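(* Let $n\ge 2$, $Q=n+2$ (so $Q\geq 4$) and $0<R\leq\infty$. Let $(V,W)$ be a $Q$-dimensional Bessel pair on $(0,R)$ with positive solution $f$ on $(0,R)$, with $V\ge 0$ and $V$ of class $C^2$, and assume that on $(0,R)$ $$(Q-5) \frac{V(\varrho)}{\varrho^{2}}+3 \frac{V_{\varrho}(\varrho)}{\varrho}-V_{\varrho\varrho}(\varrho) \geq 0 .$$ Then for every $u\in C_c^\infty(B_R(o)\setminus\{o\})$ $$\int_{B_{R}(o)} V(\varrho) \frac{(\mathcal{L}_G u)^{2}}{|\nabla_G \varrho|^{2}}\,dx\,dt \ge\int_{B_{R}(o)} W(\varrho)|\nabla_G u|^{2}\,dx\,dt +(Q-1) \int_{B_{R}(o)}\left(\frac{V(\varrho)}{\varrho^{2}}-\frac{V_{\varrho}(\varrho)}{\varrho}\right)|\nabla_G u|^2 \,dx\,dt +\int_{B_{R}(o)} V(\varrho)\left|\nabla_{G}\left(\frac{u_\varrho}{f(\varrho)}\right)\right|^{2} f^{2}(\varrho)\,dx\,dt .$$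
   Context: Grushin space: fix an integer $n\ge 2$ and put $Q=n+2$ (homogeneous dimension). Points of $\mathbb{R}^{n+1}$ are written $(x,t)$ with $x\in\mathbb{R}^n$, $t\in\mathbb{R}$; $o$ is the origin; all functions are real-valued. The Grushin gradient is $\nabla_G u=(\nabla_x u,\ |x|\partial_t u)$, so $|\nabla_G u|^2=|\nabla_x u|^2+|x|^2(\partial_t u)^2$. The Grushin operator is $\mathcal{L}_G=\Delta_x+|x|^2\partial_t^2$. The homogeneous norm is $\varrho(x,t)=(|x|^4+4t^2)^{1/4}$; it satisfies $|\nabla_G\varrho|^2=|x|^2/\varrho^2$ away from $o$. For $0<R\le\infty$, $B_R(o)=\{(x,t):\varrho(x,t)<R\}$ (so $B_\infty(o)=\mathbb{R}^{n+1}$). A suffix $\varrho$ denotes the derivative with respect to the radial variable: $u_\varrho=\partial_\varrho u=\frac1\varrho\left(\sum_{j=1}^n x_j\partial_{x_j}u+2t\,\partial_t u\right)$, and $V_\varrho=V'$, $V_{\varrho\varrho}=V''$. Integrals of nonnegative functions may take the value $+\infty$. Bessel pair: a pair $(V,W)$ of $C^1$ functions on $(0,R)$ is a $Q$-dimensional Bessel pair on $(0,R)$ with positive solution $f$ if the ODE $(r^{Q-1}V(r)y')'+r^{Q-1}W(r)y=0$ has the positive solution $y=f$ on $(0,R)$ (in the classical sense). *)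

(* Defs.v *)
From HB Require Import structures.
From mathcomp Require Import all_boot all_order all_algebra.
From mathcomp Require Import all_classical all_reals all_analysis.

Set Implicit Arguments.
Unset Strict Implicit.
Unset Printing Implicit Defensive.

Import Order.TTheory GRing.Theory Num.Theory.
Import numFieldNormedType.Exports.

Local Open Scope classical_set_scope.
Local Open Scope ring_scope.

Definition measure_rV_display : measure_display -> measure_display.
Proof. exact. Qed.

(* The product sigma-algebra on row vectors: the one generated by the
   coordinates, as the library does for tuples. *)
Section measurable_rV.
Context {d} {T : measurableType d} (n : nat).

Let coors : 'I_n -> 'rV[T]_n -> T := fun i x => x ord0 i.

Let rV_set0 : g_sigma_preimage coors set0.
Proof. exact: sigma_algebra0. Qed.

Let rV_setC A : g_sigma_preimage coors A -> g_sigma_preimage coors (~` A).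
Proof. exact: sigma_algebraC. Qed.

Let rV_bigcup (F : _^nat) : (forall i, g_sigma_preimage coors (F i)) ->
  g_sigma_preimage coors (\bigcup_i (F i)).
Proof. exact: sigma_algebra_bigcup. Qed.

HB.instance Definition _ := @isMeasurable.Build (measure_rV_display d)
  'rV[T]_n (g_sigma_preimage coors) rV_set0 rV_setC rV_bigcup.

End measurable_rV.

Section measurable_rV_theory.
Context d1 d2 (T1 : measurableType d1) (T2 : measurableType d2) (n : nat).

Lemma measurable_coord (i : 'I_n) :
  measurable_fun [set: 'rV[T2]_n] (fun x => x ord0 i).
Proof.
move=> _ Y mY; rewrite setTI; apply: sub_sigma_algebra => /=.
rewrite -bigcup_seq/=; exists i => /=; first by rewrite mem_index_enum.
by exists Y => //; rewrite setTI.
Qed.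

Lemma measurable_fun_rV (f : T1 -> 'rV[T2]_n) :
  (forall i, measurable_fun [set: T1] (fun x => f x ord0 i)) ->
  measurable_fun [set: T1] f.
Proof.
move=> mf _ A mA.
suff : preimage_set_system setT f measurable `<=` measurable.
  by apply; exists A.
rewrite -[X in X `<=` _]g_sigma_preimage_comp.
apply: smallest_sub; first exact: sigma_algebra_measurable.
case: n => [|m] in f mf A mA *; first by rewrite big_ord0.
rewrite -bigcup_mkord_ord; apply: bigcup_sub => i Ii.
by move=> B [C mC <-]; exact: mf.
Qed.

End measurable_rV_theory.

Definition rV_cons (T : Type) n (p : T * 'rV[T]_n) : 'rV[T]_n.+1 :=
  \row_i oapp (p.2 ord0) p.1 (unlift ord0 i).

Definition rV_uncons (T : Type) n (x : 'rV[T]_n.+1) : T * 'rV[T]_n :=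
  (x ord0 ord0, \row_i x ord0 (lift ord0 i)).

Lemma rV_consK (T : Type) n : cancel (@rV_cons T n) (@rV_uncons T n).
Proof.
move=> [a x]; rewrite /rV_uncons /rV_cons mxE unlift_none; congr pair.
by apply/rowP => i; rewrite !mxE liftK.
Qed.

Lemma rV_unconsK (T : Type) n : cancel (@rV_uncons T n) (@rV_cons T n).
Proof.
move=> x; apply/rowP => i; rewrite mxE /=.
by case: unliftP => [j ->|->] //=; rewrite mxE.
Qed.

Lemma measurable_rV_cons d (T : measurableType d) n :
  measurable_fun [set: T * 'rV[T]_n] (@rV_cons T n).
Proof.
apply: measurable_fun_rV => i.
case: (unliftP ord0 i) => [j ->|->].
  rewrite (_ : (fun _ => _) = (fun x : 'rV[T]_n => x ord0 j) \o snd).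
    by apply: measurableT_comp => //; exact: measurable_coord.
  by apply/funext => p /=; rewrite mxE liftK.
rewrite (_ : (fun _ => _) = fst) //.
by apply/funext => p /=; rewrite mxE unlift_none.
Qed.

Lemma measurable_rV_uncons d (T : measurableType d) n :
  measurable_fun [set: 'rV[T]_n.+1] (@rV_uncons T n).
Proof.
apply: measurable_fun_pair; first exact: measurable_coord.
apply: measurable_fun_rV => i.
rewrite (_ : (fun _ => _) = (fun x : 'rV[T]_n.+1 => x ord0 (lift ord0 i))).
  exact: measurable_coord.
by apply/funext => x; rewrite mxE.
Qed.

Section lebesgue_rV.
Context {R : realType}.
Local Notation T := (measurableTypeR R).

Section step.
Context (n : nat).
Variable mu : {sigma_finite_measure set 'rV[T]_n -> \bar R}.

Definition lebesgue_rVS : set 'rV[T]_n.+1 -> \bar R :=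
  pushforward (@lebesgue_measure R \x mu)%E (@rV_cons T n).

HB.instance Definition _ := Measure.copy lebesgue_rVS
  (measure_function_pushforward__canonical__measure_function_Measure
     [the measure _ _ of (@lebesgue_measure R \x mu)%E]
     (@measurable_rV_cons _ T n)).

Let lebesgue_rVS_sigma_finite : sigma_finite setT lebesgue_rVS.
Proof.
have /sigma_finiteP[F [TF ndF Foo]] := sigma_finiteT (@lebesgue_measure R).
have /sigma_finiteP[G [TG ndG Goo]] := sigma_finiteT mu.
exists (fun k => @rV_uncons T n @^-1` (F k `*` G k)).
  rewrite -preimage_bigcup (_ : \bigcup_i _ = setT) ?preimage_setT//.
  rewrite -subTset => -[x y] _.
  have [i _ Fx] : (\bigcup_k F k) x by rewrite -TF.
  have [j _ Gy] : (\bigcup_k G k) y by rewrite -TG.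
  exists (maxn i j) => //; split => /=.
    by move: x Fx; exact/subsetPset/ndF/leq_maxl.
  by move: y Gy; exact/subsetPset/ndG/leq_maxr.
move=> k; have [mF Fk] := Foo k; have [mG Gk] := Goo k.
have mFG : measurable (F k `*` G k) by exact: measurableX.
split.
  by rewrite -[X in measurable X]setTI; exact: measurable_rV_uncons.
rewrite /lebesgue_rVS /pushforward -comp_preimage.
rewrite (_ : _ \o _ = id); last first.
  by apply/funext => p /=; rewrite rV_consK.
by rewrite preimage_id product_measure1E// lte_mul_pinfty// ge0_fin_numE.
Qed.

HB.instance Definition _ := Measure_isSigmaFinite.Build _ _ _ lebesgue_rVS
  lebesgue_rVS_sigma_finite.
End step.

Let rV0 : 'rV[T]_0 := (0 : 'rV[R]_0).

Fixpoint lebesgue_rV n : {sigma_finite_measure set 'rV[T]_n -> \bar R} :=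
  match n with
  | 0 => @dirac _ _ rV0 R
  | m.+1 => lebesgue_rVS (lebesgue_rV m)
  end.

(* lebesgue_rV n gives boxes their volume, which characterizes it. *)
Lemma lebesgue_rV_box n (A : 'I_n -> set T) :
  (forall i, measurable (A i)) ->
  lebesgue_rV n [set x | forall i, A i (x ord0 i)] =
  (\prod_(i < n) lebesgue_measure (A i))%E.
Proof.
elim: n A => [|n IH] A mA.
  by rewrite big_ord0 /= diracE mem_set//= => -[].
have mB : measurable [set x : 'rV[T]_n | forall i, A (lift ord0 i) (x ord0 i)].
  rewrite (_ : [set _ | _] = \big[setI/setT]_(i < n)
      ((fun x : 'rV[T]_n => x ord0 i) @^-1` A (lift ord0 i))).
    apply: bigsetI_measurable => i _.
    by rewrite -[X in measurable X]setTI; exact: measurable_coord.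
  apply/seteqP; split => x /=.
    by move=> Ax; elim/big_ind: _ => //= *; split.
  by move=> Ax i; move: Ax; rewrite (bigD1 i)//= => -[].
rewrite big_ord_recl /= -IH// /lebesgue_rVS /pushforward.
rewrite -product_measure1E//; congr (_ _).
apply/seteqP; split => [[a x] /= Ax|[a x] /= [Aa Ax] i].
  split=> [|i /=].
    by have := Ax ord0; rewrite /rV_cons mxE unlift_none.
  by have := Ax (lift ord0 i); rewrite /rV_cons mxE liftK.
rewrite /rV_cons mxE.
by case: unliftP => [j ->|->].
Qed.

End lebesgue_rV.

(* Points of R^(n+1) are pairs (x, t). The library norm on 'rV[R]_n is the sup
   norm; it is used only through the topology it induces. *)
Section grushin.
Context {R : realType} {n : nat}.
Local Notation point := ('rV[R]_n * R)%type.
Implicit Types (u : point -> R) (p : point).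

(* Some i stands for the coordinate x_i and None for t. *)
Definition coord_dir (k : option 'I_n) : point :=
  if k is Some i then (delta_mx 0 i, 0) else (0, 1).

Definition partial (k : option 'I_n) u : point -> R := 'D_(coord_dir k) u.

Definition smooth u : Prop :=
  forall s : seq (option 'I_n), let v := foldr partial u s in
    continuous v /\ forall p k, derivable v p (coord_dir k).

Definition support u : set point := closure [set p | u p != 0].

Definition test_function (U : set point) u : Prop :=
  [/\ smooth u, compact (support u) & support u `<=` U].

Definition enorm (x : 'rV[R]_n) : R := Num.sqrt (\sum_i x 0 i ^+ 2).

Definition sqnorm p : R := enorm p.1 ^+ 2 + p.2 ^+ 2.

Definition gradG u p : point :=
  (\row_i partial (Some i) u p, enorm p.1 * partial None u p).

Definition grushin_op u p : R :=
  \sum_i partial (Some i) (partial (Some i) u) p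
  + enorm p.1 ^+ 2 * partial None (partial None u) p.

(* rho is not differentiable at the origin, and gradG rho vanishes where x = 0;
   both sets are null for n >= 1. *)
Definition rho p : R := (enorm p.1 ^+ 4 + 4 * p.2 ^+ 2) `^ 4^-1.

Definition grushin_ball (rad : \bar R) : set point :=
  [set p | ((rho p)%:E < rad)%E].

Definition radial_derivative u p : R :=
  (rho p)^-1 * (\sum_i p.1 0 i * partial (Some i) u p
                + 2 * p.2 * partial None u p).

End grushin.

Definition grushin_measure {R : realType} (n : nat) :=
  [the measure _ _ of (lebesgue_rV n \x @lebesgue_measure R)%E].
Arguments grushin_measure {R} n.

Section bessel.
Context {R : realType}.
Implicit Types (A : set R) (V W f g : R -> R) (rad : \bar R).

Definition radii rad : set R := [set r | 0 < r /\ (r%:E < rad)%E].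

(* The continuity is stated at each point of A, which agrees with continuity
   on A since A is always open here. *)
Definition C1_on A g : Prop :=
  forall r, A r -> derivable g r 1 /\ {for r, continuous (derive1 g)}.

Definition C2_on A g : Prop := C1_on A g /\ C1_on A (derive1 g).

(* y is a pointwise solution on (0, rad): y and r^(N-1) V(r) y'(r) are
   differentiable and the equation holds everywhere. *)
Definition bessel_solution (N : nat) rad V W y : Prop :=
  forall r, radii rad r ->
  let flux s := s ^+ N.-1 * V s * derive1 y s in
  [/\ derivable y r 1, derivable flux r 1 &
      derive1 flux r + r ^+ N.-1 * W r * y r = 0].

Definition bessel_pair (N : nat) rad V W f : Prop :=
  [/\ C1_on (radii rad) V, C1_on (radii rad) W,
      forall r, radii rad r -> 0 < f r & bessel_solution N rad V W f].

End bessel.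

(* Main.v *)
(* Write [E] for the dilation field, so that [u_rho = Eu / rho], and split every
   quantity into a radial and a tangential part: with [sig = |x|^2 / rho^4],
   [|gradG u|^2 = q(u,u) + sig (Eu)^2] and [L u = S u + sig (EEu + n Eu)], where
   the tangential form [q >= 0] annihilates functions of [rho] and [S] is its
   operator.  For [psi = |gradG rho|^2] bound [(Lu)^2 / psi] from below by
   [2 k Lu - psi k^2]; the choice [rho^2 k = EEu + n Eu - (Q-1) (u - c)] with
   [c] a function of [rho] reduces the theorem, after integrations by parts
   along [E], to three facts.
   (1) Hardy's inequality for the Bessel pair, applied to [sig (Eu)^2] and to
   [q(u,u)]; it follows from Fatou's lemma, as [V f' / f] is only differentiable.
   (2) The curvature-type hypothesis on [V], the coefficient of [q(u,u)] that is
   left over.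
   (3) The spectral gap [int phi q(w,w) >= (Q-1) int phi sig w^2] for [w = u - c]
   up to [eps], [phi = V / rho^2].  The functions [x.e] and [t] are eigenfunctions,
   [S z = - l sig z] with [l >= Q-1], and a ground state substitution gives
   the gap for functions dominated by one of them.  The odd part of [u] under the
   reflection of [x] along [e] is dominated by [x.e], so averaging over
   reflections only lowers the form; averaging until [u] is nearly a function of
   [|x|] and [t], and subtracting its value [c] on a ray where [t = 0], leaves a
   function dominated by [t] up to a small error. *)
From HB Require Import structures.
Require Import Defs.
From mathcomp Require Import all_boot all_order all_algebra.
From mathcomp Require Import all_classical all_reals all_analysis.
From mathcomp Require Import measurable_realfun ring lra.

Set Implicit Arguments.
Unset Strict Implicit.
Unset Printing Implicit Defensive.

Import Order.TTheory GRing.Theory Num.Theory.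
Import numFieldNormedType.Exports.

Local Open Scope classical_set_scope.
Local Open Scope ring_scope.

(** * Translation invariance of the measure *)

(** The pointwise optimal [k] is [Lu / psi], that is [rho^2 k = EEu + n Eu + Su / sig], which is
    singular on the axis [x = 0]. The choice made puts [- (Q-1) (u - c)] for [Su / sig], the exact
    value when [u - c] is an eigenfunction for [Q-1]; the lower bound for the left-hand side is then
    bounded with compact support, and the loss is what the spectral gap controls. The number [Q-1]
    comes from homogeneity: [L] kills the linear functions [x.e] and [t], so that
    [Sz = - (a^2 + n a) sig z] in degree [a], which gives [n + 1 = Q-1] for [x.e] and [2 n + 4] for
    [t]. Two obstacles shape the rest. [V] may vanish, so [f'] is not known to be continuous and an
    exact integration by parts against [V f' / f] is out of reach; Hardy's inequality is therefore
    one-sided, with extended integrals. The eigenfunctions have zeros, so the quotient [1 / z] of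
    the ground state substitution is regularised; this costs an [eps], which tends to [0] only at
    the very end, [c] and [k] being chosen anew for each [eps]. *)

Section translation_invariance.
Context {R : realType}.
Local Notation T := (measurableTypeR R).

Lemma measurable_addT (a : R) :
  measurable_fun [set: T] ((fun x => x + a) : T -> T).
Proof. by apply: measurable_realfun.measurable_funD. Qed.

(** The image measure gives half-open intervals their length, which determines Lebesgue measure. *)
Lemma lebesgue_measure_translate (a : R) (A : set T) : measurable A ->
  lebesgue_measure ((fun x : T => x + a : T) @^-1` A) = lebesgue_measure A.
Proof.
move=> mA; pose nu := pushforward (@lebesgue_measure R)
  ((fun x => x + a) : T -> T).
pose nu' := [the measure _ _ of measure_function_pushforward__canonical__measure_function_Measure
   (@lebesgue_measure R) (measurable_addT a)].
apply/esym; apply: (lebesgue_measure_unique (mu := nu')) => //= _ [[b c]] _ <-.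
rewrite /pushforward.
rewrite (_ : _ @^-1` _ = `]b - a, c - a]%classic); last first.
  by apply/seteqP; split=> x /=; rewrite !in_itv/= ltrBlDr lerBrDr.
rewrite !lebesgue_measure_itv/= !lte_fin ltrD2r; case: ifPn => // _.
by rewrite -!EFinB; congr EFin; ring.
Qed.

(** Two measures that agree on measurable rectangles agree on the product. This carries the
    induction on the dimension in [lebesgue_rV_translate], and then adds the variable [t]. *)
Lemma product_measure_preserved d1 d2 (T1 : measurableType d1)
    (T2 : measurableType d2) (m1 : {sigma_finite_measure set T1 -> \bar R})
    (m2 : {sigma_finite_measure set T2 -> \bar R})
    (f1 : T1 -> T1) (f2 : T2 -> T2) :
  measurable_fun setT f1 -> measurable_fun setT f2 ->
  (forall A, measurable A -> m1 (f1 @^-1` A) = m1 A) ->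
  (forall A, measurable A -> m2 (f2 @^-1` A) = m2 A) ->
  forall A, measurable A ->
    (m1 \x m2)%E ((fun p => (f1 p.1, f2 p.2)) @^-1` A) = (m1 \x m2)%E A.
Proof.
move=> mf1 mf2 f1E f2E A mA.
have mf : measurable_fun setT (fun p : T1 * T2 => (f1 p.1, f2 p.2)).
  by apply: measurable_fun_pair; apply: measurableT_comp.
pose nu := [the measure _ _ of measure_function_pushforward__canonical__measure_function_Measure
   [the measure _ _ of (m1 \x m2)%E] mf].
apply/esym; apply: (@product_measure_unique _ _ _ _ _ m1 m2 nu) => // B C mB mC.
rewrite /= /pushforward (_ : _ @^-1` _ = (f1 @^-1` B) `*` (f2 @^-1` C)) //.
have mB' : measurable (f1 @^-1` B) by rewrite -[X in measurable X]setTI; exact: mf1.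
have mC' : measurable (f2 @^-1` C) by rewrite -[X in measurable X]setTI; exact: mf2.
rewrite product_measure1E//.
by congr (_ * _)%E; [exact: f1E|exact: f2E].
Qed.

Lemma measurable_rV_translate n (a : 'rV[R]_n) :
  measurable_fun [set: 'rV[T]_n] ((fun x : 'rV[R]_n => x + a) : 'rV[T]_n -> 'rV[T]_n).
Proof.
apply: measurable_fun_rV => i.
rewrite (_ : (fun _ => _) = (fun x : T => x + a 0 i : T) \o
   (fun x : 'rV[T]_n => x ord0 i)); last first.
  by apply/funext => x /=; rewrite mxE.
by apply: measurableT_comp; [exact: measurable_addT|exact: measurable_coord].
Qed.

Lemma lebesgue_rV_translate n (a : 'rV[R]_n) (A : set 'rV[T]_n) :
  measurable A ->
  lebesgue_rV n ((fun x : 'rV[R]_n => x + a : 'rV[T]_n) @^-1` A) =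
  lebesgue_rV n A.
Proof.
elim: n a A => [|n IH] a A mA.
  congr (lebesgue_rV 0 _); apply/seteqP.
  by split=> x /=; rewrite [a](thinmx0) addr0.
have mA' : measurable (@rV_cons T n @^-1` A).
  by rewrite -[X in measurable X]setTI; exact: measurable_rV_cons.
rewrite /= /lebesgue_rVS /pushforward.
rewrite -[RHS](@product_measure_preserved _ _ _ _ (@lebesgue_measure R) (lebesgue_rV n)
   (fun x : T => x + a 0 0 : T)
   (fun x : 'rV[R]_n => x + (\row_i a 0 (lift ord0 i)) : 'rV[T]_n))//.
- congr (product_measure1 _ _ _); apply/seteqP.
  have E (p : R * 'rV[R]_n) : rV_cons p + a =
      rV_cons (p.1 + a 0 0, p.2 + \row_i a 0 (lift ord0 i)).
    apply/rowP => j; rewrite !mxE.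
    by case: unliftP => [k ->|->] /=; rewrite ?mxE.
  by split => p Ap; [exact: (eq_ind _ A Ap _ (E p))|exact: (eq_ind _ A Ap _ (esym (E p)))].
- exact: measurable_addT.
- exact: measurable_rV_translate.
- by move=> B mB; exact: lebesgue_measure_translate.
- by move=> B mB; exact: IH.
Qed.

Lemma measurable_grushin_translate n (a : 'rV[R]_n * R) :
  measurable_fun [set: 'rV[T]_n * T]
    ((fun p : 'rV[R]_n * R => p + a) : 'rV[T]_n * T -> 'rV[T]_n * T).
Proof.
apply: measurable_fun_pair => /=.
  by apply: (measurableT_comp (measurable_rV_translate a.1)).
by apply: (measurableT_comp (measurable_addT a.2)).
Qed.

Lemma grushin_measure_translate n (a : 'rV[R]_n * R)
    (A : set ('rV[T]_n * T)) : measurable A ->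
  grushin_measure n ((fun p : 'rV[R]_n * R => p + a) @^-1` A) =
  grushin_measure n A.
Proof.
move=> mA; rewrite /grushin_measure /=.
rewrite -[RHS](@product_measure_preserved _ _ _ _ (lebesgue_rV n) (@lebesgue_measure R)
   (fun x : 'rV[R]_n => x + a.1 : 'rV[T]_n)
   (fun x : T => x + a.2 : T))//.
- exact: measurable_rV_translate.
- exact: measurable_addT.
- by move=> B mB; exact: lebesgue_rV_translate.
- by move=> B mB; exact: lebesgue_measure_translate.
Qed.

End translation_invariance.

(** * Measurability of continuous functions *)

Section continuous_measurable.
Context {R : realType}.
Local Notation T := (measurableTypeR R).

Lemma rV_norm_le n (x : 'rV[R]_n) e : 0 <= e ->
  (forall i, `|x 0 i| <= e) -> `|x| <= e.
Proof.
move=> e0 h; rewrite /Num.norm /= mx_normrE; apply: bigmax_le => //.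
by move=> [i j] _; rewrite ord1.
Qed.

Lemma rV_coord_le_norm n (x : 'rV[R]_n) i : `|x 0 i| <= `|x|.
Proof.
rewrite {2}/Num.norm /= mx_normrE.
exact: (@le_bigmax_cond _ _ _ _ (0, i) xpredT (fun i : 'I_1 * 'I_n => `|x i.1 i.2|)).
Qed.

Lemma measurable_rV_box n (A : 'I_n -> set T) :
  (forall i, measurable (A i)) ->
  measurable [set x : 'rV[T]_n | forall i, A i (x ord0 i)].
Proof.
move=> mA; rewrite (_ : [set _ | _] =
  \bigcap_(i in [set: 'I_n]) ((fun x : 'rV[T]_n => x ord0 i) @^-1` A i)); last first.
  by apply/seteqP; split => x /= Ax i => [_|]; exact: Ax.
apply: fin_bigcap_measurable => [|i _]; first exact: finite_finset.
by rewrite -[X in measurable X]setTI; exact: measurable_coord.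
Qed.

Lemma measurable_floor_fiber (c : R) (m : int) :
  measurable [set x : T | Num.floor (c * x) = m].
Proof.
rewrite (_ : [set _ | _] = ( *%R c : T -> T) @^-1` `[m%:~R, (m + 1)%:~R[%classic).
  by rewrite -[X in measurable X]setTI; apply: measurable_realfun.mulrl_measurable.
apply/seteqP; split => x /=; rewrite in_itv/=.
  by move=> <-; exact: floor_itv.
by move=> h; apply: floor_def.
Qed.

Lemma floor_approx (k : nat) (x : R) :
  `|x - (Num.floor (k.+1%:R * x))%:~R / k.+1%:R| <= k.+1%:R^-1.
Proof.
have /andP[h1 h2] := floor_itv (k.+1%:R * x).
have k0 : (0 : R) < k.+1%:R by rewrite ltr0n.
have kn0 : (k.+1%:R : R) != 0 by rewrite gt_eqF.
set m := (Num.floor _)%:~R in h1 *.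
have h3 : k.+1%:R * x < m + 1 by rewrite /m -intrD1.
rewrite (_ : x - m / k.+1%:R = (k.+1%:R * x - m) / k.+1%:R); last by field.
rewrite normrM normfV (ger0_norm (ltW k0)) -[leRHS]mul1r ler_pM2r ?invr_gt0//.
by rewrite ler_norml; apply/andP; split; lra.
Qed.

(** The sigma-algebra is generated by coordinates, so the preimages of open sets are not measurable
    by definition. Instead [g] is the pointwise limit of its values at the corners of a grid of mesh
    [1 / (k+1)]; each of these step functions takes countably many values, on products of half-open
    intervals. *)
Lemma measurable_continuous n (g : 'rV[R]_n * R -> R) : continuous g ->
  measurable_fun [set: 'rV[T]_n * T] (g : 'rV[T]_n * T -> R).
Proof.
move=> cg.
pose idx k (p : 'rV[R]_n * R) : 'rV[int]_n * int :=
  (\row_i Num.floor (k.+1%:R * p.1 0 i), Num.floor (k.+1%:R * p.2)).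
pose pt k (c : 'rV[int]_n * int) : 'rV[R]_n * R :=
  (\row_i ((c.1 0 i)%:~R / k.+1%:R), c.2%:~R / k.+1%:R).
apply: (@measurable_realfun.measurable_fun_cvg _ _ _ _ (fun k p => g (pt k (idx k p)))).
  move=> k _ Y mY; rewrite setTI.
  rewrite (_ : _ @^-1` Y = \bigcup_(c : 'rV[int]_n * int)
     (if `[< Y (g (pt k c)) >] then [set p | idx k p = c] else set0)); last first.
    apply/seteqP; split => p /=.
      by move=> Yp; exists (idx k p) => //; rewrite asboolT.
    by move=> [c _]; case: asboolP => // Yc /= ->.
  apply: countable_bigcupT_measurable => // c.
  case: ifPn => _; last exact: measurable0.
  rewrite (_ : [set p | _] =
      [set x : 'rV[T]_n | forall i, [set y | Num.floor (k.+1%:R * y) = c.1 0 i] (x ord0 i)]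
      `*` [set t : T | Num.floor (k.+1%:R * t) = c.2]); last first.
    apply/seteqP; split => -[x t] /=.
      by rewrite /idx => <- /=; split => // i; rewrite mxE.
    case: c => c1 c2 /= [h1 h2]; rewrite /idx h2 /=; congr pair.
    by apply/rowP => i; rewrite mxE h1.
  apply: measurableX; last exact: measurable_floor_fiber.
  apply: (@measurable_rV_box n
    (fun i => [set y : T | Num.floor (k.+1%:R * y) = c.1 0 i])) => i.
  exact: measurable_floor_fiber.
move=> p _; apply: continuous_cvg; first exact: cg.
apply/cvgrPdist_le => e e0.
have ke0 : \forall k \near \oo, (k.+1%:R : R)^-1 <= e.
  exists (Num.bound e^-1) => // m /= hm.
  rewrite invf_ple ?posrE//.
  apply: ltW; apply: lt_le_trans (archi_boundP _) _; first by rewrite invr_ge0 ltW.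
  by rewrite ler_nat (leq_trans hm).
near=> k.
have ke : (k.+1%:R : R)^-1 <= e by near: k.
rewrite prod_normE ge_max; apply/andP; split => /=.
  apply: rV_norm_le; first exact: ltW.
  by move=> i; rewrite !mxE; apply: le_trans ke; exact: floor_approx.
by apply: le_trans ke; exact: floor_approx.
Unshelve. all: by end_near. Qed.

End continuous_measurable.

(** * Integration of bounded functions with bounded support *)

Section bounded_integrals.
Context {R : realType} {n : nat}.
Local Notation T := (measurableTypeR R).
Local Notation X := ('rV[R]_n * R)%type.
Local Notation mu := (@grushin_measure R n).
Implicit Types (g h : X -> R) (p : X).

Definition box (M : R) : set X := [set p | `|p| <= M].

Lemma prod_norm_le p e : `|p.1| <= e -> `|p.2| <= e -> `|p| <= e.
Proof. by move=> h1 h2; rewrite prod_normE ge_max h1. Qed.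

Lemma norm_fst_le p : `|p.1| <= `|p|.
Proof. by rewrite prod_normE le_max lexx. Qed.

Lemma norm_snd_le p : `|p.2| <= `|p|.
Proof. by rewrite prod_normE le_max lexx orbT. Qed.

Lemma box_prod M : box M = [set x : 'rV[R]_n | `|x| <= M] `*` [set t | `|t| <= M].
Proof.
apply/seteqP; split => p /=.
  by rewrite /box/= prod_normE ge_max => /andP[].
by move=> [h1 h2]; exact: prod_norm_le.
Qed.

Lemma compact_box M : compact (box M).
Proof.
rewrite box_prod; apply: compact_setX.
  apply: bounded_closed_compact.
    exists M; split; first exact: num_real.
    by move=> x Mx y /= /le_trans; apply; exact: ltW.
  rewrite (_ : [set _ | _] = (fun x => `|x|) @^-1` [set t | t <= M]) //.
  by apply: preimage_closed => [x _|]; [exact: norm_continuous|exact: closed_le].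
rewrite (_ : [set _ | _] = `[- M, M]%classic); first exact: segment_compact.
by apply/seteqP; split => t /=; rewrite in_itv/= ler_norml.
Qed.

Lemma measurable_box M : measurable (box M : set ('rV[T]_n * T)).
Proof.
rewrite (_ : box M = (fun p => `|p|) @^-1` `]-oo, M]%classic); last first.
  by apply/seteqP; split => p /=; rewrite in_itv.
rewrite -[X in measurable X]setTI.
apply: (measurable_continuous (@norm_continuous _ X)) => //.
Qed.

Lemma mu_box_lty M : (mu (box M) < +oo)%E.
Proof.
pose B := [set x : 'rV[T]_n | forall i, `[- M, M]%classic (x ord0 i)] `*` `[- M, M]%classic.
have mB1 : measurable [set x : 'rV[T]_n | forall i, `[- M, M]%classic (x ord0 i)].
  by apply: (@measurable_rV_box _ n (fun=> `[- M, M]%classic)).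
have mB : measurable (B : set ('rV[T]_n * T)) by exact: measurableX.
apply: (@le_lt_trans _ _ (mu B)).
  apply: le_measure; rewrite ?inE//; first exact: measurable_box.
  rewrite box_prod => -[x t] /= [hx ht]; split => /= [i|]; rewrite in_itv/= -ler_norml//.
  exact: le_trans (rV_coord_le_norm _ _) hx.
rewrite /grushin_measure /= product_measure1E//.
have fin : (lebesgue_measure (`[(- M)%R, M]%classic : set T) < +oo)%E.
  rewrite lebesgue_measure_itv/=; case: ifPn => // _.
  by rewrite -EFinB ltry.
pose B1 : set 'rV[T]_n := [set x | forall i, `[- M, M]%classic (x ord0 i)].
have finB : (lebesgue_rV n B1 < +oo)%E.
  rewrite /B1.
  have -> := @lebesgue_rV_box R n (fun=> `[- M, M]%classic) (fun=> measurable_itv _).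
  suff /andP[] : (0 <= \prod_(i < n) lebesgue_measure (`[(- M)%R, M]%classic : set T) < +oo)%E by [].
  apply: (big_ind (fun x => 0 <= x < +oo)%E) => [|x y /andP[x0 xoo] /andP[y0 yoo]|i _].
  - by rewrite lee01 ltry.
  - by rewrite mule_ge0// lte_mul_pinfty// ge0_fin_numE.
  - by rewrite measure_ge0.
by rewrite lte_mul_pinfty// ge0_fin_numE.
Qed.

(** The working class for real-valued integrals: a vector space on which [I] is linear and monotone
    without separate integrability conditions, and in which a multiple of the indicator of a box
    serves as integrable majorant. *)
Definition bb g : Prop := measurable_fun [set: 'rV[T]_n * T] g /\
  exists C M, forall p, `|g p| <= C /\ (M < `|p| -> g p = 0).

Lemma bb_integrable g : bb g -> mu.-integrable setT (EFin \o g).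
Proof.
move=> [mg [C [M gCM]]].
apply: (@le_integrable _ _ _ mu setT _ _ (fun p => (C * \1_(box M) p)%:E)) => //.
- exact/measurable_realfun.measurable_EFinP.
- move=> p _ /=; rewrite lee_fin.
  have [gC gM] := gCM p; have C0 : 0 <= C by exact: le_trans gC.
  rewrite indicE; have [pM|pM] := leP `|p| M.
    by rewrite mem_set//= mulr1 (ger0_norm C0).
  by rewrite gM// normr0.
- have [C0|C0] := ltP C 0.
    by have [h _] := gCM 0; have := lt_le_trans C0 (normr_ge0 (g 0)); rewrite ltNge h.
  under eq_fun do rewrite EFinM.
  apply: integrableZl => //; apply/integrableP; split.
    apply/measurable_realfun.measurable_EFinP; apply: measurable_realfun.measurable_indic; exact: measurable_box.
  have := @integral_indic _ _ _ mu setT measurableT _ (measurable_box M).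
  rewrite setIT => E.
  apply: (le_lt_trans _ (mu_box_lty M)); rewrite -E.
  rewrite le_eqVlt; apply/orP; left; apply/eqP.
  by apply: eq_integral => p _; rewrite gee0_abs.
Qed.

Definition I g : R := \int[mu]_p g p.

Lemma integral_bb g : bb g -> (\int[mu]_p (g p)%:E = (I g)%:E)%E.
Proof.
move=> /bb_integrable ig; rewrite /I /Rintegral fineK//.
exact: integrable_fin_num ig.
Qed.

Lemma bbD g h : bb g -> bb h -> bb (fun p => g p + h p).
Proof.
move=> [mg [C [M gC]]] [mh [C' [M' hC]]]; split.
  exact: measurable_realfun.measurable_funD.
exists (C + C'), (Num.max M M') => p; have [g1 g2] := gC p; have [h1 h2] := hC p.
split; first by rewrite (le_trans (ler_normD _ _))// lerD.
by rewrite gt_max => /andP[/g2 -> /h2 ->]; rewrite addr0.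
Qed.

Lemma bbZ a g : bb g -> bb (fun p => a * g p).
Proof.
move=> [mg [C [M gC]]]; split; first exact: measurable_realfun.measurable_funM.
exists (`|a| * C), M => p; have [g1 g2] := gC p.
by split => [|/g2 ->]; rewrite ?mulr0// normrM ler_wpM2l.
Qed.

Lemma bbN g : bb g -> bb (fun p => - g p).
Proof.
by move=> /(bbZ (-1)); congr bb; apply/funext => p; rewrite mulN1r.
Qed.

Lemma bbB g h : bb g -> bb h -> bb (fun p => g p - h p).
Proof. by move=> bg bh; apply: bbD => //; exact: bbN. Qed.

Lemma bb0 : bb (fun=> 0).
Proof.
split; first exact: measurable_cst.
by exists 0, 0 => p; rewrite normr0.
Qed.

Lemma bb_sum (J : Type) (r : seq J) (F : J -> X -> R) :
  (forall j, bb (F j)) -> bb (fun p => \sum_(j <- r) F j p).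
Proof.
move=> bF; elim: r => [|j r IH].
  by under eq_fun do rewrite big_nil; exact: bb0.
by under eq_fun do rewrite big_cons; exact: bbD.
Qed.

Lemma eq_I g h : g =1 h -> I g = I h.
Proof. by move=> /funext ->. Qed.

Lemma ID g h : bb g -> bb h -> I (fun p => g p + h p) = I g + I h.
Proof. by move=> bg bh; rewrite /I RintegralD//; exact: bb_integrable. Qed.

Lemma IZ a g : bb g -> I (fun p => a * g p) = a * I g.
Proof. by move=> bg; rewrite /I RintegralZl//; exact: bb_integrable. Qed.

Lemma IN g : bb g -> I (fun p => - g p) = - I g.
Proof.
move=> bg; rewrite -mulN1r -IZ//; apply: eq_I => p; by rewrite mulN1r.
Qed.

Lemma IB g h : bb g -> bb h -> I (fun p => g p - h p) = I g - I h.
Proof. by move=> bg bh; rewrite ID ?IN//; exact: bbN. Qed.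

Lemma I0 : I (fun=> 0) = 0.
Proof.
rewrite (@eq_I _ (fun p => 0 * (fun=> 0 : R) p)) => [|p]; last by rewrite mulr0.
by rewrite IZ ?mul0r//; exact: bb0.
Qed.

Lemma I_sum (J : Type) (r : seq J) (F : J -> X -> R) :
  (forall j, bb (F j)) -> I (fun p => \sum_(j <- r) F j p) = \sum_(j <- r) I (F j).
Proof.
move=> bF; elim: r => [|j r IH].
  by under eq_I do rewrite big_nil; rewrite big_nil I0.
under eq_I do rewrite big_cons; rewrite ID ?IH ?big_cons//.
exact: bb_sum.
Qed.

Lemma I_le g h : bb g -> bb h -> (forall p, g p <= h p) -> I g <= I h.
Proof.
move=> bg bh gh; apply: le_Rintegral => //; exact: bb_integrable.
Qed.

Lemma I_ge0 g : (forall p, 0 <= g p) -> 0 <= I g.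
Proof. by move=> g0; apply: Rintegral_ge0. Qed.

Lemma bb_continuous g M : continuous g -> (forall p, M < `|p| -> g p = 0) -> bb g.
Proof.
move=> cg gM; split; first exact: measurable_continuous.
have /compact_bounded[C [_ gC]] : compact (g @` box M).
  by apply: continuous_compact; [exact: continuous_subspaceT|exact: compact_box].
exists (`|C| + 1), M => p; split; last exact: gM.
have [pM|pM] := leP `|p| M; last by rewrite gM// normr0 addr_ge0.
apply: (gC (`|C| + 1)); first by rewrite (le_lt_trans (ler_norm _))// ltrDl.
by exists p.
Qed.

Lemma ge0_integral_preserved (phi : 'rV[T]_n * T -> 'rV[T]_n * T)
    (f : 'rV[T]_n * T -> \bar R) :
  measurable_fun [set: 'rV[T]_n * T] phi ->
  (forall A, measurable A -> mu (phi @^-1` A) = mu A) ->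
  measurable_fun [set: 'rV[T]_n * T] f -> (forall p, 0 <= f p)%E ->
  (\int[mu]_p f (phi p) = \int[mu]_p f p)%E.
Proof.
move=> mphi phiE mf f0.
have E := @ge0_integral_pushforward _ _ _ _ R phi mphi mu setT f measurableT mf
  (fun p _ => f0 p).
transitivity (\int[pushforward mu phi]_p f p)%E; first exact: esym E.
by apply: eq_measure_integral => A mA _; exact: phiE.
Qed.

Lemma I_preserved (phi : 'rV[T]_n * T -> 'rV[T]_n * T) g :
  measurable_fun [set: 'rV[T]_n * T] phi ->
  (forall A, measurable A -> mu (phi @^-1` A) = mu A) ->
  bb g -> I (fun p => g (phi p)) = I g.
Proof.
move=> mphi phiE bg; have [mg _] := bg.
have mg' : measurable_fun [set: 'rV[T]_n * T] (EFin \o (g : 'rV[T]_n * T -> R)).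
  exact/measurable_realfun.measurable_EFinP.
have E1 := @ge0_integral_preserved phi _ mphi phiE (measurable_funepos mg')
  (fun p => funepos_ge0 _ p).
have E2 := @ge0_integral_preserved phi _ mphi phiE (measurable_funeneg mg')
  (fun p => funeneg_ge0 _ p).
rewrite /I /Rintegral; congr fine.
rewrite integralE [RHS]integralE; congr (_ - _)%E.
  by refine (eq_trans _ (eq_trans E1 _)); apply: eq_integral => x _; rewrite !funeposE.
by refine (eq_trans _ (eq_trans E2 _)); apply: eq_integral => x _; rewrite !funenegE.
Qed.

Lemma I_translate g (a : X) : bb g -> I (fun p => g (p + a)) = I g.
Proof.
move=> bg; apply: (I_preserved (measurable_grushin_translate a)) => // A mA.
exact: grushin_measure_translate.
Qed.

Lemma I_dominated (G : nat -> X -> R) g C M :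
  (forall k, measurable_fun [set: 'rV[T]_n * T] (G k)) ->
  (forall k p, `|G k p| <= C) -> (forall k p, M < `|p| -> G k p = 0) ->
  (forall p, G k p @[k --> \oo] --> g p) ->
  bb g /\ I (G k) @[k --> \oo] --> I g.
Proof.
move=> mG GC GM Gg.
have mg : measurable_fun [set: 'rV[T]_n * T] g.
  by apply: (@measurable_realfun.measurable_fun_cvg _ _ _ _ G) => // p _; exact: Gg.
have bG k : bb (G k) by split => //; exists C, M => p; split; [exact: GC|exact: GM].
have bg : bb g.
  split => //; exists C, M => p; split.
    have /cvg_lim <- // : `|G k p| @[k --> \oo] --> `|g p| by apply: cvg_norm; exact: Gg.
    apply: limr_le; first by apply: cvgP; apply: cvg_norm; exact: Gg.
    by apply: nearW => k; exact: GC.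
  move=> pM; have /cvg_lim <- // := Gg p.
  rewrite (_ : (fun k => G k p) = (fun=> 0)); last by apply/funext => k; rewrite GM.
  by apply: cvg_lim => //; exact: cvg_cst.
split => //; apply: fine_cvg.
rewrite fineK; last by apply: integrable_fin_num => //; exact: bb_integrable.
pose h p := (C * \1_(box M) p).
apply: (@dominated_cvg _ _ _ mu setT _ (fun k p => (G k p)%:E) (fun p => (g p)%:E)
  (fun p => (h p)%:E)) => //=.
- by move=> k; exact/measurable_realfun.measurable_EFinP.
- by move=> p _; apply: cvg_EFin; [exact: nearW|exact: Gg].
- apply: bb_integrable; split.
    apply: measurable_realfun.measurable_funM => //.
    by apply: measurable_realfun.measurable_indic; exact: measurable_box.
  have C0 : 0 <= C by exact: le_trans (GC 0%N 0).
  exists C, M => p; rewrite /h indicE; split.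
    rewrite normrM ger0_norm// ler_piMr//; case: (_ \in _) => /=; by rewrite ?normr1 ?normr0.
  by move=> pM; rewrite memNset ?mulr0//= /box/= => /le_lt_trans/(_ pM); rewrite ltxx.
- move=> k p _; rewrite lee_fin /h indicE.
  have [pM|pM] := leP `|p| M; first by rewrite mem_set// mulr1.
  by rewrite GM// normr0 mulr_ge0// (le_trans _ (GC 0%N 0)).
Qed.

End bounded_integrals.

(** * Directional derivatives *)

Section derivative_rules.
Context {R : realType} {V : normedModType R}.
Implicit Types (g h : V -> R) (p v w : V).

Lemma isD_eq p v g dg dg' : is_derive p v g dg -> dg = dg' -> is_derive p v g dg'.
Proof. by move=> ? <-. Qed.

Lemma isD_near p v g h dg : (\near p, g p = h p) ->
  is_derive p v g dg -> is_derive p v h dg.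
Proof.
move=> gh [d e]; split; first exact: near_eq_derivable gh d.
by rewrite -e; apply: near_eq_derive; near=> q; apply/esym; near: q.
Unshelve. all: by end_near. Qed.

Lemma isD_cst p v (a : R) : is_derive p v (fun=> a) 0.
Proof. exact: is_derive_cst. Qed.

Lemma isD_add p v g h dg dh : is_derive p v g dg -> is_derive p v h dh ->
  is_derive p v (fun q => g q + h q) (dg + dh).
Proof. exact: is_deriveD. Qed.

Lemma isD_opp p v g dg : is_derive p v g dg ->
  is_derive p v (fun q => - g q) (- dg).
Proof. exact: is_deriveN. Qed.

Lemma isD_mul p v g h dg dh : is_derive p v g dg -> is_derive p v h dh ->
  is_derive p v (fun q => g q * h q) (dg * h p + g p * dh).
Proof.
move=> dg' dh'; apply: isD_eq (is_deriveM dg' dh') _.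
by rewrite addrC; congr (_ + _); rewrite /GRing.scale/= mulrC.
Qed.

Lemma isD_inv p v g dg : g p != 0 -> is_derive p v g dg ->
  is_derive p v (fun q => (g q)^-1) (- (g p)^-1 ^+ 2 * dg).
Proof.
move=> g0 [d e]; split; first exact: derivableV.
by rewrite deriveV// e exprVn.
Qed.

Lemma isD_sum p v (J : Type) (r : seq J) (F : J -> V -> R) (dF : J -> R) :
  (forall j, is_derive p v (F j) (dF j)) ->
  is_derive p v (fun q => \sum_(j <- r) F j q) (\sum_(j <- r) dF j).
Proof.
move=> dFj; elim: r => [|j r IH].
  by rewrite big_nil; under eq_fun do rewrite big_nil; exact: isD_cst.
by rewrite big_cons; under eq_fun do rewrite big_cons; exact: isD_add.
Qed.

End derivative_rules.

Section directional_derivatives.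
Context {R : realType} {V : normedModType R}.
Implicit Types (g h : V -> R) (p v w : V).

(** Restricting to a line turns a directional derivative into an ordinary one, so that the chain
    rule and the mean value theorem are available without total differentiability. *)
Lemma isD_line p v g (s dg : R) :
  is_derive (s *: v + p) v g dg <->
  is_derive s 1 (fun t : R => g (t *: v + p)) dg.
Proof.
have E : (fun h : R => h^-1 *: (g (h *: v + (s *: v + p)) - g (s *: v + p))) =
    (fun h : R => h^-1 *: (g ((h *: 1 + s) *: v + p) - g (s *: v + p))).
  by apply/funext => h; rewrite addrA scalerDl [h *: 1]mulr1.
split=> -[d e]; split; move: d e; rewrite /derivable /derive;
  first [by rewrite E | by rewrite E | by rewrite E].
Qed.

Lemma isD_comp p v g (f : R -> R) (df dg : R) :
  is_derive (g p) 1 f df -> is_derive p v g dg ->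
  is_derive p v (fun q => f (g q)) (df * dg).
Proof.
move=> hf hg.
have E : p = 0 *: v + p by rewrite scale0r add0r.
have hg' : is_derive (0 : R) 1 (fun t : R => g (t *: v + p)) dg.
  by apply/isD_line; rewrite -E.
rewrite [p in is_derive p]E; apply/isD_line.
apply: (@is_derive1_comp _ f (fun t : R => g (t *: v + p)) 0 df dg _ hg').
by rewrite -E.
Qed.

Lemma isD_affine (s a b : R) : is_derive s 1 (fun t : R => t * a + b) a.
Proof.
have := @isD_add _ R s 1 _ _ _ _ (isD_mul (is_derive_id s 1) (isD_cst s 1 a)) (isD_cst s 1 b).
by move=> /isD_eq; apply; rewrite mul1r mulr0 !addr0.
Qed.

Lemma isD_linear p v g : (forall a q q', g (a *: q + q') = a * g q + g q') ->
  is_derive p v g (g v).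
Proof.
move=> lg; have E : p = 0 *: v + p by rewrite scale0r add0r.
rewrite [p in is_derive p]E; apply/isD_line.
rewrite (_ : (fun t : R => _) = (fun t => t * g v + g p)); first exact: isD_affine.
by apply/funext => t; rewrite lg.
Qed.

Lemma line_MVT p v g (h : R) :
  (forall s, `|s| <= `|h| -> derivable g (s *: v + p) v) ->
  exists2 s, `|s| <= `|h| & g (h *: v + p) - g p = h * 'D_v g (s *: v + p).
Proof.
move=> dg.
have seg a b : a <= b -> `|a| <= `|h| -> `|b| <= `|h| ->
    exists2 s, `|s| <= `|h| & g (b *: v + p) - g (a *: v + p) =
      (b - a) * 'D_v g (s *: v + p).
  move=> ab ah bh.
  have dl s : s \in `[a, b]%R ->
      is_derive s 1 (fun t : R => g (t *: v + p)) ('D_v g (s *: v + p)) /\ `|s| <= `|h|.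
    rewrite in_itv/= => /andP[a1 a2].
    have sh : `|s| <= `|h|.
      by move: ah bh; rewrite !ler_norml => /andP[? ?] /andP[? ?]; lra.
    by split=> //; apply/isD_line/derivableP/dg.
  have [||s sh E] := @MVT_segment R (fun t : R => g (t *: v + p))
    (fun s => 'D_v g (s *: v + p)) a b ab.
  - by move=> x xh; have [] := dl x (subset_itv_oo_cc xh).
  - by apply: derivable_within_continuous => x xh; have [[]] := dl x xh.
  - by exists s; [have [] := dl s sh|rewrite E mulrC].
have E0 : p = 0 *: v + p by rewrite scale0r add0r.
have [h0|h0] := leP 0 h.
  have [||s sh E] := seg 0 h h0 => //; first by rewrite normr0.
  by exists s => //; move: E; rewrite -E0 subr0.
have [||s sh E] := seg h 0 (ltW h0) => //; first by rewrite normr0.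
by exists s => //; move: E; rewrite -E0 sub0r => E; rewrite -opprB E mulNr opprK.
Qed.

Lemma isD_scale_dir p v g dg (c : R) : is_derive p v g dg ->
  is_derive p (c *: v) g (c * dg).
Proof.
move=> hg; have E w : p = 0 *: w + p by rewrite scale0r add0r.
rewrite [p in is_derive p](E (c *: v)); apply/isD_line.
rewrite (_ : (fun t : R => _) = (fun t => g (t *: v + p)) \o (fun t => c * t)); last first.
  by apply/funext => t /=; rewrite scalerA [t * c]mulrC.
rewrite mulrC; apply: is_derive1_comp; first by apply/isD_line; rewrite mulr0 -E.
have := isD_affine 0 c 0; congr (is_derive _ _ _ _).
by apply/funext => t; rewrite addr0 mulrC.
Qed.

(** Move by [h v], then by [h w]. By the mean value theorem the second increment, [phi h] below, is
    [h] times ['D_w g] at a nearby point, and the convergence of ['D_w g] at [p] gives the limit.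
    Along [v] the bare derivative at [p] is enough. *)
Lemma isD_add_dir p v w g dv dw : is_derive p v g dv ->
  (\near p, derivable g p w) -> 'D_w g q @[q --> p] --> dw ->
  is_derive p (v + w) g (dv + dw).
Proof.
move=> hv nw cw; have E0 u : p = 0 *: u + p by rewrite scale0r add0r.
pose phi (s : R) := g (s *: (v + w) + p) - g (s *: v + p).
suff hphi : is_derive (0 : R) 1 phi dw.
  rewrite [p in is_derive p](E0 (v + w)); apply/isD_line.
  rewrite (_ : (fun t : R => _) = (fun t => g (t *: v + p) + phi t)); last first.
    by apply/funext => t; rewrite /phi; ring.
  by apply: isD_add => //; apply/isD_line; rewrite -E0.
suff hl : h^-1 *: (phi (h *: 1 + 0) - phi 0) @[h --> 0^'] --> dw.
  by split; [apply/cvg_ex; exists dw|exact: cvg_lim].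
apply/cvgrPdist_le => e e0.
have /cvgrPdist_le/(_ e e0) cwe := cw.
have [d d0 dB] : exists2 d, 0 < d & forall q, `|q - p| < d ->
    derivable g q w /\ `|dw - 'D_w g q| <= e.
  have /nbhs_ballP[d /= d0 dB] : \near p, derivable g p w /\ `|dw - 'D_w g p| <= e.
    by apply: filterI.
  by exists d => // q qd; apply: dB; rewrite -ball_normE /ball_ /= distrC.
pose c := `|v| + `|w| + 1.
have c0 : 0 < c by rewrite ltr_wpDl// addr_ge0.
near=> h.
have hn0 : h != 0 by near: h; exact: nbhs_dnbhs_neq.
have hd : `|h| < d / c.
  near: h; apply: dnbhs0_lt; exact: divr_gt0.
rewrite [h *: 1]mulr1 addr0.
have -> : phi 0 = 0 by rewrite /phi !scale0r subrr.
rewrite subr0.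
have near_p s : `|s| <= `|h| -> `|s *: w + (h *: v + p) - p| < d.
  move=> sh; rewrite addrA addrK; apply: (@le_lt_trans _ _ (`|h| * c)).
    rewrite (le_trans (ler_normD _ _))// !normrZ /c !mulrDr mulr1 addrC.
    rewrite -[leLHS]addr0 lerD// lerD2l ler_wpM2r//.
  by rewrite -ltr_pdivlMr.
have [s sh E] := @line_MVT (h *: v + p) w g h (fun s sh => (dB _ (near_p s sh)).1).
have -> : phi h = h * 'D_w g (s *: w + (h *: v + p)).
  by rewrite -E /phi scalerDr [h *: v + h *: w]addrC addrA.
rewrite /GRing.scale/= mulrA mulVf// mul1r.
by have [] := dB _ (near_p s sh).
Unshelve. all: by end_near. Qed.

End directional_derivatives.

(** * Regularity through iterated partial derivatives *)

Section regularity.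
Context {R : realType} {n : nat}.
Local Notation X := ('rV[R]_n * R)%type.
Local Notation dir := (@coord_dir R n).
Implicit Types (g h : X -> R) (p : X).

(** Only derivatives along the coordinates are demanded, and for open [O] the values off [O] do not
    matter ([Ck_ext]). This accommodates [rho] and its inverse, which are singular at the origin. *)
Fixpoint Ck (O : set X) (k : nat) g : Prop :=
  (forall p, O p -> {for p, continuous g}) /\
  match k with
  | 0 => True
  | k'.+1 => forall d, (forall p, O p -> derivable g p (dir d)) /\
                       Ck O k' (partial d g)
  end.

Definition smooth_on (O : set X) g := forall k, Ck O k g.

Context (O : set X) (oO : open O).

Lemma near_O p : O p -> \near p, O p.
Proof. by move=> Op; apply: open_nbhs_nbhs. Qed.

Lemma Ck_cont k g p : Ck O k g -> O p -> {for p, continuous g}.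
Proof. by case: k => [|k] [+ _] => h /h. Qed.

Lemma Ck_isD k g p d : Ck O k.+1 g -> O p -> is_derive p (dir d) g (partial d g p).
Proof. by move=> [_ h] Op; apply: derivableP; exact: (h d).1. Qed.

Lemma Ck_partial k g d : Ck O k.+1 g -> Ck O k (partial d g).
Proof. by move=> [_ h]; exact: (h d).2. Qed.

Lemma CkS k g : Ck O k.+1 g -> Ck O k g.
Proof.
elim: k g => [|k IH] g [cg h]; split => // d; split; first exact: (h d).1.
by apply: IH; exact: (h d).2.
Qed.

Lemma Ck_ext k g h : (forall p, O p -> g p = h p) -> Ck O k g -> Ck O k h.
Proof.
elim: k g h => [|k IH] g h gh.
  move=> [cg _]; split => // p Op; rewrite /prop_for /continuous_at -(gh p Op).
  apply: cvg_trans (cg p Op); apply: near_eq_cvg.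
  by near=> q; rewrite gh//; near: q; exact: near_O.
move=> Ckg; have [cg dg] := Ckg; split.
  by move=> p Op; exact: (Ck_cont (IH g h gh (CkS Ckg)) Op).
have ngh p : O p -> \near p, g p = h p.
  by move=> Op; near=> q; apply: gh; near: q; exact: near_O.
move=> d; split => [p Op|].
  by apply: near_eq_derivable (ngh p Op) _; exact: (dg d).1.
apply: IH (dg d).2 => p Op; rewrite /partial; exact/near_eq_derive/ngh.
Unshelve. all: by end_near. Qed.

Lemma Ck_succ k g (dg : option 'I_n -> X -> R) :
  (forall p, O p -> {for p, continuous g}) ->
  (forall d p, O p -> is_derive p (dir d) g (dg d p)) ->
  (forall d, Ck O k (dg d)) -> Ck O k.+1 g.
Proof.
move=> cg hd Cd; split => // d; split => [p Op|]; first by have [] := hd d p Op.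
by apply: Ck_ext (Cd d) => p Op; have [_ <-] := hd d p Op.
Qed.

Lemma Ck_cst k (a : R) : Ck O k (fun=> a).
Proof.
elim: k a => [|k IH] a; first by split => // p _; exact: cst_continuous.
by apply: (@Ck_succ _ _ (fun _ _ => 0)) => // p _; exact: cst_continuous.
Qed.

Lemma CkD k g h : Ck O k g -> Ck O k h -> Ck O k (fun p => g p + h p).
Proof.
elim: k g h => [|k IH] g h Cg Ch.
  split => // p Op; by apply: continuousD; [exact: (Ck_cont Cg Op)|exact: (Ck_cont Ch Op)].
apply: (@Ck_succ _ _ (fun d p => partial d g p + partial d h p)).
- move=> p Op; by apply: continuousD; [exact: (Ck_cont Cg Op)|exact: (Ck_cont Ch Op)].
- by move=> d p Op; apply: isD_add; [exact: (Ck_isD _ Cg Op)|exact: (Ck_isD _ Ch Op)].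
- by move=> d; apply: IH; exact: Ck_partial.
Qed.

Lemma CkM k g h : Ck O k g -> Ck O k h -> Ck O k (fun p => g p * h p).
Proof.
elim: k g h => [|k IH] g h Cg Ch.
  split => // p Op; by apply: continuousM; [exact: (Ck_cont Cg Op)|exact: (Ck_cont Ch Op)].
apply: (@Ck_succ _ _ (fun d p => partial d g p * h p + g p * partial d h p)).
- move=> p Op; by apply: continuousM; [exact: (Ck_cont Cg Op)|exact: (Ck_cont Ch Op)].
- by move=> d p Op; apply: isD_mul; [exact: (Ck_isD _ Cg Op)|exact: (Ck_isD _ Ch Op)].
- by move=> d; apply: CkD; apply: IH; (exact: Ck_partial || exact: CkS).
Qed.

Lemma CkZ k a g : Ck O k g -> Ck O k (fun p => a * g p).
Proof. by move=> Cg; apply: CkM => //; exact: Ck_cst. Qed.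

Lemma CkN k g : Ck O k g -> Ck O k (fun p => - g p).
Proof.
move=> Cg; apply: Ck_ext (CkZ (-1) Cg) => p _; by rewrite mulN1r.
Qed.

Lemma CkB k g h : Ck O k g -> Ck O k h -> Ck O k (fun p => g p - h p).
Proof. by move=> Cg Ch; apply: CkD => //; exact: CkN. Qed.

Lemma CkX k g m : Ck O k g -> Ck O k (fun p => g p ^+ m).
Proof.
move=> Cg; elim: m => [|m IH].
  by under eq_fun do rewrite expr0; exact: Ck_cst.
by under eq_fun do rewrite exprS; exact: CkM.
Qed.

Lemma CkV k g : (forall p, O p -> g p != 0) -> Ck O k g ->
  Ck O k (fun p => (g p)^-1).
Proof.
move=> g0; elim: k => [|k IH] Cg.
  split => // p Op; by apply: (continuousV (g0 _ Op)); exact: (Ck_cont Cg Op).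
apply: (@Ck_succ _ _ (fun d p => - (g p)^-1 ^+ 2 * partial d g p)).
- move=> p Op; by apply: (continuousV (g0 _ Op)); exact: (Ck_cont Cg Op).
- by move=> d p Op; apply: isD_inv; [exact: g0|exact: (Ck_isD _ Cg Op)].
- move=> d; apply: CkM; last exact: Ck_partial.
  by apply: CkN; apply: CkX; apply: IH; exact: CkS.
Qed.

Lemma Ck_sum k (J : Type) (r : seq J) (F : J -> X -> R) :
  (forall j, Ck O k (F j)) -> Ck O k (fun p => \sum_(j <- r) F j p).
Proof.
move=> CF; elim: r => [|j r IH].
  by under eq_fun do rewrite big_nil; exact: Ck_cst.
by under eq_fun do rewrite big_cons; exact: CkD.
Qed.

Definition pcoord (k : option 'I_n) p : R := if k is Some i then p.1 0 i else p.2.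

Lemma pcoord_lin k a p q : pcoord k (a *: p + q) = a * pcoord k p + pcoord k q.
Proof. by case: k => [i|] //=; rewrite !mxE. Qed.

Lemma pcoord_continuous k : continuous (pcoord k).
Proof.
move=> p; case: k => [i|] /=; last exact: cvg_snd.
by apply: (@continuous_comp _ _ _ fst (fun x : 'rV[R]_n => x 0 i));
  [exact: cvg_fst|exact: coord_continuous].
Qed.

Lemma pcoord_dir k d : pcoord k (dir d) = (k == d)%:R.
Proof.
by case: k => [i|]; case: d => [j|] //=; rewrite ?mxE//=.
Qed.

Lemma isD_pcoord k p v : is_derive p v (pcoord k) (pcoord k v).
Proof. by apply: isD_linear => a q q'; exact: pcoord_lin. Qed.

Lemma Ck_pcoord k m : Ck O m (pcoord k).
Proof.
case: m => [|m]; first by split => // p _; exact: pcoord_continuous.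
apply: (@Ck_succ _ _ (fun d p => pcoord k (dir d))).
- by move=> p _; exact: pcoord_continuous.
- by move=> d p _; exact: isD_pcoord.
- by move=> d; exact: Ck_cst.
Qed.

Lemma point_sum (v : X) :
  v = \sum_(i < n) v.1 0 i *: dir (Some i) + v.2 *: dir None.
Proof.
have E1 : (\sum_(i < n) v.1 0 i *: dir (Some i)).1 = v.1.
  rewrite (big_morph fst (id1 := 0) (op1 := +%R))//.
  apply/rowP => j; rewrite summxE (bigD1 j)//= !mxE !eqxx mulr1 big1 ?addr0//.
  by move=> i ij; rewrite !mxE eqxx (negbTE (_ : j != i)) ?mulr0// eq_sym.
have E2 : (\sum_(i < n) v.1 0 i *: dir (Some i)).2 = 0.
  rewrite (big_morph snd (id1 := 0) (op1 := +%R))//.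
  by rewrite big1// => i _ /=; rewrite scaler0.
case: v E1 E2 => x t /= E1 E2.
apply/eqP; rewrite -pair_eqE/= E1 E2 !scaler0 addr0 eqxx add0r.
by rewrite [t *: 1]mulr1 eqxx.
Qed.

(** The coordinates of [v] are added one at a time by [isD_add_dir], each partial derivative being
    continuous. *)
Lemma Ck_isD_dir g p v : Ck O 1 g -> O p ->
  is_derive p v g (\sum_(i < n) v.1 0 i * partial (Some i) g p + v.2 * partial None g p).
Proof.
move=> Cg Op.
have step w k c dw : is_derive p w g dw ->
    is_derive p (w + c *: dir k) g (dw + c * partial k g p).
  move=> hw; apply: isD_add_dir => //.
    near=> q; have Oq : O q by near: q; exact: near_O.
    by have [] := isD_scale_dir c (Ck_isD k Cg Oq).
  have ck : {for p, continuous (fun q => c * partial k g q)}.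
    by apply: continuousM; [exact: cst_continuous|exact: (Ck_cont (Ck_partial k Cg) Op)].
  apply: cvg_trans ck; apply: near_eq_cvg.
  near=> q; have Oq : O q by near: q; exact: near_O.
  by have [_ ->] := isD_scale_dir c (Ck_isD k Cg Oq).
rewrite {1}[v]point_sum; apply: (step _ None).
elim: (index_enum 'I_n) => [|i r IH].
  by rewrite !big_nil; split; [exact: derivable0|exact: derive0].
by rewrite !big_cons addrC [X in is_derive _ _ _ X]addrC; apply: (step _ (Some i)).
Unshelve. all: by end_near. Qed.

Lemma smooth_onP (g : X -> R) : smooth g -> smooth_on O g.
Proof.
move=> sg k; rewrite -[g]/(foldr partial g [::]).
elim: k [::] => [|k IH] s; first by split => // p _; exact: (sg s).1.
split => [p _|d]; first exact: (sg s).1.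
by split => [p _|]; [exact: (sg s).2|exact: (IH (d :: s))].
Qed.

End regularity.

(** * Symmetry of second derivatives *)

Section schwarz.
Context {R : realType} {V : normedModType R}.
Implicit Types (g : V -> R) (p v w : V).

Lemma isD_shift p v g (a : V) dg : is_derive (a + p) v g dg ->
  is_derive p v (fun q => g (a + q)) dg.
Proof.
have E : (fun h : R => h^-1 *: (g (a + (h *: v + p)) - g (a + p))) =
    (fun h : R => h^-1 *: (g (h *: v + (a + p)) - g (a + p))).
  by apply/funext => h; rewrite addrCA.
by move=> [d e]; split; move: d e; rewrite /derivable /derive E.
Qed.

Lemma second_difference p v w g (h d : R) : `|h| * (`|v| + `|w|) < d ->
  (forall q, `|q - p| < d -> derivable g q v /\ derivable ('D_v g) q w) ->
  exists2 q, `|q - p| < d &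
    g (h *: w + (h *: v + p)) - g (h *: v + p) - (g (h *: w + p) - g p) =
    h ^+ 2 * 'D_w ('D_v g) q.
Proof.
move=> hd dg; pose phi q := g (h *: w + q) - g q.
have small s s' : `|s| <= `|h| -> `|s'| <= `|h| -> `|s *: v + s' *: w| < d.
  move=> sh sh'; apply: le_lt_trans hd; rewrite (le_trans (ler_normD _ _))//.
  by rewrite !normrZ mulrDr lerD// ler_wpM2r.
have n0 : `|0 : R| <= `|h| by rewrite normr0.
have dphi s : `|s| <= `|h| -> is_derive (s *: v + p) v phi
    ('D_v g (h *: w + (s *: v + p)) - 'D_v g (s *: v + p)).
  move=> sh; apply: isD_add.
    apply/isD_shift/derivableP; apply: (dg _ _).1.
    by rewrite addrCA addrA addrK small.
  apply/isD_opp/derivableP; apply: (dg _ _).1; rewrite addrK.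
  by have := small s 0 sh n0; rewrite scale0r addr0.
have [s sh E] := line_MVT (fun s sh => @ex_derive _ _ _ _ _ _ _ (dphi s sh)).
have [|s' sh' E'] := @line_MVT _ _ (s *: v + p) w ('D_v g) h.
  by move=> s' sh'; apply: (dg _ _).2; rewrite addrA addrK addrC small.
exists (s' *: w + (s *: v + p)); first by rewrite addrA addrK addrC small.
by rewrite -[LHS]/(phi (h *: v + p) - phi p) E (@derive_val _ _ _ _ _ _ _ (dphi s sh)) E' mulrA expr2.
Qed.

Lemma close2 (x y z e : R) : `|x - z| <= e / 2 -> `|y - z| <= e / 2 -> `|x - y| <= e.
Proof.
by rewrite !ler_norml => /andP[? ?] /andP[? ?]; apply/andP; split; lra.
Qed.

(** The second difference is symmetric in [v] and [w], so [h ^+ 2] times one mixed derivative at a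
    point near [p] equals [h ^+ 2] times the other at another such point; continuity of both at [p]
    does the rest. *)
Lemma derive_comm p v w g :
  (\near p, [/\ derivable g p v, derivable g p w,
     derivable ('D_v g) p w & derivable ('D_w g) p v]) ->
  {for p, continuous ('D_w ('D_v g))} -> {for p, continuous ('D_v ('D_w g))} ->
  'D_w ('D_v g) p = 'D_v ('D_w g) p.
Proof.
move=> nd c1 c2; apply/eqP; rewrite -subr_eq0 -normr_le0.
apply/ler_addgt0Pr => e e0; rewrite add0r.
have e2 : 0 < e / 2 by rewrite divr_gt0.
have [d d0 dB] : exists2 d, 0 < d & forall q, `|q - p| < d ->
    [/\ derivable g q v, derivable g q w,
     derivable ('D_v g) q w & derivable ('D_w g) q v] /\
    (`|'D_w ('D_v g) p - 'D_w ('D_v g) q| <= e / 2 /\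
     `|'D_v ('D_w g) p - 'D_v ('D_w g) q| <= e / 2).
  move/cvgrPdist_le/(_ _ e2): c1 => c1; move/cvgrPdist_le/(_ _ e2): c2 => c2.
  have H : nbhs p ([set q | [/\ derivable g q v, derivable g q w,
     derivable ('D_v g) q w & derivable ('D_w g) q v]] `&`
     ([set q | `|'D_w ('D_v g) p - 'D_w ('D_v g) q| <= e / 2] `&`
      [set q | `|'D_v ('D_w g) p - 'D_v ('D_w g) q| <= e / 2])).
    exact: (filterI nd (filterI c1 c2)).
  move: H => /nbhs_ballP[d /= d0 dB].
  by exists d => // q qd; apply: dB; rewrite -ball_normE /ball_ /= distrC.
pose c := `|v| + `|w| + 1.
have c0 : 0 < c by rewrite ltr_wpDl// addr_ge0.
pose h := d / c / 2.
have h0 : 0 < h by rewrite !divr_gt0.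
have hd : `|h| * (`|v| + `|w|) < d.
  rewrite gtr0_norm// (@le_lt_trans _ _ (h * c))//.
    by rewrite ler_wpM2l ?(ltW h0)// /c lerDl.
  by rewrite /h (_ : d / c / 2 * c = d / 2); [lra|field; rewrite gt_eqF].
have [q qd E] := second_difference hd (fun q qd =>
   let: And4 a _ b _ := (dB q qd).1 in conj a b).
rewrite addrC in hd.
have [q' qd' E'] := second_difference hd (fun q qd =>
   let: And4 _ a _ b := (dB q qd).1 in conj a b).
have EE : 'D_w ('D_v g) q = 'D_v ('D_w g) q'.
  apply: (@mulfI _ (h ^+ 2)); first by rewrite expf_neq0// gt_eqF.
  have E3 := addrCA (h *: w) (h *: v) p.
  rewrite -E -E' E3.
  move: (g (h *: v + (h *: w + p))) (g (h *: v + p)) (g (h *: w + p)) (g p).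
  by move=> a1 a2 a3 a4; ring.
have [_ [b1 _]] := dB _ qd; have [_ [_ b2]] := dB _ qd'.
by rewrite EE in b1; exact: close2 b1 b2.
Qed.

End schwarz.

Lemma partial_comm (R : realType) n (O : set ('rV[R]_n * R)) g d e p :
  open O -> Ck O 2 g -> O p -> partial d (partial e g) p = partial e (partial d g) p.
Proof.
move=> oO Cg Op; apply: derive_comm.
- near=> q; have Oq : O q by near: q; exact: near_O.
  split; [exact: ((Cg.2 e).1)|exact: ((Cg.2 d).1)| |].
    by have [] := Ck_isD d (Ck_partial e Cg) Oq.
  by have [] := Ck_isD e (Ck_partial d Cg) Oq.
- exact: (Ck_cont (Ck_partial d (Ck_partial e Cg)) Op).
- exact: (Ck_cont (Ck_partial e (Ck_partial d Cg)) Op).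
Unshelve. all: by end_near. Qed.

(** * Grushin calculus *)

Section pointwise_forms.
Context {R : realType} {n : nat}.
Local Notation X := ('rV[R]_n * R)%type.
Local Notation grad := (option 'I_n -> R).
Implicit Types (p : X) (a b c : grad).

Definition s2 p : R := \sum_i p.1 0 i ^+ 2.
Definition r4 p : R := s2 p ^+ 2 + 4 * p.2 ^+ 2.

Lemma s2_ge0 p : 0 <= s2 p.
Proof. by apply: sumr_ge0 => i _; exact: sqr_ge0. Qed.

Lemma enorm_sqr p : enorm p.1 ^+ 2 = s2 p.
Proof. by apply: sqr_sqrtr; exact: s2_ge0. Qed.

Lemma r4_ge0 p : 0 <= r4 p.
Proof. by rewrite /r4 addr_ge0 ?sqr_ge0// mulr_ge0 ?sqr_ge0. Qed.

Lemma s2_eq0 p : (s2 p == 0) = (p.1 == 0).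
Proof.
rewrite /s2 psumr_eq0 => [|i _]; last exact: sqr_ge0.
apply/allP/eqP => [h|-> i _]; last by rewrite mxE expr0n/= eqxx.
apply/rowP => i; rewrite mxE; apply/eqP.
by have /= := h i (mem_index_enum i); rewrite sqrf_eq0.
Qed.

Lemma r4_gt0 p : p != 0 -> 0 < r4 p.
Proof.
move=> p0; rewrite lt_neqAle r4_ge0 andbT eq_sym.
have t0 : 0 <= 4 * p.2 ^+ 2 by apply: mulr_ge0 => //; exact: sqr_ge0.
apply: contra p0; rewrite /r4 paddr_eq0 ?sqr_ge0//.
rewrite sqrf_eq0 s2_eq0 mulf_eq0 pnatr_eq0/= sqrf_eq0 => /andP[/eqP h1 /eqP h2].
by rewrite [p]surjective_pairing h1 h2.
Qed.

Lemma rho_sqrt p : rho p = Num.sqrt (Num.sqrt (r4 p)).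
Proof.
rewrite /rho -powR12_sqrt ?sqrtr_ge0// -powR12_sqrt ?r4_ge0// -powRrM.
rewrite (_ : enorm p.1 ^+ 4 = s2 p ^+ 2); last first.
  by rewrite -[4%N]/(2 * 2)%N exprM enorm_sqr.
rewrite -/(r4 p).
by congr (_ `^ _); field.
Qed.

Lemma rho_ge0 p : 0 <= rho p.
Proof. by rewrite rho_sqrt sqrtr_ge0. Qed.

Lemma rho_expr4 p : rho p ^+ 4 = r4 p.
Proof.
by rewrite rho_sqrt -[4%N]/(2 * 2)%N exprM !sqr_sqrtr ?sqrtr_ge0 ?r4_ge0.
Qed.

Lemma rho_gt0 p : p != 0 -> 0 < rho p.
Proof. by move=> p0; rewrite rho_sqrt !sqrtr_gt0 r4_gt0. Qed.

Lemma s20 : s2 (0 : X) = 0.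
Proof. by rewrite /s2 big1// => i _; rewrite mxE expr0n. Qed.

Lemma rho0 : rho (0 : X) = 0.
Proof.
rewrite rho_sqrt /r4 s20.
by rewrite expr0n/= ?expr0n/= mulr0 addr0 !sqrtr0.
Qed.

Lemma rho_continuous : continuous (@rho R n).
Proof.
have -> : @rho R n = Num.sqrt \o (Num.sqrt \o r4).
  by apply/funext => p; exact: rho_sqrt.
have cr4 : continuous r4.
  have : Ck setT 0 r4.
    rewrite /r4 /s2; apply: (CkD openT).
      apply: (CkX openT); apply: (Ck_sum openT) => i; apply: (CkX openT).
      exact: (Ck_pcoord openT (Some i)).
    by apply: (CkZ openT); apply: (CkX openT); exact: (Ck_pcoord openT None).
  by move=> [h _] p; exact: h.
move=> p; apply: continuous_comp; last exact: sqrt_continuous.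
by apply: continuous_comp; [exact: cr4|exact: sqrt_continuous].
Qed.

(* [a] and [b] stand for the partial derivatives at [p] of two functions. *)
Definition Ev p a : R := \sum_i p.1 0 i * a (Some i) + 2 * p.2 * a None.
Definition Gv p a b : R := \sum_i a (Some i) * b (Some i) + s2 p * (a None * b None).
(** Away from the origin this is [|gradG rho|^2 / rho^2], the factor by which the square of the
    dilation derivative enters the squared gradient. *)
Definition sig p : R := s2 p * (rho p)^-1 ^+ 4.
Definition qv p a b : R := Gv p a b - sig p * (Ev p a * Ev p b).

Lemma sig_ge0 p : 0 <= sig p.
Proof. by rewrite mulr_ge0 ?s2_ge0// exprn_ge0// invr_ge0 rho_ge0. Qed.

Lemma Ev_lin p x a b : Ev p (fun k => x * a k + b k) = x * Ev p a + Ev p b.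
Proof.
rewrite /Ev [x * (_ + _)]mulrDr mulr_sumr addrACA -big_split/=; congr (_ + _); last by ring.
by apply: eq_bigr => i _; ring.
Qed.

Lemma Gv_linl p x a b c : Gv p (fun k => x * a k + b k) c = x * Gv p a c + Gv p b c.
Proof.
rewrite /Gv [x * (_ + _)]mulrDr mulr_sumr addrACA -big_split/=; congr (_ + _); last by ring.
by apply: eq_bigr => i _; ring.
Qed.

Lemma Gv_sym p a b : Gv p a b = Gv p b a.
Proof.
rewrite /Gv [b None * _]mulrC; congr (_ + _).
by apply: eq_bigr => i _; rewrite mulrC.
Qed.

Lemma qv_linl p x a b c : qv p (fun k => x * a k + b k) c = x * qv p a c + qv p b c.
Proof. by rewrite /qv Gv_linl Ev_lin; ring. Qed.

Lemma qv_sym p a b : qv p a b = qv p b a.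
Proof. by rewrite /qv Gv_sym [Ev p b * _]mulrC. Qed.

Lemma qv_linr p x a b c : qv p c (fun k => x * a k + b k) = x * qv p c a + qv p c b.
Proof. by rewrite qv_sym qv_linl !(qv_sym p c). Qed.

Lemma qv_scalel p x a c : qv p (fun k => x * a k) c = x * qv p a c.
Proof.
have z : qv p (fun=> 0) c = 0.
  have := qv_linl p (-1) (fun=> 0) (fun=> 0) c.
  under [X in qv p X]eq_fun do rewrite mulr0 addr0.
  by rewrite mulN1r addNr.
rewrite -[RHS]addr0 -[X in _ + X]z -qv_linl.
by congr (qv p _ c); apply/funext => k; rewrite addr0.
Qed.

Lemma qv_scaler p x a c : qv p c (fun k => x * a k) = x * qv p c a.
Proof. by rewrite qv_sym qv_scalel qv_sym. Qed.

(* Completing the square with the multiple of [nabla rho] that carries the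
   radial part of [a]. *)
Lemma qv_ge0 p a : 0 <= qv p a a.
Proof.
have [->|p0] := eqVneq p 0.
  rewrite /qv /sig s20 !mul0r subr0 /Gv s20 mul0r addr0.
  by apply: sumr_ge0 => i _; rewrite -expr2 sqr_ge0.
have r0 : rho p != 0 by rewrite gt_eqF// rho_gt0.
pose l := Ev p a * (rho p)^-1 ^+ 4.
have -> : qv p a a = \sum_i (a (Some i) - l * (s2 p * p.1 0 i)) ^+ 2 +
    s2 p * (a None - l * (2 * p.2)) ^+ 2.
  have -> : \sum_i (a (Some i) - l * (s2 p * p.1 0 i)) ^+ 2 =
      \sum_i a (Some i) * a (Some i) - 2 * l * s2 p * (\sum_i p.1 0 i * a (Some i))
      + l ^+ 2 * s2 p ^+ 2 * s2 p.
    transitivity (\sum_i (a (Some i) * a (Some i)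
        - 2 * l * s2 p * (p.1 0 i * a (Some i)) + l ^+ 2 * s2 p ^+ 2 * p.1 0 i ^+ 2)).
      by apply: eq_bigr => i _; ring.
    by rewrite big_split sumrB -!mulr_sumr.
  rewrite /qv /Gv /sig /l.
  have E4 : s2 p ^+ 2 = rho p ^+ 4 - 4 * p.2 ^+ 2 by rewrite rho_expr4 /r4 addrK.
  have -> : \sum_i p.1 0 i * a (Some i) = Ev p a - 2 * p.2 * a None.
    by rewrite /Ev addrK.
  by rewrite E4; field.
apply: addr_ge0; first by apply: sumr_ge0 => i _; exact: sqr_ge0.
by apply: mulr_ge0; [exact: s2_ge0|exact: sqr_ge0].
Qed.

End pointwise_forms.

Section grushin_calculus.
Context {R : realType} {n : nat} (rad : \bar R).
Local Notation X := ('rV[R]_n * R)%type.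
Local Notation dir := (@coord_dir R n).
Local Arguments pcoord : simpl never.
Local Arguments coord_dir : simpl never.
Implicit Types (g h : X -> R) (p : X).

Definition Om : set X := grushin_ball rad `\ (0 : X).

Definition gr g p (k : option 'I_n) : R := partial k g p.
Definition EE g p : R := Ev p (gr g p).
Definition qf g h p : R := qv p (gr g p) (gr h p).

Lemma OmP p : Om p <-> p != 0 /\ ((rho p)%:E < rad)%E.
Proof. by split=> [[h /eqP]|[/eqP]]. Qed.

Lemma Om_neq0 p : Om p -> p != 0.
Proof. by move=> /OmP[]. Qed.

Lemma Om_rho_gt0 p : Om p -> 0 < rho p.
Proof. by move=> /Om_neq0; exact: rho_gt0. Qed.

Lemma Om_rho_neq0 p : Om p -> rho p != 0.
Proof. by move=> /Om_rho_gt0 h; rewrite gt_eqF. Qed.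

Lemma Om_radii p : Om p -> radii rad (rho p).
Proof. by move=> /OmP[/rho_gt0]. Qed.

Lemma open_Om : open Om.
Proof.
rewrite /Om setDE; apply: openI; last first.
  apply: closed_openC.
  exact: (@accessible_closed_set1 X (@hausdorff_accessible X (@norm_hausdorff _ X))).
rewrite (_ : grushin_ball rad = rho @^-1` [set r | (r%:E < rad)%E]) //.
apply: open_comp; first by move=> p _; exact: rho_continuous.
case: rad => [r| |].
- rewrite (_ : [set _ | _] = [set s | s < r]); first exact: open_lt.
  by apply/seteqP; split => s /=; rewrite lte_fin.
- rewrite (_ : [set _ | _] = setT); first exact: openT.
  by apply/seteqP; split => s //= _; rewrite ltry.
- rewrite (_ : [set _ | _] = set0); first exact: open0.
  by apply/seteqP; split => s.
Qed.
Local Notation oO := open_Om.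

Lemma grE g p k dg : is_derive p (dir k) g dg -> gr g p k = dg.
Proof. by move=> [_ e]. Qed.

Lemma gr_ext g h p : Om p -> (forall q, Om q -> g q = h q) -> gr g p = gr h p.
Proof.
move=> Op gh; apply/funext => k; apply: near_eq_derive.
by near=> q; apply: gh; near: q; exact: (near_O oO).
Unshelve. all: by end_near. Qed.

Lemma gr_cst (a : R) p : gr (fun=> a) p = (fun=> 0).
Proof. by apply/funext => k; apply: grE; exact: isD_cst. Qed.

Lemma gr_pcoord (k : option 'I_n) p : gr (pcoord k) p = (fun d => pcoord k (dir d)).
Proof. by apply/funext => d; apply: grE; exact: isD_pcoord. Qed.

Lemma grD g h p : Ck Om 1 g -> Ck Om 1 h -> Om p ->
  gr (fun p => g p + h p) p = (fun k => 1 * gr g p k + gr h p k).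
Proof.
move=> Cg Ch Op; apply/funext => k; rewrite mul1r; apply: grE.
by apply: isD_add; [exact: Ck_isD Cg Op|exact: Ck_isD Ch Op].
Qed.

Lemma grB g h p : Ck Om 1 g -> Ck Om 1 h -> Om p ->
  gr (fun p => g p - h p) p = (fun k => (-1) * gr h p k + gr g p k).
Proof.
move=> Cg Ch Op; apply/funext => k; rewrite mulN1r addrC; apply: grE.
by apply: isD_add; [exact: Ck_isD Cg Op|apply: isD_opp; exact: Ck_isD Ch Op].
Qed.

Lemma grM g h p : Ck Om 1 g -> Ck Om 1 h -> Om p ->
  gr (fun p => g p * h p) p = (fun k => h p * gr g p k + g p * gr h p k).
Proof.
move=> Cg Ch Op; apply/funext => k; rewrite [h p * _]mulrC; apply: grE.
by apply: isD_mul; [exact: Ck_isD Cg Op|exact: Ck_isD Ch Op].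
Qed.

Lemma grV g p : Ck Om 1 g -> Om p -> g p != 0 ->
  gr (fun p => (g p)^-1) p = (fun k => - (g p)^-1 ^+ 2 * gr g p k).
Proof.
move=> Cg Op g0; apply/funext => k; apply: grE.
by apply: isD_inv => //; exact: Ck_isD Cg Op.
Qed.

Lemma gr_comp (f : R -> R) g p : Ck Om 1 g -> Om p -> derivable f (g p) 1 ->
  gr (fun p => f (g p)) p = (fun k => derive1 f (g p) * gr g p k).
Proof.
move=> Cg Op df; apply/funext => k; apply: grE.
apply: isD_comp; last exact: Ck_isD Cg Op.
by rewrite derive1E; exact: derivableP.
Qed.

Lemma Ev_scale p (x : R) a : Ev p (fun k => x * a k) = x * Ev p a.
Proof.
rewrite /Ev mulrDr mulr_sumr; congr (_ + _); last by ring.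
by apply: eq_bigr => i _; ring.
Qed.

Lemma EE_ext g h p : Om p -> (forall q, Om q -> g q = h q) -> EE g p = EE h p.
Proof. by move=> Op gh; rewrite /EE (gr_ext Op gh). Qed.

Lemma EE_cst (a : R) p : EE (fun=> a) p = 0.
Proof.
by rewrite /EE gr_cst /Ev mulr0 addr0 big1// => i _; rewrite mulr0.
Qed.

Lemma EED g h p : Ck Om 1 g -> Ck Om 1 h -> Om p ->
  EE (fun p => g p + h p) p = EE g p + EE h p.
Proof. by move=> Cg Ch Op; rewrite /EE grD// Ev_lin mul1r. Qed.

Lemma EEB g h p : Ck Om 1 g -> Ck Om 1 h -> Om p ->
  EE (fun p => g p - h p) p = EE g p - EE h p.
Proof. by move=> Cg Ch Op; rewrite /EE grB// Ev_lin mulN1r addrC. Qed.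

Lemma EEM g h p : Ck Om 1 g -> Ck Om 1 h -> Om p ->
  EE (fun p => g p * h p) p = EE g p * h p + g p * EE h p.
Proof.
by move=> Cg Ch Op; rewrite /EE grM// Ev_lin Ev_scale [h p * _]mulrC.
Qed.

Lemma EE_sum (J : Type) (r : seq J) (F : J -> X -> R) p :
  (forall j, Ck Om 1 (F j)) -> Om p ->
  EE (fun p => \sum_(j <- r) F j p) p = \sum_(j <- r) EE (F j) p.
Proof.
move=> CF Op; elim: r => [|j r IH].
  by rewrite big_nil; under eq_fun do rewrite big_nil; exact: EE_cst.
rewrite big_cons; under eq_fun do rewrite big_cons.
by rewrite EED ?IH//; exact: (Ck_sum oO).
Qed.

Lemma EE_comp (f : R -> R) g p : Ck Om 1 g -> Om p -> derivable f (g p) 1 ->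
  EE (fun p => f (g p)) p = derive1 f (g p) * EE g p.
Proof. by move=> Cg Op df; rewrite /EE gr_comp// Ev_scale. Qed.

Lemma EE_pcoord_none p : EE (pcoord None) p = 2 * p.2.
Proof.
rewrite /EE gr_pcoord /Ev/= pcoord_dir eqxx mulr1 big1 ?add0r// => i _.
by rewrite pcoord_dir mulr0.
Qed.

Lemma smD g h : smooth_on Om g -> smooth_on Om h -> smooth_on Om (fun p => g p + h p).
Proof. by move=> Cg Ch k; exact: (CkD oO). Qed.
Lemma smM g h : smooth_on Om g -> smooth_on Om h -> smooth_on Om (fun p => g p * h p).
Proof. by move=> Cg Ch k; exact: (CkM oO). Qed.
Lemma smX g m : smooth_on Om g -> smooth_on Om (fun p => g p ^+ m).
Proof. by move=> Cg k; exact: (CkX oO). Qed.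
Lemma sm_cst (a : R) : smooth_on Om (fun=> a).
Proof. by move=> k; exact: (Ck_cst oO). Qed.
Lemma sm_pcoord k : smooth_on Om (pcoord k).
Proof. by move=> m; exact: (Ck_pcoord oO). Qed.
Lemma sm_s2 : smooth_on Om s2.
Proof.
move=> k; apply: (Ck_sum oO) => i; apply: (CkX oO).
exact: (Ck_pcoord oO (Some i)).
Qed.

Lemma sm_r4 : smooth_on Om r4.
Proof.
apply: smD; first exact/smX/sm_s2.
by apply: smM; [exact: sm_cst|exact: (smX 2 (sm_pcoord None))].
Qed.

Lemma gr_s2 p : Om p -> gr s2 p =
  (fun k => if k is Some i then 2 * p.1 0 i else 0).
Proof.
move=> Op; apply/funext => d; apply: grE.
have h : is_derive p (dir d) s2 (\sum_i (2 * p.1 0 i * pcoord (Some i) (dir d))).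
  apply: (@isD_sum _ X p (dir d) _ (index_enum 'I_n) (fun i p => p.1 0 i ^+ 2)) => i.
  have := isD_mul (isD_pcoord (Some i) p (dir d)) (isD_pcoord (Some i) p (dir d)).
  move=> h; have -> : (fun p : X => p.1 0 i ^+ 2) = (fun p => pcoord (Some i) p * pcoord (Some i) p).
    by apply/funext => q; rewrite expr2.
  apply: isD_eq h _; rewrite -[p.1 0 i]/(pcoord (Some i) p); ring.
apply: isD_eq h _; case: d => [i|].
  rewrite (bigD1 i)//= pcoord_dir eqxx mulr1 big1 ?addr0// => j ji.
  by rewrite pcoord_dir [_ == _](_ : _ = (j == i)) // (negbTE ji) mulr0.
by rewrite big1// => i _; rewrite pcoord_dir mulr0.
Qed.

Lemma gr_r4 p : Om p -> gr r4 p =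
  (fun k => if k is Some i then 4 * s2 p * p.1 0 i else 8 * p.2).
Proof.
move=> Op; have -> : @r4 R n = (fun p => s2 p * s2 p + 4 * (pcoord None p * pcoord None p)).
  by apply/funext => q; rewrite /r4 !expr2.
have C1 := @sm_s2 1; have C2 := @sm_pcoord None 1.
have C3 : Ck Om 1 (fun p : X => pcoord None p * pcoord None p) := CkM oO C2 C2.
rewrite (grD (CkM oO C1 C1) (CkZ oO 4 C3) Op) (grM C1 C1 Op) (grM (Ck_cst oO 1 4) C3 Op).
rewrite gr_cst (grM C2 C2 Op) (gr_s2 Op) gr_pcoord.
by apply/funext => -[i|]; rewrite !pcoord_dir/= /pcoord; ring.
Qed.

Lemma Om_rho_isD p k : Om p -> is_derive p (dir k) rho ((rho p)^-1 ^+ 3 / 4 * gr r4 p k).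
Proof.
move=> Op; have r0 := Om_rho_gt0 Op; have r40 := r4_gt0 (Om_neq0 Op).
have E : @rho R n = (fun p => Num.sqrt (Num.sqrt (r4 p))) by apply/funext => q; exact: rho_sqrt.
rewrite {1}E.
have h1 : is_derive p (dir k) r4 (gr r4 p k) by exact: Ck_isD (@sm_r4 1) Op.
have h2 := isD_comp (is_derive1_sqrt r40) h1.
have s0 : 0 < Num.sqrt (r4 p) by rewrite sqrtr_gt0.
have h3 := @isD_comp _ _ p (dir k) (fun q => Num.sqrt (r4 q)) _ _ _ (is_derive1_sqrt s0) h2.
apply: isD_eq h3 _; rewrite -rho_sqrt.
have -> : Num.sqrt (r4 p) = rho p ^+ 2 by rewrite rho_sqrt sqr_sqrtr// sqrtr_ge0.
by field; rewrite gt_eqF.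
Qed.

Lemma gr_rho p : Om p -> gr rho p =
  (fun k => if k is Some i then s2 p * p.1 0 i * (rho p)^-1 ^+ 3
            else 2 * p.2 * (rho p)^-1 ^+ 3).
Proof.
move=> Op; apply/funext => k; rewrite (grE (Om_rho_isD k Op)) gr_r4//.
by case: k => [i|]; field; rewrite (Om_rho_neq0 Op).
Qed.

Lemma sm_rho : smooth_on Om rho.
Proof.
elim=> [|k IH]; first by split => // p _; exact: rho_continuous.
apply: (Ck_succ oO (dg := fun d p => (rho p)^-1 ^+ 3 / 4 * partial d r4 p)).
- by move=> p _; exact: rho_continuous.
- by move=> d p Op; exact: Om_rho_isD.
- move=> d; apply: (CkM oO); last exact: (Ck_partial _ (sm_r4 k.+1)).
  apply: (CkM oO); last exact: (Ck_cst oO).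
  by apply: (CkX oO); apply: (CkV oO) => // p; exact: Om_rho_neq0.
Qed.

Lemma sm_rinv : smooth_on Om (fun p => (rho p)^-1).
Proof. by move=> k; apply: (CkV oO); [exact: Om_rho_neq0|exact: sm_rho]. Qed.

Lemma sm_sig : smooth_on Om sig.
Proof. by apply: smM; [exact: sm_s2|exact/smX/sm_rinv]. Qed.

Lemma EE_rho p : Om p -> EE rho p = rho p.
Proof.
move=> Op; rewrite /EE gr_rho// /Ev.
have -> : \sum_i p.1 0 i * (s2 p * p.1 0 i * (rho p)^-1 ^+ 3) =
    s2 p * (rho p)^-1 ^+ 3 * \sum_i p.1 0 i ^+ 2.
  by rewrite mulr_sumr; apply: eq_bigr => i _; ring.
rewrite -/(s2 p).
have E4 : s2 p * s2 p = rho p ^+ 4 - 4 * p.2 ^+ 2 by rewrite rho_expr4 /r4 expr2 addrK.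
rewrite mulrAC E4; by field; rewrite (Om_rho_neq0 Op).
Qed.

(** The formula for [gr rho] makes [Gv p (gr rho p) b] equal to [s2 * rho^-3 * Ev p b], that is
    [sig * rho * Ev p b], which is exactly the radial part that [qv] subtracts. *)
Lemma qv_rho p b : Om p -> qv p (gr rho p) b = 0.
Proof.
move=> Op; have := EE_rho Op; rewrite /EE /qv => ->.
rewrite gr_rho// /Gv /sig /Ev.
have -> : \sum_i s2 p * p.1 0 i * (rho p)^-1 ^+ 3 * b (Some i) =
   s2 p * (rho p)^-1 ^+ 3 * \sum_i p.1 0 i * b (Some i).
  by rewrite mulr_sumr; apply: eq_bigr => i _; ring.
by field; rewrite (Om_rho_neq0 Op).
Qed.

Lemma EE_rinv p : Om p -> EE (fun p => (rho p)^-1) p = - (rho p)^-1.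
Proof.
move=> Op; have r0 := Om_rho_neq0 Op.
rewrite /EE (grV (@sm_rho 1) Op r0) Ev_scale -/(EE rho p) EE_rho//.
by field.
Qed.

Lemma EEX g m p : Ck Om 1 g -> Om p ->
  EE (fun p => g p ^+ m.+1) p = m.+1%:R * g p ^+ m * EE g p.
Proof.
move=> Cg Op; elim: m => [|m IH].
  by rewrite expr0 !mul1r; apply: EE_ext => // q _; rewrite expr1.
rewrite (@EE_ext _ (fun p => g p * g p ^+ m.+1))//.
rewrite (EEM Cg (CkX oO _ Cg) Op) IH.
by rewrite -[in RHS]natr1 exprS; ring.
Qed.

Lemma EE_s2 p : Om p -> EE s2 p = 2 * s2 p.
Proof.
move=> Op; rewrite /EE gr_s2// /Ev mulr0 addr0 /s2 mulr_sumr.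
by apply: eq_bigr => i _; ring.
Qed.

Lemma EE_sig p : Om p -> EE sig p = - 2 * sig p.
Proof.
move=> Op; rewrite /sig EEM//; [|exact: sm_s2|exact: (smX 4 sm_rinv)].
rewrite EE_s2// EEX//; last exact: sm_rinv.
by rewrite EE_rinv//; ring.
Qed.

Lemma EE_radial (f : R -> R) p : Om p -> derivable f (rho p) 1 ->
  EE (fun p => f (rho p)) p = rho p * derive1 f (rho p).
Proof. by move=> Op df; rewrite (EE_comp (@sm_rho 1) Op df) (EE_rho Op) mulrC. Qed.

Lemma qv_radial (f : R -> R) p b : Om p -> derivable f (rho p) 1 ->
  qv p (gr (fun p => f (rho p)) p) b = 0.
Proof.
move=> Op df; rewrite (gr_comp (@sm_rho 1) Op df).
by rewrite qv_scalel (qv_rho _ Op) mulr0.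
Qed.

Lemma Ck0_radial (f : R -> R) : (forall r, radii rad r -> {for r, continuous f}) ->
  Ck Om 0 (fun p => f (rho p)).
Proof.
move=> cf; split => // p Op; apply: (@continuous_comp _ _ _ rho f).
  exact: rho_continuous.
exact/cf/Om_radii.
Qed.

Lemma Ck1_radial (f : R -> R) : C1_on (radii rad) f -> Ck Om 1 (fun p => f (rho p)).
Proof.
move=> Cf.
apply: (Ck_succ oO (dg := fun d p => derive1 f (rho p) * partial d rho p)).
- apply: (Ck0_radial _).1 => r /Cf[df _].
  by apply: differentiable_continuous; exact/derivable1_diffP.
- move=> d p Op; apply: isD_comp; last exact: Ck_isD (@sm_rho 1) Op.
  by rewrite derive1E; apply: derivableP; exact: (Cf _ (Om_radii Op)).1.
- move=> d; apply: (CkM oO); last exact: (Ck_partial _ (@sm_rho 1)).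
  by apply: Ck0_radial => r /Cf[].
Qed.

Lemma CkE k g : Ck Om k.+1 g -> Ck Om k (EE g).
Proof.
move=> Cg; apply: (CkD oO).
  apply: (Ck_sum oO) => i; apply: (CkM oO); last exact: Ck_partial.
  exact: (Ck_pcoord oO (Some i)).
apply: (CkM oO); last exact: Ck_partial.
by apply: (CkZ oO); exact: (Ck_pcoord oO None).
Qed.

Lemma smE g : smooth_on Om g -> smooth_on Om (EE g).
Proof. by move=> sg k; apply: CkE; exact: sg. Qed.

Lemma Ckq k g h : Ck Om k.+1 g -> Ck Om k.+1 h -> Ck Om k (qf g h).
Proof.
move=> Cg Ch; apply: (CkB oO); last first.
  by apply: (CkM oO); [exact: sm_sig|apply: (CkM oO); exact: CkE].
apply: (CkD oO).
  by apply: (Ck_sum oO) => i; apply: (CkM oO); exact: Ck_partial.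
by apply: (CkM oO); [exact: sm_s2|apply: (CkM oO); exact: Ck_partial].
Qed.

Lemma smq g h : smooth_on Om g -> smooth_on Om h -> smooth_on Om (qf g h).
Proof. by move=> sg sh k; apply: Ckq. Qed.

Local Opaque partial.

(** The commutator of the dilation field with a coordinate derivative: [x_i] has weight 1 and [t]
    has weight 2. *)
Lemma EE_partial g p k : Ck Om 2 g -> Om p ->
  EE (partial k g) p = partial k (EE g) p - (if k is Some _ then 1 else 2) * partial k g p.
Proof.
move=> Cg Op.
have Cd i : Ck Om 1 (partial i g) by exact: Ck_partial.
have -> : partial k (EE g) p = \sum_i (pcoord (Some i) (dir k) * partial (Some i) g p
     + p.1 0 i * partial k (partial (Some i) g) p)
    + (2 * pcoord None (dir k) * partial None g p
     + 2 * p.2 * partial k (partial None g) p).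
  apply: grE; apply: isD_add.
    apply: (@isD_sum _ X p (dir k) _ (index_enum 'I_n)
      (fun i p => p.1 0 i * partial (Some i) g p)) => i.
    by apply: isD_mul; [exact: (isD_pcoord (Some i))|exact: Ck_isD (Cd _) Op].
  have h : is_derive p (dir k) (fun q : X => 2 * q.2) (2 * pcoord None (dir k)).
    apply: isD_eq (isD_mul (isD_cst p (dir k) 2) (isD_pcoord None p (dir k))) _.
    by rewrite mul0r add0r.
  by apply: isD_mul => //; exact: Ck_isD (Cd _) Op.
have -> : EE (partial k g) p = \sum_i (p.1 0 i * partial k (partial (Some i) g) p)
    + 2 * p.2 * partial k (partial None g) p.
  have E i : partial i (partial k g) p = partial k (partial i g) p.
    exact: (partial_comm i k oO Cg Op).
  rewrite /EE /Ev.
  rewrite /gr.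
  rewrite [partial None _ _](E None).
  apply: (f_equal (fun a => a + _)).
  apply: eq_bigr => i _.
  exact: (f_equal (fun a => _ * a) (E (Some i))).
rewrite big_split/=.
have -> : \sum_i pcoord (Some i) (dir k) * partial (Some i) g p =
    if k is Some j then partial (Some j) g p else 0.
  case: k => [j|].
    rewrite (bigD1 j)//= pcoord_dir eqxx mul1r big1 ?addr0// => i ij.
    by rewrite pcoord_dir [_ == _](_ : _ = (i == j)) // (negbTE ij) mul0r.
  by rewrite big1// => i _; rewrite pcoord_dir mul0r.
by rewrite pcoord_dir; case: k => [j|] /=; ring.
Qed.

(** The Leibniz rule corrected by homogeneity: each of the three terms of [q], coefficient and
    derivatives together, scales with degree -2 under dilations. *)
Lemma EE_qf g h p : Ck Om 2 g -> Ck Om 2 h -> Om p ->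
  EE (qf g h) p = qf (EE g) h p + qf g (EE h) p - 2 * qf g h p.
Proof.
move=> Cg Ch Op.
have Cdg i : Ck Om 1 (partial i g) by exact: Ck_partial.
have Cdh i : Ck Om 1 (partial i h) by exact: Ck_partial.
have CEg : Ck Om 1 (EE g) by exact: CkE.
have CEh : Ck Om 1 (EE h) by exact: CkE.
have CM (a b : X -> R) : Ck Om 1 a -> Ck Om 1 b -> Ck Om 1 (fun p => a p * b p).
  exact: (CkM oO).
have C1 : Ck Om 1 (fun p => \sum_i partial (Some i) g p * partial (Some i) h p).
  by apply: (Ck_sum oO) => i; exact: (CM _ _ (Cdg _) (Cdh _)).
have C2 : Ck Om 1 (fun p => s2 p * (partial None g p * partial None h p)).
  exact: (CM _ _ (@sm_s2 1) (CM _ _ (Cdg None) (Cdh None))).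
have C3 : Ck Om 1 (fun p => sig p * (EE g p * EE h p)).
  exact: (CM _ _ (@sm_sig 1) (CM _ _ CEg CEh)).
have C12 := CkD oO C1 C2.
transitivity (EE (fun p => \sum_i partial (Some i) g p * partial (Some i) h p
   + s2 p * (partial None g p * partial None h p) - sig p * (EE g p * EE h p)) p).
  by [].
rewrite (EEB C12 C3 Op) (EED C1 C2 Op).
rewrite (EE_sum (index_enum 'I_n) (fun i => CM _ _ (Cdg (Some i)) (Cdh (Some i))) Op).
rewrite (EEM (@sm_s2 1) (CM _ _ (Cdg None) (Cdh None)) Op).
rewrite (EEM (Cdg None) (Cdh None) Op) (EE_s2 Op).
rewrite (EEM (@sm_sig 1) (CM _ _ CEg CEh) Op) (EEM CEg CEh Op) (EE_sig Op).
rewrite (EE_partial None Cg Op) (EE_partial None Ch Op).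
have -> : \sum_(i < n) EE (fun p => partial (Some i) g p * partial (Some i) h p) p =
   \sum_(i < n) partial (Some i) (EE g) p * partial (Some i) h p +
   \sum_(i < n) partial (Some i) g p * partial (Some i) (EE h) p -
   2 * \sum_(i < n) partial (Some i) g p * partial (Some i) h p.
  rewrite mulr_sumr -big_split/= -sumrB; apply: eq_bigr => i _.
  rewrite (EEM (Cdg _) (Cdh _) Op) (EE_partial (Some i) Cg Op) (EE_partial (Some i) Ch Op).
  by move: (partial _ (EE g) p) (partial _ (EE h) p) (partial _ g p) (partial _ h p)
    => a b x y; ring.
have qE (a b : X -> R) : qf a b p = \sum_i partial (Some i) a p * partial (Some i) b p
   + s2 p * (partial None a p * partial None b p) - sig p * (EE a p * EE b p) by [].
rewrite !qE; move: (\sum_i _ ) (\sum_i _) (\sum_i _) => x1 x2 x3.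
move: (partial None (EE g) p) (partial None (EE h) p) (partial None g p) (partial None h p).
move: (EE (EE g) p) (EE (EE h) p) (EE g p) (EE h p) (s2 p) (sig p).
by move=> *; ring.
Qed.

End grushin_calculus.

(** * Integration by parts *)

Section annular_support.
Context {R : realType} {n : nat} (rad : \bar R) (r1 r2 : R).
Hypothesis r1_gt0 : 0 < r1.
Hypothesis r2_rad : (r2%:E < rad)%E.
Local Notation X := ('rV[R]_n * R)%type.
Local Notation dir := (@coord_dir R n).
Local Notation Om := (@Om R n rad).
Implicit Types (g h F : X -> R) (p : X).

(** The closed annulus lies in [Om] and its complement is open. A function that is regular on [Om]
    and vanishes off the annulus is therefore regular everywhere, and integration by parts leaves no
    boundary terms. *)
Definition AS F := forall p, ~~ (r1 <= rho p <= r2) -> F p = 0.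

Lemma annulus_Om p : r1 <= rho p <= r2 -> Om p.
Proof.
move=> /andP[h1 h2]; apply/OmP; split.
  by apply/eqP => p0; move: h1; rewrite p0 rho0 leNgt r1_gt0.
by apply: le_lt_trans r2_rad; rewrite lee_fin.
Qed.

Lemma near_outside p : ~~ (r1 <= rho p <= r2) ->
  \near p, ~~ (r1 <= rho p <= r2).
Proof.
rewrite negb_and -!ltNge => /orP[h|h].
  near=> q; rewrite negb_and -!ltNge; apply/orP; left; near: q.
  by apply: (cvgr_lt (rho p)) => //; exact: rho_continuous.
near=> q; rewrite negb_and -!ltNge; apply/orP; right; near: q.
by apply: (cvgr_gt (rho p)) => //; exact: rho_continuous.
Unshelve. all: by end_near. Qed.

Lemma AS_near F p : AS F -> ~~ (r1 <= rho p <= r2) -> \near p, 0 = F p.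
Proof.
move=> aF /near_outside h; near=> q; apply/esym/aF; near: q; exact: h.
Unshelve. all: by end_near. Qed.

Lemma AS_isD0 F p v : AS F -> ~~ (r1 <= rho p <= r2) -> is_derive p v F 0.
Proof. by move=> aF h; apply: isD_near (AS_near aF h) (isD_cst p v 0). Qed.

Lemma AS_partial F k : AS F -> AS (partial k F).
Proof. by move=> aF p h; exact: (@derive_val _ _ _ _ _ _ _ (AS_isD0 (dir k) aF h)). Qed.

Lemma AS_isD F p k : Ck Om 1 F -> AS F -> is_derive p (dir k) F (partial k F p).
Proof.
move=> CF aF; have [h|h] := boolP (r1 <= rho p <= r2).
  exact: (Ck_isD k CF (annulus_Om h)).
by apply: isD_eq (AS_isD0 _ aF h) _; rewrite AS_partial.
Qed.

Lemma AS_continuous F : Ck Om 0 F -> AS F -> continuous F.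
Proof.
move=> CF aF p; have [h|h] := boolP (r1 <= rho p <= r2).
  exact: (Ck_cont CF (annulus_Om h)).
rewrite /continuous_at (aF p h).
have c0 : (fun=> (0 : R)) x @[x --> p] --> (0 : R) by exact: cvg_cst.
apply: cvg_trans c0; apply: near_eq_cvg.
exact: AS_near.
Qed.

Lemma rho_coord p i : `|p.1 0 i| <= rho p.
Proof.
rewrite -(@ler_pXn2r _ 4)// ?nnegrE ?rho_ge0// rho_expr4.
rewrite -[4%N]/(2 * 2)%N exprM real_normK ?num_real//.
have h : p.1 0 i ^+ 2 <= s2 p.
  rewrite /s2 (bigD1 i)//= lerDl; apply: sumr_ge0 => j _; exact: sqr_ge0.
have := s2_ge0 p; have := sqr_ge0 (p.1 0 i); have := sqr_ge0 p.2.
by rewrite /r4; nra.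
Qed.

Lemma rho_time p : 2 * `|p.2| <= rho p ^+ 2.
Proof.
rewrite -(@ler_pXn2r _ 2)// ?nnegrE ?exprn_ge0 ?rho_ge0 ?mulr_ge0//.
rewrite -exprM rho_expr4 /r4 exprMn real_normK ?num_real//.
by have := sqr_ge0 (s2 p); rewrite -natrX; lra.
Qed.

(** A bound of the annulus in the sup norm: [rho] controls the coordinates of [x], and [rho ^+ 2]
    controls [t]. *)
Definition Mbox : R := `|r2| + `|r2| ^+ 2.

Lemma annulus_box p : r1 <= rho p <= r2 -> `|p| <= Mbox.
Proof.
move=> /andP[h1 h2]; have r20 : 0 <= r2 by rewrite (le_trans (ltW r1_gt0))// (le_trans h1).
have rh : 0 <= rho p by exact: rho_ge0.
rewrite /Mbox ger0_norm//; apply: prod_norm_le.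
  apply: rV_norm_le => [|i]; first by rewrite addr_ge0// sqr_ge0.
  apply: le_trans (rho_coord p i) _; have := sqr_ge0 r2; lra.
by have := rho_time p; have := normr_ge0 p.2; nra.
Qed.

Lemma AS_box F p : AS F -> Mbox < `|p| -> F p = 0.
Proof.
by move=> aF Mp; apply: aF; apply/negP => /annulus_box; rewrite leNgt Mp.
Qed.

Lemma bb_AS F : Ck Om 0 F -> AS F -> bb F.
Proof.
move=> CF aF; apply: (@bb_continuous _ _ F Mbox); first exact: AS_continuous.
by move=> p; exact: AS_box.
Qed.

Lemma AS_bounded F : Ck Om 0 F -> AS F -> exists2 C, 0 <= C & forall p, `|F p| <= C.
Proof.
move=> CF aF; have [_ [C [M h]]] := bb_AS CF aF; exists C; last by move=> p; have [] := h p.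
exact: le_trans (normr_ge0 (F 0)) (h 0).1.
Qed.

Lemma ASMl g h : AS g -> AS (fun p => g p * h p).
Proof. by move=> ag p /ag ->; rewrite mul0r. Qed.

Lemma ASMr g h : AS h -> AS (fun p => g p * h p).
Proof. by move=> ag p /ag ->; rewrite mulr0. Qed.

Lemma ASD g h : AS g -> AS h -> AS (fun p => g p + h p).
Proof. by move=> ag ah p pA; rewrite ag// ah// addr0. Qed.

Lemma ASN g : AS g -> AS (fun p => - g p).
Proof. by move=> ag p /ag ->; rewrite oppr0. Qed.

Lemma ASB g h : AS g -> AS h -> AS (fun p => g p - h p).
Proof. by move=> ag ah; apply: ASD => //; exact: ASN. Qed.

Lemma AS_gr g p : AS g -> ~~ (r1 <= rho p <= r2) -> gr g p = (fun=> 0).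
Proof. by move=> ag pA; apply/funext => k; exact: AS_partial. Qed.

Lemma AS_E g : AS g -> AS (EE g).
Proof.
move=> ag p pA; rewrite /EE (AS_gr ag pA) /Ev mulr0 addr0 big1// => i _.
by rewrite mulr0.
Qed.

Lemma AS_ql g h : AS g -> AS (qf g h).
Proof.
move=> ag p pA; rewrite /qf (AS_gr ag pA).
rewrite (_ : (fun=> 0) = (fun k => 0 * gr h p k)) ?qv_scalel ?mul0r//.
by apply/funext => k; rewrite mul0r.
Qed.

(* Translation invariance makes the integrals of all difference quotients
   vanish. *)
Lemma I_partial F k : Ck Om 1 F -> AS F -> I (partial k F) = 0.
Proof.
move=> CF aF.
have CdF : Ck Om 0 (partial k F) by exact: Ck_partial.
have adF : AS (partial k F) by exact: AS_partial.
have [C C0 dFC] := AS_bounded CdF adF.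
have bF : bb F by apply: bb_AS => //; exact: CkS.
pose e (j : nat) : R := j.+1%:R^-1.
have e0 j : 0 < e j by rewrite invr_gt0.
have e1 j : e j <= 1 by rewrite invf_le1// ler1n.
pose G j p := (e j)^-1 * (F (p + e j *: dir k) - F p).
have bFt j : bb (fun p => F (p + e j *: dir k)).
  have cF : continuous F by apply: AS_continuous => //; exact: CkS.
  apply: (@bb_continuous _ _ _ (Mbox + `|dir k|)) => [p|p Mp].
    apply: (@continuous_comp _ _ _ (fun p => p + e j *: dir k) F); last exact: cF.
    by apply: continuousD; [exact: cvg_id|exact: cst_continuous].
  apply: AS_box => //; rewrite -(ltrD2r `|dir k|) (lt_le_trans Mp)//.
  have -> : p = (p + e j *: dir k) - e j *: dir k by rewrite addrK.
  rewrite (le_trans (ler_normB _ _))// addrK lerD2l normrZ gtr0_norm// ler_piMl//.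
(* The mean value theorem bounds the quotients by the bound [C] of the derivative, uniformly in [j];
   steps of length at most [|dir k|] keep all supports in one box. *)
have [bd cv] : bb (partial k F) /\ I (G j) @[j --> \oo] --> I (partial k F).
  apply: (@I_dominated _ _ G (partial k F) C (Mbox + `|dir k|)).
  - by move=> j; have [] := bbZ (e j)^-1 (bbB (bFt j) bF).
  - move=> j p; have [s sh E] := @line_MVT _ _ p (dir k) F (e j)
      (fun s _ => @ex_derive _ _ _ _ _ _ _ (AS_isD (s *: dir k + p) k CF aF)).
    rewrite /G [p + _]addrC E mulrA mulVf ?mul1r ?gt_eqF//; exact: dFC.
  - move=> j p Mp; rewrite /G !(AS_box aF) ?subrr ?mulr0//.
      by apply: le_lt_trans Mp; rewrite lerDl.
    rewrite -(ltrD2r `|dir k|) (lt_le_trans Mp)//.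
    have -> : p = (p + e j *: dir k) - e j *: dir k by rewrite addrK.
    rewrite (le_trans (ler_normB _ _))// addrK lerD2l normrZ gtr0_norm// ler_piMl//.
  - move=> p; have [d Ed] := AS_isD p k CF aF.
    have h : h^-1 *: (F (h *: dir k + p) - F p) @[h --> 0^'] --> partial k F p.
      by rewrite -[X in _ --> X]Ed; exact: d.
    have ec : e j @[j --> \oo] --> (0 : R)^'.
      have ec0 : e j @[j --> \oo] --> (0 : R) by exact: cvg_harmonic.
      move=> A hA; have H : \forall j \near \oo, e j != 0 -> A (e j) := ec0 _ hA.
      by apply: filterS H => j; apply; rewrite gt_eqF.
    have := cvg_comp _ _ ec h; apply: cvg_trans; apply: near_eq_cvg.
    by near=> j; rewrite /G/= [p + _]addrC.
have GI : (fun j => I (G j)) = (fun=> 0).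
  apply/funext => j; rewrite /G IZ ?IB ?I_translate ?subrr ?mulr0//.
  exact: bbB.
rewrite GI in cv; apply/esym; exact: (cvg_unique _ (cvg_cst 0) cv).
Unshelve. all: by end_near. Qed.

End annular_support.

Section integration_by_parts.
Context {R : realType} {n : nat} (rad : \bar R) (r1 r2 : R).
Hypothesis r1_gt0 : 0 < r1.
Hypothesis r2_rad : (r2%:E < rad)%E.
Local Notation X := ('rV[R]_n * R)%type.
Local Notation dir := (@coord_dir R n).
Local Notation Om := (@Om R n rad).
Local Notation oO := (@open_Om R n rad).
Local Notation AS := (@AS R n r1 r2).
Local Notation bbA := (bb_AS r1_gt0 r2_rad).
Local Arguments pcoord : simpl never.
Local Arguments coord_dir : simpl never.
Implicit Types (g h F w z : X -> R) (p : X).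

Local Opaque partial.

Lemma AS_partialM g F k p : Ck Om 1 g -> Ck Om 1 F -> AS F ->
  partial k (fun p => g p * F p) p = partial k g p * F p + g p * partial k F p.
Proof.
move=> Cg CF aF; have [h|h] := boolP (r1 <= rho p <= r2).
  have Op := annulus_Om r1_gt0 r2_rad h.
  by apply: grE; apply: isD_mul; [exact: Ck_isD Cg Op|exact: Ck_isD CF Op].
have aFg : AS (fun p => g p * F p) by exact: ASMr.
by rewrite (AS_partial k aF h) (AS_partial k aFg h) (aF p h) !mulr0 addr0.
Qed.

(** The dilation field has divergence [n + 2 = Q]: up to that multiple of [F], [EE F] is the sum of
    the exact derivatives of [x_i F] and twice that of [t F]. *)
Lemma I_EE F : Ck Om 1 F -> AS F -> I (EE F) = - (n%:R + 2) * I F.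
Proof.
move=> CF aF.
have Cx k : Ck Om 1 (pcoord k : X -> R) by exact: (Ck_pcoord oO).
pose D k := partial k (fun p => pcoord k p * F p).
have CxF k : Ck Om 1 (fun p => pcoord k p * F p) by exact: (CkM oO).
have axF k : AS (fun p => pcoord k p * F p) by exact: ASMr.
have DE k p : D k p = F p + pcoord k p * partial k F p.
  rewrite /D AS_partialM//; congr (_ + _).
  have -> : partial k (pcoord k) p = pcoord k (dir k) by apply: grE; exact: isD_pcoord.
  by rewrite pcoord_dir eqxx mul1r.
have bF : bb F by apply: bbA => //; exact: CkS.
have bE : bb (EE F) by apply: bbA; [exact: CkE|exact: AS_E].
have bD k : bb (D k).
  by apply: bbA; [exact: (Ck_partial _ (CxF k))|exact: AS_partial].
have E : I (fun p => EE F p + (n%:R + 2) * F p) = 0.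
  rewrite (@eq_I _ _ _ (fun p => \sum_i D (Some i) p + 2 * D None p)); last first.
    move=> p; rewrite DE; under [in RHS]eq_bigr do rewrite DE.
    rewrite big_split/= sumr_const card_ord -mulr_natl /EE /Ev /gr.
    rewrite -[p.2]/(pcoord None p).
    move: (\sum_i _) (partial None F p) (pcoord None p) => a b c; ring.
  rewrite ID ?IZ//; [|exact: bb_sum|exact: bbZ].
  have ID0 k : I (D k) = 0 := I_partial r1_gt0 r2_rad _ (CxF k) (axF k).
  by rewrite I_sum// (ID0 None) mulr0 addr0 big1// => i _; exact: ID0.
move: E; rewrite ID ?IZ//; last exact: bbZ.
by move=> /eqP; rewrite addr_eq0 mulNr => /eqP.
Qed.

Lemma I_EEM w F : Ck Om 1 w -> Ck Om 1 F -> AS F ->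
  I (fun p => w p * EE F p) = - I (fun p => ((n%:R + 2) * w p + EE w p) * F p).
Proof.
move=> Cw CF aF.
have CwF : Ck Om 1 (fun p => w p * F p) by exact: (CkM oO).
have awF : AS (fun p => w p * F p) by exact: ASMr.
have b1 : bb (fun p => w p * EE F p).
  by apply: bbA; [apply: (CkM oO); [exact: CkS|exact: CkE]|apply: ASMr; exact: AS_E].
have b2 : bb (fun p => EE w p * F p).
  by apply: bbA; [apply: (CkM oO); [exact: CkE|exact: CkS]|exact: ASMr].
have b3 : bb (fun p => w p * F p) by apply: bbA => //; exact: CkS.
have := I_EE CwF awF.
rewrite (@eq_I _ _ _ (fun p => EE w p * F p + w p * EE F p)); last first.
  move=> p; have [h|h] := boolP (r1 <= rho p <= r2).
    by rewrite (EEM Cw CF (annulus_Om r1_gt0 r2_rad h)).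
  by rewrite (AS_E awF h) (AS_E aF h) (aF p h) !mulr0 addr0.
rewrite ID// => E.
rewrite (@eq_I _ _ (fun p => (_ + _) * _) (fun p => (n%:R + 2) * (w p * F p) + EE w p * F p)); last first.
  by move=> p; ring.
rewrite (ID (bbZ _ b3) b2) IZ//; move: E.
by move: (I _) (I _) (I _) => a b c; lra.
Qed.

Lemma Ck_op k z : Ck Om k.+2 z -> Ck Om k (grushin_op z).
Proof.
move=> Cz.
apply: (@Ck_ext _ _ _ oO _ (fun p => \sum_i partial (Some i) (partial (Some i) z) p
  + s2 p * partial None (partial None z) p)).
  by move=> p _; rewrite /grushin_op enorm_sqr.
apply: (CkD oO).
  by apply: (Ck_sum oO) => i; do 2 apply: Ck_partial.
by apply: (CkM oO); [exact: sm_s2|do 2 apply: Ck_partial].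
Qed.

(** The coefficient [s2] does not depend on [t], so the operator is in divergence form. *)
Lemma I_op g z : Ck Om 1 g -> AS g -> Ck Om 2 z ->
  I (fun p => g p * grushin_op z p) = - I (fun p => Gv p (gr g p) (gr z p)).
Proof.
move=> Cg ag Cz.
have Cdz k : Ck Om 1 (partial k z) by exact: Ck_partial.
pose D i := partial (Some i) (fun p => partial (Some i) z p * g p).
pose Dt := partial None (fun p => (s2 p * partial None z p) * g p).
have Csz : Ck Om 1 (fun p => s2 p * partial None z p).
  by apply: (CkM oO); [exact: sm_s2|].
have DE i p : D i p = partial (Some i) (partial (Some i) z) p * g p +
    partial (Some i) z p * partial (Some i) g p := AS_partialM (Some i) p (Cdz (Some i)) Cg ag.
have DtE p : Dt p = s2 p * partial None (partial None z) p * g p +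
    s2 p * partial None z p * partial None g p.
  rewrite /Dt AS_partialM//.
  have [h|h] := boolP (r1 <= rho p <= r2); last first.
    by rewrite (ag p h) (AS_partial None ag h) !mulr0.
  have Op := annulus_Om r1_gt0 r2_rad h.
  congr (_ * _ + _); apply: grE.
  have h1 : is_derive p (dir None) s2 0.
    have := Ck_isD None (@sm_s2 _ _ _ 1) Op.
    by rewrite -[partial None s2 p]/(gr s2 p None) (gr_s2 Op).
  apply: isD_eq (isD_mul h1 (Ck_isD None (Cdz None) Op)) _.
  by rewrite mul0r add0r.
have CG : Ck Om 0 (fun p => Gv p (gr g p) (gr z p)).
  apply: (CkD oO).
    by apply: (Ck_sum oO) => i; apply: (CkM oO); [exact: (Ck_partial _ Cg)|exact: (CkS (Cdz _))].
  by apply: (CkM oO); [exact: sm_s2|apply: (CkM oO); [exact: (Ck_partial _ Cg)|exact: (CkS (Cdz _))]].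
have aG : AS (fun p => Gv p (gr g p) (gr z p)).
  move=> p h; rewrite (AS_gr ag h) /Gv mul0r mulr0 addr0 big1// => i _.
  by rewrite mul0r.
have b1 : bb (fun p => g p * grushin_op z p).
  by apply: bbA; [apply: (CkM oO); [exact: CkS|exact: Ck_op]|exact: ASMl].
have b2 := bbA CG aG.
have Cd i : Ck Om 1 (fun p => partial (Some i) z p * g p) := CkM oO (Cdz (Some i)) Cg.
have ad i : AS (fun p => partial (Some i) z p * g p) by exact: ASMr.
have Ct : Ck Om 1 (fun p => s2 p * partial None z p * g p) by exact: (CkM oO).
have at' : AS (fun p => s2 p * partial None z p * g p) by exact: ASMr.
have bD i : bb (D i).
  by apply: bbA; [exact: (Ck_partial _ (Cd i))|exact: AS_partial].
have bDt : bb Dt.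
  by apply: bbA; [exact: (Ck_partial _ Ct)|exact: AS_partial].
apply/eqP; rewrite -addr_eq0 -ID//.
rewrite (@eq_I _ _ _ (fun p => \sum_i D i p + Dt p)); last first.
  move=> p; rewrite DtE; under [in RHS]eq_bigr do rewrite DE.
  rewrite big_split/= -mulr_suml /grushin_op enorm_sqr /Gv /gr.
  have -> : \sum_i partial (Some i) g p * partial (Some i) z p =
    \sum_i partial (Some i) z p * partial (Some i) g p.
    by apply: eq_bigr => i _; rewrite mulrC.
  move: (\sum_i _) (\sum_i _) (partial None (partial None z) p) (partial None z p)
    (partial None g p) => a b c d e; ring.
rewrite ID//; last exact: bb_sum.
rewrite I_sum// (I_partial r1_gt0 r2_rad _ Ct at') addr0 big1// => i _.
exact: (I_partial r1_gt0 r2_rad _ (Cd i) (ad i)).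
Qed.

(* The tangential part of the operator: [grushin_op z] minus its radial part. *)
Definition Sop z p : R := grushin_op z p - sig p * (EE (EE z) p + n%:R * EE z p).

Lemma Ck_Sop k z : Ck Om k.+2 z -> Ck Om k (Sop z).
Proof.
move=> Cz; apply: (CkB oO); first exact: Ck_op.
apply: (CkM oO); first exact: sm_sig.
have CE : Ck Om k.+1 (EE z) by exact: CkE.
apply: (CkD oO); first exact: CkE.
by apply: (CkZ oO); exact: CkS.
Qed.

(** The radial part of [Gv] is integrated by parts along the dilation field, through the density
    [F]. The field has divergence [n + 2] and [sig] has degree -2, whence the coefficient [n] in
    [Sop]. *)
Lemma I_Sop g z : Ck Om 1 g -> AS g -> Ck Om 2 z ->
  I (fun p => g p * Sop z p) = - I (qf g z).
Proof.
move=> Cg ag Cz.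
have CE : Ck Om 1 (EE z) by exact: CkE.
have Csg : Ck Om 1 sig := @sm_sig _ _ _ 1.
pose F p := g p * (sig p * EE z p).
have CF : Ck Om 1 F := CkM oO Cg (CkM oO Csg CE).
have aF : AS F by exact: ASMl.
have b0 : bb F by apply: bbA => //; exact: CkS.
pose H p := sig p * (EE g p * EE z p).
have bH : bb H.
  apply: bbA; last by apply: ASMr; apply: ASMl; exact: AS_E.
  by apply: (CkM oO); [exact: CkS|apply: (CkM oO); [exact: CkE|exact: CkS]].
have b1 : bb (fun p => g p * grushin_op z p).
  by apply: bbA; [apply: (CkM oO); [exact: CkS|exact: Ck_op]|exact: ASMl].
have bEF : bb (EE F) by apply: bbA; [exact: CkE|exact: AS_E].
have EF p : EE F p = H p - 2 * F p + g p * (sig p * EE (EE z) p).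
  have [h|h] := boolP (r1 <= rho p <= r2); last first.
    by rewrite (AS_E aF h) /H /F (AS_E ag h) (ag p h); ring.
  have Op := annulus_Om r1_gt0 r2_rad h.
  rewrite /F (EEM Cg _ Op); last exact: (CkM oO).
  by rewrite (EEM Csg CE Op) (EE_sig Op) /H; ring.
have bq : bb (qf g z) := bbA (Ckq Cg (CkS Cz)) (AS_ql z ag).
have -> : I (fun p => g p * Sop z p) =
    I (fun p => (g p * grushin_op z p + H p) - (EE F p + (n%:R + 2) * F p)).
  by apply: eq_I => p; rewrite EF /Sop /H /F; ring.
rewrite IB; [|exact: bbD|apply: bbD => //; exact: bbZ].
rewrite (ID bEF (bbZ _ b0)) (I_EE CF aF) IZ// mulNr addNr subr0.
rewrite ID// (I_op Cg ag Cz).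
have -> : qf g z = (fun p => Gv p (gr g p) (gr z p) - H p) by [].
rewrite IB//; first by rewrite opprB addrC.
suff -> : (fun p => Gv p (gr g p) (gr z p)) = (fun p => qf g z p + H p) by exact: bbD.
by apply/funext => p; rewrite /qf /qv /H /EE subrK.
Qed.

End integration_by_parts.

(** * One-sided bounds: extended integrals and Fatou's lemma for difference quotients *)

Section integral_bounds.
Context {R : realType} {n : nat}.
Local Notation T := (measurableTypeR R).
Local Notation X := ('rV[R]_n * R)%type.
Local Notation mu := (@grushin_measure R n).
Implicit Types (g h F : X -> R) (p : X).

Lemma bb_indic (C M : R) : 0 <= C -> bb (fun p : X => C * \1_(box M) p).
Proof.
move=> C0; split.
  by apply: measurable_funM => //; apply: measurable_indic; exact: measurable_box.
exists C, M => p; rewrite indicE; split.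
  rewrite normrM ger0_norm// ler_piMr//.
  by case: (_ \in _) => /=; rewrite ?normr1 ?normr0.
by move=> pM; rewrite memNset ?mulr0//= /box/= => /le_lt_trans/(_ pM); rewrite ltxx.
Qed.

Lemma integral_bbD G (N : X -> R) (x : R) : bb G -> measurable_fun [set: 'rV[T]_n * T] N ->
  (forall p, 0 <= N p) -> (\int[mu]_p (N p)%:E <= x%:E)%E ->
  (\int[mu]_p (G p + N p)%:E <= (I G + x)%:E)%E.
Proof.
move=> bG mN N0 Nx.
have iN : mu.-integrable setT (EFin \o (N : 'rV[T]_n * T -> R)).
  apply/integrableP; split; first exact/measurable_EFinP.
  apply: le_lt_trans (ltry x); apply: le_trans Nx.
  rewrite le_eqVlt; apply/orP; left; apply/eqP; apply: eq_integral => p _ /=.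
  by rewrite ger0_norm.
have E := @integralD _ _ _ mu setT measurableT _ _ (bb_integrable bG) iN.
apply: (@le_trans _ _ (\int[mu]_p (G p)%:E + \int[mu]_p (N p)%:E)%E).
  by rewrite -E.
by rewrite (integral_bb bG) EFinD leeD2l.
Qed.

(** This extracts a real inequality from a bound on an extended integral, whose integrand [N] need
    not be bounded. *)
Lemma I_le_ge0 (K N : X -> R) (x : R) : bb K -> measurable_fun [set: 'rV[T]_n * T] N ->
  (forall p, 0 <= N p) -> (forall p, K p <= N p) ->
  (\int[mu]_p (N p)%:E <= x%:E)%E -> I K <= x.
Proof.
move=> bK mN N0 KN Nx.
have := integral_bbD (bbN bK) mN N0 Nx; rewrite (IN bK) => h.
suff : (0 <= (- I K + x)%:E :> \bar R)%E by rewrite lee_fin; lra.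
apply: le_trans h; apply: integral_ge0 => p _; rewrite lee_fin.
by have := KN p; lra.
Qed.

End integral_bounds.

Section fatou_partial.
Context {R : realType} {n : nat} (rad : \bar R) (r1 r2 : R).
Hypothesis r1_gt0 : 0 < r1.
Hypothesis r2_rad : (r2%:E < rad)%E.
Local Notation T := (measurableTypeR R).
Local Notation X := ('rV[R]_n * R)%type.
Local Notation mu := (@grushin_measure R n).
Local Notation dir := (@coord_dir R n).
Local Notation Om := (@Om R n rad).
Local Notation AS := (@AS R n r1 r2).
Local Notation bbA := (bb_AS r1_gt0 r2_rad).
Implicit Types (g h F : X -> R) (p : X).

(* A one-sided bound on the derivative is enough for Fatou's lemma on the
   difference quotients, so that [dF] need not be continuous. *)
Lemma fatou_partial F H (dF : X -> R) k : Ck Om 0 F -> AS F -> Ck Om 0 H -> AS H ->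
  (forall p, is_derive p (dir k) F (dF p)) -> (forall p, dF p <= H p) ->
  measurable_fun [set: 'rV[T]_n * T] (fun p => H p - dF p) /\
  (\int[mu]_p (H p - dF p)%:E <= (I H)%:E)%E.
Proof.
move=> CF aF CH aH isF dFH.
have [C C0 HC] := AS_bounded r1_gt0 r2_rad CH aH.
have bF : bb F by exact: bbA.
have bH : bb H by exact: bbA.
pose e (j : nat) : R := j.+1%:R^-1.
have e0 j : 0 < e j by rewrite invr_gt0.
have e1 j : e j <= 1 by rewrite invf_le1// ler1n.
pose M := Mbox r2 + `|dir k|.
pose G j p := (e j)^-1 * (F (p + e j *: dir k) - F p).
have out j p : M < `|p| -> F (p + e j *: dir k) = 0 /\ F p = 0.
  move=> Mp; split; last first.
    by apply: (AS_box r1_gt0 aF); apply: le_lt_trans Mp; rewrite lerDl.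
  apply: (AS_box r1_gt0 aF); rewrite -(ltrD2r `|dir k|) (lt_le_trans Mp)//.
  have -> : p = (p + e j *: dir k) - e j *: dir k by rewrite addrK.
  rewrite (le_trans (ler_normB _ _))// addrK lerD2l normrZ gtr0_norm// ler_piMl//.
have bFt j : bb (fun p => F (p + e j *: dir k)).
  have cF : continuous F by apply: (AS_continuous r1_gt0 r2_rad).
  apply: (@bb_continuous _ _ _ M) => [p|p Mp]; last exact: (out j p Mp).1.
  apply: (@continuous_comp _ _ _ (fun p => p + e j *: dir k) F); last exact: cF.
  by apply: continuousD; [exact: cvg_id|exact: cst_continuous].
have bG j : bb (G j) by exact: bbZ (bbB (bFt j) bF).
(* The mean value theorem makes the quotient a value of [dF], which lies below [H]. This upper bound
   alone makes the functions [g j] below nonnegative, as Fatou's lemma demands. *)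
have GC j p : G j p <= C * \1_(box M) p.
  rewrite indicE; have [pM|pM] := leP `|p| M; last first.
    rewrite /G (out j p pM).1 (out j p pM).2 subrr mulr0 mulr_ge0//.
  rewrite mem_set// mulr1.
  have [s sh E] := @line_MVT _ _ p (dir k) F (e j)
      (fun s _ => @ex_derive _ _ _ _ _ _ _ (isF (s *: dir k + p))).
  rewrite /G [p + _]addrC E mulrA mulVf ?mul1r ?gt_eqF//.
  have [_ ->] := isF (s *: dir k + p); rewrite (le_trans (dFH _))//.
  by rewrite (le_trans (ler_norm _)).
pose g j p := C * \1_(box M) p - G j p.
have bg j : bb (g j) by apply: bbB => //; exact: bb_indic.
have Gcv p : G j p @[j --> \oo] --> dF p.
  have [d Ed] := isF p.
  have h : h^-1 *: (F (h *: dir k + p) - F p) @[h --> 0^'] --> dF p.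
    by rewrite -[X in _ --> X]Ed; exact: d.
  have ec : e j @[j --> \oo] --> (0 : R)^'.
    have ec0 : e j @[j --> \oo] --> (0 : R) by exact: cvg_harmonic.
    move=> A hA; have H' : \forall j \near \oo, e j != 0 -> A (e j) := ec0 _ hA.
    by apply: filterS H' => j; apply; rewrite gt_eqF.
  have := cvg_comp _ _ ec h; apply: cvg_trans; apply: near_eq_cvg.
  by near=> j; rewrite /G/= [p + _]addrC.
have mdF : measurable_fun [set: 'rV[T]_n * T] dF.
  apply: (@measurable_fun_cvg _ _ _ _ G) => [j|p _]; last exact: Gcv.
  by have [] := bG j.
have mHdF : measurable_fun [set: 'rV[T]_n * T] (fun p => H p - dF p).
  by apply: measurable_funB => //; have [] := bH.
split => //.
have IG0 j : I (G j) = 0.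
  rewrite /G IZ ?IB ?I_translate ?subrr ?mulr0//; exact: bbB.
have b1 := @bb_indic R n C M C0.
have Fat : (\int[mu]_p (C * \1_(box M) p - dF p)%:E <= (I (fun p => (C * \1_(box M) p)%R))%:E)%E.
  have Fat0 := @fatou _ _ _ mu setT measurableT (fun j p => (g j p)%:E)
    (fun j => (measurable_EFinP _ _).2 (bg j).1).
  have g0 j p : setT p -> (0 <= (g j p)%:E)%E by move=> _; rewrite lee_fin subr_ge0.
  have {}Fat0 := Fat0 g0.
  have L : limn_einf (fun j => \int[mu]_p (g j p)%:E)%E =
      (I (fun p => (C * \1_(box M) p)%R))%:E.
    have -> : (fun j => \int[mu]_p (g j p)%:E)%E = (fun=> (I (fun p => (C * \1_(box M) p)%R))%:E).
      by apply/funext => j; rewrite (integral_bb (bg j)) /g (IB b1 (bG j)) IG0 subr0.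
    exact: (cvg_limn_einf_sup (cvg_cst _)).1.
  rewrite L in Fat0; apply: le_trans Fat0.
  rewrite le_eqVlt; apply/orP; left; apply/eqP; apply: eq_integral => p _.
  apply/esym; apply: (cvg_limn_einf_sup _).1; apply: cvg_EFin; first exact: nearW.
  by apply: cvgB; [exact: cvg_cst|exact: Gcv].
(* The crude majorant is now exchanged for [H]: their difference is nonnegative with finite
   integral, hence it can be subtracted from both sides. *)
have bCH : bb (fun p => C * \1_(box M) p - H p) by exact: bbB.
have CH0 p : 0 <= C * \1_(box M) p - H p.
  rewrite subr_ge0 indicE; have [pM|pM] := leP `|p| M.
    by rewrite mem_set// mulr1 (le_trans (ler_norm _)).
  rewrite (AS_box r1_gt0 aH) ?mulr_ge0//; apply: le_lt_trans pM; by rewrite lerDl.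
have D := @ge0_integralD _ _ _ mu setT measurableT
  (fun p => (C * \1_(box M) p - H p)%:E) (fun p => (H p - dF p)%:E)
  (fun p _ => CH0 p) ((measurable_EFinP _ _).2 bCH.1).
have {}D := D (fun p _ => ltac:(by rewrite lee_fin subr_ge0)) ((measurable_EFinP _ _).2 mHdF).
have : ((I (fun p => (C * \1_(box M) p)%R) - I H)%:E + \int[mu]_p (H p - dF p)%:E
    <= (I (fun p => (C * \1_(box M) p)%R))%:E)%E.
  apply: le_trans Fat; rewrite -(IB b1 bH) -(integral_bb bCH) -D.
  rewrite le_eqVlt; apply/orP; left; apply/eqP; apply: eq_integral => p _.
  by rewrite -EFinD; congr EFin; ring.
by rewrite -leeBrDl// -EFinB opprB addrC subrK.
Unshelve. all: by end_near. Qed.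

End fatou_partial.

(** * Hardy's inequality *)

Lemma isD_exp (R : realType) (r : R) (m : nat) :
  is_derive r 1 (fun s : R => s ^+ m) (m%:R * r ^+ m.-1).
Proof.
elim: m => [|k IH].
  by rewrite mul0r; under eq_fun do rewrite expr0; exact: isD_cst.
under eq_fun do rewrite exprS.
apply: isD_eq (isD_mul (is_derive_id r 1) IH) _.
by case: k {IH} => [|k]; rewrite ?expr0 -?pred_Sn ?exprS -?natr1; ring.
Qed.

Section bessel_coefficients.
Context {R : realType} (m : nat) (rad : \bar R) (V W f : R -> R).
Hypothesis VWf : bessel_pair m.+1 rad V W f.

(** The Riccati variable of the Bessel equation; [Nc] is the quadratic term of its Riccati
    equation. *)
Definition Bc r : R := V r * derive1 f r / f r.
Definition Nc r : R := V r * derive1 f r ^+ 2 / f r ^+ 2.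

Lemma Nc_ge0 r : 0 <= V r -> 0 <= Nc r.
Proof.
move=> V0; rewrite /Nc; apply: mulr_ge0; last by rewrite invr_ge0 sqr_ge0.
by apply: mulr_ge0 => //; exact: sqr_ge0.
Qed.

(** Near [r] the function [Bc] is the flux divided by [r ^+ m * f], a quotient of differentiable
    functions, also where [V] vanishes and [f'] is not known to be differentiable. The equation then
    gives the derivative; it contains [Nc], which is not known to be continuous. *)
Lemma Bc_isD r : radii rad r ->
  is_derive r 1 Bc (- (Nc r + m%:R * Bc r / r + W r)).
Proof.
move=> rr; have [_ _ f0 sol] := VWf.
have fr := f0 _ rr; have [df dflux ode] := sol r rr.
have r0 : 0 < r by case: rr.
have fn0 : f r != 0 by rewrite gt_eqF.
have rn0 : r != 0 by rewrite gt_eqF.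
pose flux s := s ^+ m * V s * derive1 f s.
have h1 : is_derive r 1 flux (derive1 flux r) by rewrite derive1E; exact: derivableP.
have h2 : is_derive r 1 (fun s : R => s ^+ m) (m%:R * r ^+ m.-1).
  exact: isD_exp.
have rmn0 : r ^+ m != 0 by rewrite expf_neq0.
have h3 := @isD_inv _ _ r 1 (fun s : R => s ^+ m) _ rmn0 h2.
have h4 : is_derive r 1 f (derive1 f r) by rewrite derive1E; exact: (@derivableP _ _ _ f r 1 df).
have h5 := isD_mul (isD_mul h1 h3) (isD_inv fn0 h4).
apply: (@isD_near _ _ _ _ _ _ _ _ (isD_eq h5 _)).
  near=> s; rewrite /flux /Bc.
  have sn0 : s != 0.
    by rewrite gt_eqF//; near: s; exact: lt_nbhsr.
  have smn0 : s ^+ m != 0 by rewrite expf_neq0.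
  congr (_ / _); move: (s ^+ m) (V s) (derive1 f s) smn0 => a b c a0.
  by field.
have E : derive1 flux r = - (r ^+ m * W r * f r) by apply/eqP; rewrite -addr_eq0; apply/eqP.
rewrite E /flux /Bc /Nc.
case: m rmn0 {h1 h2 h3 h5 E} => [|k] _.
  by rewrite !expr0 !mul0r; field; rewrite fn0.
have rkn0 : r ^+ k != 0 by rewrite expf_neq0.
by rewrite exprS -pred_Sn; field; rewrite fn0 rn0 rkn0.
Unshelve. all: by end_near. Qed.

Lemma Bc_continuous r : radii rad r -> {for r, continuous Bc}.
Proof.
move=> rr; apply: differentiable_continuous; apply/derivable1_diffP.
by have [] := Bc_isD rr.
Qed.

Lemma W_continuous r : radii rad r -> {for r, continuous W}.
Proof.
move=> rr; have [_ CW _ _] := VWf; have [dW _] := CW r rr.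
by apply: differentiable_continuous; apply/derivable1_diffP.
Qed.

End bessel_coefficients.

Section hardy.
Context {R : realType} {n : nat} (rad : \bar R) (r1 r2 : R).
Hypothesis r1_gt0 : 0 < r1.
Hypothesis r2_rad : (r2%:E < rad)%E.
Variables (V W f : R -> R).
Hypothesis VWf : bessel_pair n.+2 rad V W f.
Hypothesis V_ge0 : forall r, radii rad r -> 0 <= V r.
Local Notation T := (measurableTypeR R).
Local Notation X := ('rV[R]_n * R)%type.
Local Notation mu := (@grushin_measure R n).
Local Notation dir := (@coord_dir R n).
Local Notation Om := (@Om R n rad).
Local Notation oO := (@open_Om R n rad).
Local Notation AS := (@AS R n r1 r2).
Local Notation bbA := (bb_AS r1_gt0 r2_rad).
Local Notation B := (Bc V f).
Local Notation N := (Nc V f).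
Local Arguments pcoord : simpl never.
Local Arguments coord_dir : simpl never.
Implicit Types (g h F : X -> R) (p : X).

Lemma Ck0_B : Ck Om 0 (fun p => B (rho p)).
Proof. by apply: Ck0_radial => r rr; exact: (Bc_continuous VWf). Qed.

Lemma Ck0_W : Ck Om 0 (fun p => W (rho p)).
Proof. by apply: Ck0_radial => r rr; exact: (W_continuous VWf). Qed.

(** Each coordinate contributes to [E rho] with the same sign. So [N q0] splits into nonnegative
    pieces, and [fatou_partial] can be used one coordinate at a time. *)
Lemma pcoord_gr_rho k p : Om p -> 0 <= pcoord k p * gr rho p k.
Proof.
move=> Op; rewrite (gr_rho Op).
have r3 : 0 <= (rho p)^-1 ^+ 3 by rewrite exprn_ge0// invr_ge0 rho_ge0.
case: k => [i|]; rewrite /pcoord.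
  rewrite (_ : _ * _ = s2 p * (p.1 0 i ^+ 2) * (rho p)^-1 ^+ 3); last by ring.
  by apply: mulr_ge0 => //; apply: mulr_ge0; [exact: s2_ge0|exact: sqr_ge0].
rewrite (_ : _ * _ = 2 * (p.2 ^+ 2) * (rho p)^-1 ^+ 3); last by ring.
by apply: mulr_ge0 => //; apply: mulr_ge0 => //; exact: sqr_ge0.
Qed.

(** One coordinate of the divergence of the dilation field times [B q0 / rho]. By the Riccati
    equation the derivative of [F] is [H - N'] with [H] continuous and [N'] nonnegative. *)
Lemma hardy_component q0 k : Ck Om 1 q0 -> AS q0 -> (forall p, 0 <= q0 p) ->
  exists H : X -> R, [/\ Ck Om 0 H, AS H,
   (forall p, Om p -> H p = B (rho p) * ((rho p)^-1 * q0 p)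
      - ((n.+1)%:R * B (rho p) / rho p + W (rho p)) * (pcoord k p * gr rho p k * ((rho p)^-1 * q0 p))
      + B (rho p) * (pcoord k p * gr (fun p => (rho p)^-1 * q0 p) p k)) &
   let N' p := N (rho p) * (pcoord k p * gr rho p k * ((rho p)^-1 * q0 p)) in
   [/\ measurable_fun [set: 'rV[T]_n * T] N', (forall p, 0 <= N' p) &
      (\int[mu]_p (N' p)%:E <= (I H)%:E)%E]].
Proof.
move=> Cq aq q0_ge0.
pose w p := (rho p)^-1 * q0 p.
have Cw : Ck Om 1 w := CkM oO (@sm_rinv _ _ rad 1) Cq.
have aw : AS w by exact: ASMr.
have Cx : Ck Om 1 (pcoord k : X -> R) by exact: (Ck_pcoord oO).
have Cdr : Ck Om 0 (partial k rho) by exact: (Ck_partial _ (@sm_rho _ _ _ 1)).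
pose H p := B (rho p) * w p
      - ((n.+1)%:R * B (rho p) * (rho p)^-1 + W (rho p)) * (pcoord k p * partial k rho p * w p)
      + B (rho p) * (pcoord k p * partial k w p).
pose F p := pcoord k p * (B (rho p) * w p).
pose N' p := N (rho p) * (pcoord k p * gr rho p k * w p).
have CF : Ck Om 0 F.
  by apply: (CkM oO); [exact: CkS|apply: (CkM oO); [exact: Ck0_B|exact: CkS]].
have aF : AS F by apply: ASMr; exact: ASMr.
have CH : Ck Om 0 H.
  have CB := Ck0_B.
  have Cri : Ck Om 0 (fun p => (rho p)^-1) by exact: sm_rinv.
  apply: (CkD oO).
    apply: (CkB oO); first by apply: (CkM oO) => //; exact: CkS.
    apply: (CkM oO); first by apply: (CkD oO); [do !apply: (CkM oO) => //; exact: (Ck_cst oO)|exact: Ck0_W].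
    by apply: (CkM oO); [apply: (CkM oO) => //; exact: CkS|exact: CkS].
  by apply: (CkM oO) => //; apply: (CkM oO); [exact: CkS|exact: (Ck_partial _ Cw)].
have aH : AS H.
  apply: ASD; last by apply: ASMr; apply: ASMr; exact: AS_partial.
  by apply: ASB; apply: ASMr => //; exact: ASMr.
have aN : AS N' by apply: ASMr; exact: ASMr.
have N'0 p : 0 <= N' p.
  have [h|h] := boolP (r1 <= rho p <= r2); last by rewrite aN.
  have Op := annulus_Om r1_gt0 r2_rad h.
  have wp : 0 <= w p by rewrite mulr_ge0// invr_ge0 rho_ge0.
  rewrite /N' mulr_ge0//; last by rewrite mulr_ge0// pcoord_gr_rho.
  by apply: Nc_ge0; apply: V_ge0; exact: Om_radii.
have isF p : is_derive p (dir k) F (H p - N' p).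
  have [h|h] := boolP (r1 <= rho p <= r2); last first.
    by rewrite aH// aN// subrr; exact: (AS_isD0 (dir k) aF h).
  have Op := annulus_Om r1_gt0 r2_rad h.
  have hB := isD_comp (Bc_isD VWf (Om_radii Op)) (Ck_isD k (@sm_rho _ _ _ 1) Op).
  have hF := isD_mul (isD_pcoord k p (dir k)) (isD_mul hB (Ck_isD k Cw Op)).
  apply: isD_eq hF _; rewrite pcoord_dir eqxx mul1r /H /N' /gr.
  move: (B (rho p)) (W (rho p)) (N (rho p)) (partial k w p) (partial k rho p) => b w' n' dw dr.
  ring.
exists H; split => //.
have [mN IN] := @fatou_partial R n rad r1 r2 r1_gt0 r2_rad F H (fun p => H p - N' p) k
  CF aF CH aH isF (fun p => ltac:(by rewrite gerBl)).
have E : (fun p => H p - (H p - N' p)) = N' by apply/funext => p; rewrite opprB addrC subrK.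
split => //; first by rewrite -[X in measurable_fun _ X]/N' -E.
apply: le_trans IN; rewrite le_eqVlt; apply/orP; left; apply/eqP.
by apply: eq_integral => p _; rewrite opprB addrC subrK.
Qed.

(** Formally an equality, since the dilation field times [B q0 / rho] has divergence of integral
    zero. The components are added with weight 1 for [x_i] and 2 for [t]: then [E rho = rho]
    reassembles [N q0], and the divergence [n + 2] of the field cancels against the [n + 1] of the
    Riccati equation and the degree -1 of [1 / rho]. *)
Lemma hardy q0 : Ck Om 1 q0 -> AS q0 -> (forall p, 0 <= q0 p) ->
  [/\ measurable_fun [set: 'rV[T]_n * T] (fun p => N (rho p) * q0 p),
   (forall p, 0 <= N (rho p) * q0 p) &
   (\int[mu]_p (N (rho p) * q0 p)%:E <=
     (I (fun p => B (rho p) * ((rho p)^-1 * EE q0 p) - W (rho p) * q0 p))%:E)%E].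
Proof.
move=> Cq aq q0_ge0.
have /(@choice _ _ _)[H HH] := fun k => hardy_component k Cq aq q0_ge0.
pose w p := (rho p)^-1 * q0 p.
have Cw : Ck Om 1 w := CkM oO (@sm_rinv _ _ rad 1) Cq.
have aw : AS w by exact: ASMr.
pose N' k p := N (rho p) * (pcoord k p * gr rho p k * w p).
have aN' k : AS (N' k) by apply: ASMr; exact: ASMr.
have mN' k : measurable_fun [set: 'rV[T]_n * T] (N' k) by have [_ _ _ []] := HH k.
have N'0 k p : 0 <= N' k p by have [_ _ _ [_ + _]] := HH k; apply.
have IN' k : (\int[mu]_p (N' k p)%:E <= (I (H k))%:E)%E by have [_ _ _ []] := HH k.
have CH k : Ck Om 0 (H k) by have [] := HH k.
have aH k : AS (H k) by have [] := HH k.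
have bH k : bb (H k) by exact: bbA.
have HE k p : Om p -> H k p = B (rho p) * w p
      - ((n.+1)%:R * B (rho p) / rho p + W (rho p)) * (pcoord k p * gr rho p k * w p)
      + B (rho p) * (pcoord k p * gr w p k) by move=> Op; have [_ _ + _] := HH k; apply.
have NE : (fun p => N (rho p) * q0 p) = (fun p => \sum_i N' (Some i) p + 2 * N' None p).
  apply/funext => p; have [h|h] := boolP (r1 <= rho p <= r2); last first.
    by rewrite (aq p h) (aN' None p h) !mulr0 addr0 big1// => i _; exact: aN'.
  have Op := annulus_Om r1_gt0 r2_rad h.
  have r0 := Om_rho_neq0 Op.
  have := EE_rho Op; rewrite /EE /Ev => Er.
  transitivity (N (rho p) * (\sum_i p.1 0 i * gr rho p (Some i) + 2 * p.2 * gr rho p None) * w p).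
    by rewrite Er /w; field.
  rewrite mulrDr mulrDl mulr_sumr mulr_suml; congr (_ + _).
    by apply: eq_bigr => i _; rewrite /N' /pcoord; ring.
  by rewrite /N' /pcoord; ring.
have N0 p : 0 <= N (rho p) * q0 p.
  rewrite -[X in 0 <= X]/((fun p => N (rho p) * q0 p) p) NE addr_ge0//.
    by apply: sumr_ge0 => i _.
  by rewrite mulr_ge0.
have mS : measurable_fun [set: 'rV[T]_n * T] (fun p => \sum_i N' (Some i) p).
  by apply: measurable_sum => i.
have m2 : measurable_fun [set: 'rV[T]_n * T] (fun p => 2 * N' None p).
  exact: measurable_funM.
split => //; first by rewrite NE; exact: measurable_funD.
have -> : (\int[mu]_p (N (rho p) * q0 p)%:E =
   \sum_(i < n) \int[mu]_p (N' (Some i) p)%:E + 2%:E * \int[mu]_p (N' None p)%:E)%E.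
  have D := @ge0_integralD _ _ _ mu setT measurableT
    (fun p => (\sum_i N' (Some i) p)%:E) (fun p => (2 * N' None p)%:E)
    (fun p _ => ltac:(by rewrite lee_fin; apply: sumr_ge0 => i _))
    ((measurable_EFinP _ _).2 mS)
    (fun p _ => ltac:(by rewrite lee_fin mulr_ge0))
    ((measurable_EFinP _ _).2 m2).
  transitivity (\int[mu]_p ((\sum_i N' (Some i) p)%:E + (2 * N' None p)%:E))%E.
    by apply: eq_integral => p _; rewrite -EFinD -[(N (rho p) * q0 p)%R]/((fun p => N (rho p) * q0 p) p) NE.
  rewrite D; congr (_ + _)%E.
    rewrite -ge0_integral_sum//.
    - by apply: eq_integral => p _; rewrite sumEFin.
    - by move=> i; exact/measurable_EFinP.
    - by move=> i p _; rewrite lee_fin.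
  rewrite -ge0_integralZl_EFin//.
  - by move=> p _; rewrite lee_fin.
  - exact/measurable_EFinP.
apply: (@le_trans _ _ (\sum_(i < n) (I (H (Some i)))%:E + 2%:E * (I (H None))%:E)%E).
  apply: leeD; first by apply: lee_sum => i _.
  by apply: lee_wpmul2l => //; rewrite lee_fin.
rewrite sumEFin -EFinM -EFinD -I_sum// -IZ// -ID//; [|exact: bb_sum|exact: bbZ].
rewrite le_eqVlt; apply/orP; left; apply/eqP; congr EFin; apply: eq_I => p.
have [h|h] := boolP (r1 <= rho p <= r2); last first.
  rewrite (aH None p h) (aq p h) (AS_E aq h) !mulr0 subr0 addr0 big1// => i _.
  by rewrite (aH _ p h).
have Op := annulus_Om r1_gt0 r2_rad h.
have r0 := Om_rho_neq0 Op.
have Er := EE_rho Op.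
have Ew : EE w p = - (rho p)^-1 * q0 p + (rho p)^-1 * EE q0 p.
  by rewrite (EEM (@sm_rinv _ _ _ 1) Cq Op) (EE_rinv Op).
rewrite HE//; under eq_bigr do rewrite HE//.
pose Z := (n.+1)%:R * B (rho p) / rho p + W (rho p).
transitivity ((n%:R + 2) * (B (rho p) * w p) - Z * (EE rho p * w p) + B (rho p) * EE w p).
  rewrite /EE /Ev big_split sumrB/= sumr_const card_ord -[_ *+ n]mulr_natl.
  rewrite /Z -!mulr_sumr -!mulr_suml /pcoord.
  by move: (\sum_i _) (\sum_i _) => x y; ring.
by rewrite Er Ew /Z /w -natr1; field.
Qed.

End hardy.

(** * Ground states *)

Section ground_state.
Context {R : realType} {n : nat} (rad : \bar R) (r1 r2 : R).
Hypothesis r1_gt0 : 0 < r1.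
Hypothesis r2_rad : (r2%:E < rad)%E.
Local Notation T := (measurableTypeR R).
Local Notation X := ('rV[R]_n * R)%type.
Local Notation Om := (@Om R n rad).
Local Notation oO := (@open_Om R n rad).
Local Notation AS := (@AS R n r1 r2).
Local Notation bbA := (bb_AS r1_gt0 r2_rad).
Implicit Types (g h F w : X -> R) (p : X).

Lemma bounded_annulus g : Ck Om 0 g ->
  exists2 C, 0 <= C & forall p, r1 <= rho p <= r2 -> `|g p| <= C.
Proof.
move=> Cg; pose A := [set p : X | r1 <= rho p <= r2].
have cA : compact A.
  apply: (@subclosed_compact _ _ (box (Mbox r2))).
  - have -> : A = rho @^-1` `[r1, r2]%classic.
      by apply/seteqP; split => p; rewrite /A /= in_itv.
    by apply: preimage_closed; [move=> p _; exact: rho_continuous|exact: itv_closed].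
  - exact: compact_box.
  - by move=> p pA; exact: (annulus_box r1_gt0 pA).
have wc : {within A, continuous g}.
  apply: continuous_in_subspaceT => p; rewrite inE => pA.
  exact: (Ck_cont Cg (annulus_Om r1_gt0 r2_rad pA)).
have /compact_bounded[C [_ gC]] := continuous_compact wc cA.
exists (`|C| + 1) => [|p pA]; first by rewrite addr_ge0.
apply: (gC (`|C| + 1)); first by rewrite (le_lt_trans (ler_norm _))// ltrDl.
by exists p.
Qed.

Variable phi : R -> R.
Hypothesis phi_C1 : C1_on (radii rad) phi.
Hypothesis phi_ge0 : forall r, radii rad r -> 0 <= phi r.

(** The form of the spectral gap, which will be used with [phi = V / rho^2] and
    [k = n + 1 = Q - 1]. *)
Definition Pform (k : R) g : R :=
  I (fun p => phi (rho p) * (qf g g p - k * sig p * g p ^+ 2)).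

Lemma Ck1_phi : Ck Om 1 (fun p => phi (rho p)).
Proof. exact: Ck1_radial. Qed.

Lemma Ck0_phi : Ck Om 0 (fun p => phi (rho p)).
Proof. exact/CkS/Ck1_phi. Qed.

Lemma bb_Pform k g : Ck Om 1 g -> AS g ->
  bb (fun p => phi (rho p) * (qf g g p - k * sig p * g p ^+ 2)).
Proof.
move=> Cg ag; apply: bbA.
  apply: (CkM oO); first exact: Ck0_phi.
  apply: (CkB oO); first exact: Ckq.
  apply: (CkM oO); last by apply: (CkX oO); exact: CkS.
  by apply: (CkZ oO); exact: sm_sig.
apply: ASMr; apply: ASB; first exact: AS_ql.
by apply: ASMr => p /ag ->; rewrite expr0n.
Qed.

(** Were [z] free of zeros, testing [S z = - l sig z] with [phi w^2 / z] and expanding [q >= 0] at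
    [grad w - (w / z) grad z] would give [Pform l w >= 0]. With [1 / z] replaced by
    [m = z / (z^2 + d)] there remain errors with the factors [w^2 d / (z^2 + d)] and
    [w^2 d / (z^2 + d)^2], which the bound of [w] by [z] makes small. *)
Lemma ground_state (z : X -> R) (l k C eps : R) :
  continuous z -> smooth_on Om z ->
  (forall p, Om p -> Sop z p = - l * (sig p * z p)) ->
  k <= l -> 0 <= l -> 0 <= C -> 0 < eps ->
  exists2 eta, 0 < eta & forall w, Ck Om 1 w -> AS w ->
    (forall p, w p ^+ 2 <= C * z p ^+ 2 + eta) -> - eps <= Pform k w.
Proof.
move=> cz sz Sz kl l0 C0 eps0.
have [K1 K10 HK1] : exists2 K, 0 <= K & forall p, r1 <= rho p <= r2 ->
    `|phi (rho p) * (l * sig p)| <= K.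
  apply: bounded_annulus; apply: (CkM oO); first exact: Ck0_phi.
  by apply: (CkZ oO); exact: sm_sig.
have [K2 K20 HK2] : exists2 K, 0 <= K & forall p, r1 <= rho p <= r2 ->
    `|phi (rho p) * qf z z p| <= K.
  apply: bounded_annulus; apply: (CkM oO); first exact: Ck0_phi.
  exact: (smq sz sz 0%N).
pose ib p : R := \1_(box (Mbox r2)) p.
pose d (j : nat) : R := j.+1%:R^-1.
have d0 j : 0 < d j by rewrite invr_gt0.
(* The part of the second error factor that is due to [C z^2]: at most 1, and tending to 0 with [d]
   at every point, the zeros of [z] included, so that dominated convergence applies. *)
pose e (j : nat) p := ib p * (z p ^+ 2 * d j / (z p ^+ 2 + d j) ^+ 2).
have D0 j p : 0 < z p ^+ 2 + d j by rewrite ltr_wpDl// sqr_ge0.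
have ib01 p : 0 <= ib p <= 1.
  by rewrite /ib indicE; case: (_ \in _); rewrite /= ?lexx ler01.
have e01 j p : 0 <= e j p <= 1.
  have /andP[i0 i1] := ib01 p.
  have h0 : 0 <= z p ^+ 2 * d j / (z p ^+ 2 + d j) ^+ 2.
    by rewrite divr_ge0 ?sqr_ge0// mulr_ge0 ?sqr_ge0// ltW.
  rewrite /e mulr_ge0//= -[leRHS]mulr1 ler_pM//.
  rewrite ler_pdivrMr ?exprn_gt0// mul1r.
  have := sqr_ge0 (z p); have := d0 j; nra.
have bib (x : R) : 0 <= x -> bb (fun p => x * ib p) by exact: bb_indic.
have me j : measurable_fun [set: 'rV[T]_n * T] (e j).
  have cF : continuous (fun p => z p ^+ 2 * d j * ((z p ^+ 2 + d j) ^+ 2)^-1).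
    move=> p.
    have c2 : {for p, continuous (fun p => z p ^+ 2)}.
      rewrite (_ : (fun p => z p ^+ 2) = (fun p => z p * z p)).
        by apply: continuousM; exact: cz.
      by apply/funext => q; rewrite expr2.
    have c3 : {for p, continuous (fun p => z p ^+ 2 + d j)}.
      by apply: continuousD => //; exact: cst_continuous.
    have c4 : {for p, continuous (fun p => (z p ^+ 2 + d j) ^+ 2)}.
      rewrite (_ : (fun p => (z p ^+ 2 + d j) ^+ 2) =
        (fun p => (z p ^+ 2 + d j) * (z p ^+ 2 + d j))); first exact: continuousM.
      by apply/funext => q; rewrite expr2.
    have c5 : {for p, continuous (fun p => ((z p ^+ 2 + d j) ^+ 2)^-1)}.
      by apply: continuousV => //; rewrite expf_neq0// gt_eqF.
    have c6 : {for p, continuous (fun p => z p ^+ 2 * d j)}.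
      by apply: continuousM => //; exact: cst_continuous.
    exact: continuousM c6 c5.
  apply: measurable_funM; first by apply: measurable_indic; exact: measurable_box.
  exact: (measurable_continuous cF).
have out j p : Mbox r2 < `|p| -> e j p = 0.
  move=> pM; rewrite /e /ib indicE memNset ?mul0r//= /box/= => /le_lt_trans/(_ pM).
  by rewrite ltxx.
have d_cvg : d j @[j --> \oo] --> (0 : R) by exact: cvg_harmonic.
have [_ Ie] : bb (fun _ : X => 0 : R) /\
    I (e j) @[j --> \oo] --> I (fun _ : X => 0 : R).
  apply: (@I_dominated R n e (fun _ : X => 0) 1 (Mbox r2)) => //.
    by move=> j p; have /andP[h1 h2] := e01 j p; rewrite ger0_norm.
  move=> p; have [z0|z0] := eqVneq (z p) 0.
    rewrite (_ : (fun j => e j p) = (fun=> 0)); first exact: cvg_cst.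
    by apply/funext => j; rewrite /e z0 expr0n/= !mul0r mulr0.
  have z2 : 0 < z p ^+ 2 by rewrite exprn_even_gt0.
  apply: (@squeeze_cvgr nat \oo _ R (fun=> 0) (fun j => (z p ^+ 2)^-1 * d j) (fun j => e j p) _ 0).
  - near=> j; have /andP[-> _] := e01 j p; rewrite /=.
    have /andP[i0 i1] := ib01 p.
    rewrite /e -[leRHS]mul1r ler_pM//.
      by rewrite divr_ge0 ?sqr_ge0// mulr_ge0 ?sqr_ge0// ltW.
    rewrite ler_pdivrMr ?exprn_gt0//.
    move: (z p ^+ 2) (d j) z2 (d0 j) => zz t zz0 t0.
    have -> : zz^-1 * t * (zz + t) ^+ 2 = zz * t + (2 * t * t + zz^-1 * t * t * t).
      by field; rewrite gt_eqF.
    by rewrite lerDl addr_ge0// !mulr_ge0 ?invr_ge0// ltW.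
  - exact: cvg_cst.
  - rewrite -[X in _ --> X](mulr0 (z p ^+ 2)^-1); apply: cvgM => //; exact: cvg_cst.
rewrite I0 in Ie.
pose mB := I ib.
have mB0 : 0 <= mB by apply: I_ge0 => p; have /andP[] := ib01 p.
have bi : bb ib by have := bib 1 ler01; congr bb; apply/funext => p; rewrite mul1r.
have lim0 : (K1 * C * mB) * d j + (K2 * C) * I (e j) @[j --> \oo] --> (0 : R).
  rewrite -[X in _ --> X](_ : K1 * C * mB * 0 + K2 * C * 0 = 0); last by rewrite !mulr0 addr0.
  by apply: cvgD; apply: cvgM => //; exact: cvg_cst.
have e2 : 0 < eps / 2 by rewrite divr_gt0.
(* First [d] is fixed, so that the errors proportional to [C] take less than half of [eps]. Only
   then is [eta] chosen, because [eta / d] occurs; the 1 added in [S] keeps the divisor positive. *)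
have [j Hj] : exists j, (K1 * C * mB) * d j + (K2 * C) * I (e j) < eps / 2.
  have [j _ Hj] := cvgr_lt _ lim0 _ e2; exists j; exact: (Hj j (leqnn j)).
pose S := (K1 + K2 / d j) * mB + 1.
have S0 : 0 < S.
  by rewrite ltr_wpDl// mulr_ge0// addr_ge0// divr_ge0// ltW.
exists (eps / 2 / S); first by rewrite divr_gt0.
set eta := eps / 2 / S => w Cw aw wz.
have eta0 : 0 < eta by rewrite /eta divr_gt0.
have etaS : eta * S = eps / 2 by rewrite /eta divfK// gt_eqF.
clearbody eta.
pose D p := z p ^+ 2 + d j.
have CD : Ck Om 1 D.
  by apply: (CkD oO); [apply: (CkX oO); exact: sz|exact: (Ck_cst oO)].
have Dn0 p : D p != 0 by rewrite gt_eqF//; exact: D0.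
have CDi : Ck Om 1 (fun p => (D p)^-1) by apply: (CkV oO).
pose m p := z p * (D p)^-1.
have Cm : Ck Om 1 m := CkM oO (sz 1) CDi.
pose G p := phi (rho p) * (m p * (w p * w p)).
have CG : Ck Om 1 G := CkM oO Ck1_phi (CkM oO Cm (CkM oO Cw Cw)).
have aG : AS G by apply: ASMr; apply: ASMr; exact: ASMr.
have bq : bb (qf G z) := bbA (Ckq CG (sz 1)) (AS_ql z aG).
have bS : bb (fun p => G p * Sop z p).
  by apply: bbA; [apply: (CkM oO); [exact: CkS|exact: Ck_Sop]|exact: ASMl].
have T0 : I (fun p => qf G z p + G p * Sop z p) = 0.
  by rewrite ID// (I_Sop r1_gt0 r2_rad CG aG (sz 2)) subrr.
have qG p : Om p -> qf G z p = phi (rho p) * (2 * m p * w p * qf w z p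
    + w p ^+ 2 * ((d j - z p ^+ 2) / D p ^+ 2) * qf z z p).
  move=> Op; have [dphi _] := phi_C1 (Om_radii Op).
  have Cww : Ck Om 1 (fun p => w p * w p) by exact: (CkM oO).
  have Cmw : Ck Om 1 (fun p => m p * (w p * w p)) by exact: (CkM oO).
  have Cz1 : Ck Om 1 z by exact: sz.
  have grD' : gr D p = (fun k => 2 * z p * gr z p k).
    rewrite (grD _ (Ck_cst oO 1 (d j)) Op); last exact: (CkX oO).
    apply/funext => i; rewrite gr_cst addr0 mul1r.
    rewrite (@gr_ext _ _ rad _ (fun p => z p * z p) p Op); last by move=> q _; rewrite expr2.
    by rewrite (grM Cz1 Cz1 Op); ring.
  have -> : qf G z p = m p * (w p * w p) * qv p (gr (fun p => phi (rho p)) p) (gr z p)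
     + phi (rho p) * qf (fun p => m p * (w p * w p)) z p.
    by rewrite /qf (grM Ck1_phi Cmw Op) qv_linl qv_scalel.
  rewrite (qv_radial _ Op dphi) mulr0 add0r; congr (_ * _).
  rewrite /qf (grM Cm Cww Op) qv_linl qv_scalel (grM Cw Cw Op) qv_linl qv_scalel.
  rewrite (grM Cz1 CDi Op) qv_linl qv_scalel (grV CD Op (Dn0 p)) qv_scalel grD' qv_scalel.
  rewrite -/(qf w z p) -/(qf z z p) /m.
  have := Dn0 p; rewrite /D; move: (qf w z p) (qf z z p) (w p) (z p) (d j) => a b x y t tn0.
  by field.
pose Err p := (K1 * (C * d j + eta) + K2 * (eta / d j)) * ib p + K2 * C * e j p.
have dj0 := ltW (d0 j); have eta0' := ltW eta0.
have E0 : 0 <= K1 * (C * d j + eta) + K2 * (eta / d j).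
  apply: addr_ge0; apply: mulr_ge0 => //; last exact: divr_ge0.
  by apply: addr_ge0 => //; exact: mulr_ge0.
have be : bb (e j).
  split => //; exists 1, (Mbox r2) => p; split; last exact: out.
  by have /andP[h1 h2] := e01 j p; rewrite ger0_norm.
have bErr : bb Err.
  apply: bbD; last exact: bbZ.
  exact: bib.
have main p : qf G z p + G p * Sop z p - Err p <=
    phi (rho p) * (qf w w p - k * sig p * w p ^+ 2).
  have [h|h] := boolP (r1 <= rho p <= r2); last first.
    rewrite (AS_ql z aG h) (aG p h) (AS_ql w aw h) (aw p h) expr0n/= !mulr0 mul0r subr0 mulr0.
    rewrite add0r sub0r oppr_le0; apply: addr_ge0.
      by apply: mulr_ge0 => //; have /andP[] := ib01 p.
    by apply: mulr_ge0; [exact: mulr_ge0|have /andP[] := e01 j p].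
  have Op := annulus_Om r1_gt0 r2_rad h.
  have ph0 := phi_ge0 (Om_radii Op).
  have ib1 : ib p = 1 by rewrite /ib indicE mem_set//; exact: (annulus_box r1_gt0 h).
  (* The form [q] at [grad w - m w grad z], which absorbs the cross term of [qG]. *)
  have ps : 0 <= qf w w p - 2 * (m p * w p) * qf w z p + (m p * w p) ^+ 2 * qf z z p.
    have := qv_ge0 p (fun i => (- (m p * w p)) * gr z p i + gr w p i).
    rewrite qv_linl !qv_linr (qv_sym p (gr z p) (gr w p)) -/(qf w w p) -/(qf w z p) -/(qf z z p).
    by move: (qf w w p) (qf w z p) (qf z z p) (m p) (w p) => *; lra.
  have {HK1}HK1 := HK1 p h; have {HK2}HK2 := HK2 p h.
  have q0 : 0 <= qf z z p by exact: qv_ge0.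
  have s0 := sig_ge0 p.
  rewrite (qG p Op) (Sz p Op) /G /Err /e ib1 mul1r mulr1 -/(D p).
  rewrite ger0_norm in HK1; last by apply: mulr_ge0 => //; exact: mulr_ge0.
  rewrite ger0_norm in HK2; last exact: mulr_ge0.
  have := D0 j p; rewrite -/(D p) => Dp.
  have E1 : m p * z p = 1 - d j / D p by rewrite /m /D; field; exact: Dn0.
  have E2 : (d j - z p ^+ 2) / D p ^+ 2 + m p ^+ 2 = d j / D p ^+ 2.
    by rewrite /m; field; exact: Dn0.
  have B1 : w p ^+ 2 * (d j / D p) <= C * d j + eta.
    rewrite mulrA ler_pdivrMr// /D.
    move: (wz p) (d0 j) (sqr_ge0 (z p)) (sqr_ge0 (w p)).
    by move: (z p ^+ 2) (w p ^+ 2) (d j) => zz ww t; nra.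
  have B2 : w p ^+ 2 * (d j / D p ^+ 2) <= C * (z p ^+ 2 * d j / D p ^+ 2) + eta / d j.
    have D2 : 0 < D p ^+ 2 by rewrite exprn_gt0.
    have -> : C * (z p ^+ 2 * d j / D p ^+ 2) = C * z p ^+ 2 * (d j / D p ^+ 2) by ring.
    apply: (@le_trans _ _ ((C * z p ^+ 2 + eta) * (d j / D p ^+ 2))).
      by rewrite ler_wpM2r// divr_ge0 ?ltW.
    rewrite mulrDl lerD2l ler_wpM2l ?(ltW eta0)//.
    rewrite ler_pdivrMr// -ler_pdivrMl ?invr_gt0// invrK -expr2.
    rewrite /D; have := d0 j; have := sqr_ge0 (z p); nra.
  have w20 : 0 <= w p ^+ 2 := sqr_ge0 _.
  have P1 := mulr_ge0 ph0 ps.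
  have P2 : phi (rho p) * qf z z p * (w p ^+ 2 * (d j / D p ^+ 2)) <=
      K2 * (C * (z p ^+ 2 * d j / D p ^+ 2) + eta / d j).
    apply: ler_pM => //; first exact: mulr_ge0.
    by apply: mulr_ge0 => //; rewrite divr_ge0// ?sqr_ge0// ltW.
  have P3 : phi (rho p) * (l * sig p) * (w p ^+ 2 * (d j / D p)) <= K1 * (C * d j + eta).
    apply: ler_pM => //; first by apply: mulr_ge0 => //; exact: mulr_ge0.
    by apply: mulr_ge0 => //; rewrite divr_ge0// ltW.
  have P4 : 0 <= phi (rho p) * sig p * w p ^+ 2 * (l - k).
    by apply: mulr_ge0; [do 2 apply: mulr_ge0 => //|rewrite subr_ge0].
  have -> : phi (rho p) * (m p * (w p * w p)) * (- l * (sig p * z p)) =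
      - (phi (rho p) * (l * sig p) * w p ^+ 2 * (m p * z p)) by ring.
  have -> : (d j - z p ^+ 2) / D p ^+ 2 = d j / D p ^+ 2 - m p ^+ 2 by rewrite -E2 addrK.
  rewrite E1; move: P1 P2 P3 P4.
  move: (d j / D p ^+ 2) (d j / D p) (z p ^+ 2 * d j / D p ^+ 2) (eta / d j) => x2 x3 x4 x5.
  move: (phi (rho p)) (qf w w p) (qf w z p) (qf z z p) (sig p) (m p) (w p) (C * d j + eta).
  by move=> *; lra.
have L : I (fun p => qf G z p + G p * Sop z p - Err p) <= Pform k w.
  apply: I_le => //; first by apply: bbB => //; exact: bbD.
  exact: bb_Pform.
move: L; rewrite IB ?T0; [|exact: bbD|by []].
rewrite ID ?IZ//; [|exact: bib|exact: bbZ].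
rewrite sub0r; apply: le_trans; rewrite lerN2.
move: Hj etaS; rewrite -/mB /S.
have -> : K1 * (C * d j + eta) + K2 * (eta / d j) = K1 * C * d j + eta * (K1 + K2 / d j).
  by ring.
have b0 : 0 <= (K1 + K2 / d j) * mB by apply: mulr_ge0 => //; rewrite addr_ge0// divr_ge0.
move: b0 eta0; move: (K1 + K2 / d j) (I (e j)) => x y b0 eta0 h1 h2.
by nra.
Unshelve. all: by end_near. Qed.

End ground_state.

(** * Invariance under reflections *)

Section sigma_finite_product.
Context {R : realType} {n : nat}.
Local Notation T := (measurableTypeR R).
Local Notation X := ('rV[R]_n * R)%type.
Local Notation XT := ('rV[T]_n * T)%type.
Local Notation mu := (@grushin_measure R n).

(** The same measure under a name that can carry sigma-finiteness, which Tonelli's theorem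
    requires. *)
Definition sf_grushin : set XT -> \bar R := mu.

HB.instance Definition _ := Measure.copy sf_grushin mu.

Lemma sf_grushin_sigma_finite : sigma_finite setT sf_grushin.
Proof.
exists (fun j => box j%:R) => [|j]; last by split; [exact: measurable_box|exact: mu_box_lty].
apply/esym; rewrite -subTset => p _.
by exists (Num.bound `|p : X|) => //=; rewrite /box/=; apply: ltW; exact: archi_boundP.
Qed.

HB.instance Definition _ := Measure_isSigmaFinite.Build _ _ _ sf_grushin
  sf_grushin_sigma_finite.

Lemma grushin_tonelli (F : XT * XT -> \bar R) : measurable_fun [set: XT * XT] F ->
  (forall z, 0 <= F z)%E ->
  (\int[mu]_x \int[mu]_y F (x, y) = \int[mu]_y \int[mu]_x F (x, y))%E.
Proof.
move=> mF F0.
exact: (@fubini_tonelli _ _ _ _ _ sf_grushin sf_grushin F mF F0).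
Qed.

End sigma_finite_product.

Section isometry_invariance.
Context {R : realType} {n : nat}.
Local Notation T := (measurableTypeR R).
Local Notation X := ('rV[R]_n * R)%type.
Local Notation XT := ('rV[T]_n * T)%type.
Local Notation mu := (@grushin_measure R n).
Implicit Types (p : X).

Lemma mu_box_gt0 (c : R) : 0 < c -> (0 < mu (box c))%E.
Proof.
move=> c0.
pose B1 : set 'rV[T]_n := [set x | forall i, `[- c, c]%classic (x ord0 i)].
have mB1 : measurable B1 by apply: (@measurable_rV_box _ n (fun=> `[- c, c]%classic)).
have lc : lebesgue_measure (`[- c, c]%classic : set T) = (c + c)%:E.
  by rewrite lebesgue_measure_itv/= lte_fin gtrN// -EFinB opprK.
have E1 : lebesgue_rV n B1 = ((c + c) ^+ n)%:E.
  have -> := @lebesgue_rV_box R n (fun=> `[- c, c]%classic) (fun=> measurable_itv _).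
  under eq_bigr do rewrite lc.
  rewrite prodEFin; congr EFin; by rewrite prodr_const card_ord.
apply: (@lt_le_trans _ _ (mu (B1 `*` `[- c, c]%classic))).
  rewrite /grushin_measure /= product_measure1E//; apply: mule_gt0.
    by apply: (@lt_le_trans _ _ ((c + c) ^+ n)%:E);
      rewrite ?lte_fin ?exprn_gt0 ?addr_gt0// -E1.
  apply: (@lt_le_trans _ _ (c + c)%:E); last by rewrite -lc.
  by rewrite lte_fin addr_gt0.
apply: le_measure; rewrite ?inE; [exact: measurableX|exact: measurable_box|].
move=> -[x t] /= [hx ht]; apply: prod_norm_le => /=.
  by apply: rV_norm_le => [|i]; [exact: ltW|have := hx i; rewrite /= in_itv/= -ler_norml].
by move: ht; rewrite in_itv/= -ler_norml.
Qed.

Lemma rhoN p : rho (- p) = rho p.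
Proof.
rewrite !rho_sqrt /r4 /s2 /= sqrrN.
congr (Num.sqrt (Num.sqrt (_ ^+ 2 + _))).
by apply: eq_bigr => i _; rewrite mxE sqrrN.
Qed.

Let K : set X := [set p | rho p <= 1].

Let mK : measurable (K : set XT).
Proof.
rewrite (_ : K = (@rho R n) @^-1` `]-oo, 1]%classic); last first.
  by apply/seteqP; split => p /=; rewrite in_itv.
rewrite -[X in measurable X]setTI.
exact: (measurable_continuous (@rho_continuous R n)).
Qed.

Let mu_K : exists2 k : R, 0 < k & mu K = k%:E.
Proof.
have fin : (mu K < +oo)%E.
  apply: le_lt_trans (mu_box_lty 2).
  apply: le_measure; rewrite ?inE//; first exact: measurable_box.
  move=> p /= Kp; rewrite /K/= in Kp; have r0 := rho_ge0 p.
  apply: prod_norm_le.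
    by apply: rV_norm_le => // i; have := rho_coord p i; lra.
  by have := rho_time p; have := normr_ge0 p.2; nra.
have pos : (0 < mu K)%E.
  (* Small enough for both [n * c <= 1] and [c <= 1 / 4], which puts the box inside [K]. *)
  pose c : R := (n%:R + 4)^-1.
  have n0 : (0 : R) <= n%:R by rewrite ler0n.
  have c0 : 0 < c by rewrite invr_gt0 ltr_wpDl.
  apply: lt_le_trans (mu_box_gt0 c0) _.
  apply: le_measure; rewrite ?inE//; first exact: measurable_box.
  move=> p /= pc; rewrite /K/= -(@ler_pXn2r _ 4)// ?nnegrE ?rho_ge0// rho_expr4 expr1n.
  have cE : c * (n%:R + 4) = 1 by rewrite mulVf// gt_eqF// ltr_wpDl.
  have h1 : s2 p <= n%:R * c ^+ 2.
    apply: (@le_trans _ _ (\sum_(i < n) c ^+ 2)).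
      apply: ler_sum => i _; rewrite -[p.1 0 i ^+ 2]real_normK ?num_real//.
      rewrite ler_pXn2r ?nnegrE// ?(ltW c0)//.
      by rewrite (le_trans (rV_coord_le_norm _ _))// (le_trans (norm_fst_le _)).
    by rewrite sumr_const card_ord mulr_natl.
  have h2 : p.2 ^+ 2 <= c ^+ 2.
    rewrite -[p.2 ^+ 2]real_normK ?num_real// ler_pXn2r ?nnegrE// ?(ltW c0)//.
    exact: le_trans (norm_snd_le _) pc.
  have h3 := s2_ge0 p.
  have c4 : c <= 1 / 4 by nra.
  have h4 : n%:R * c ^+ 2 <= 1 / 2 by rewrite expr2; nra.
  by rewrite /r4; nra.
exists (fine (mu K)); first by rewrite -lte_fin fineK// ge0_fin_numE// ltW.
by rewrite fineK// ge0_fin_numE// ltW.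
Qed.

Lemma mule_cancel (k : R) (x y : \bar R) : 0 < k -> (k%:E * x = k%:E * y)%E -> x = y.
Proof.
move=> k0 E; have kV : ((k^-1)%:E * k%:E = 1)%E by rewrite -EFinM mulVf// gt_eqF.
by rewrite -[x]mul1e -[y]mul1e -kV -!muleA E.
Qed.

(* Uniqueness of the translation invariant measure, with the constant fixed by
   the invariant set [rho <= 1]. *)
Lemma isometry_preserves_measure (phi : X -> X) :
  measurable_fun [set: XT] (phi : XT -> XT) ->
  (forall p q, phi (p + q) = phi p + phi q) -> (forall p, phi (phi p) = p) ->
  (forall p, rho (phi p) = rho p) ->
  forall A : set XT, measurable A -> mu (phi @^-1` A) = mu A.
Proof.
move=> mphi phiD phiK rphi A mA.
have [k k0 Kk] := mu_K.
have ind0 (D : set X) (p : X) : 0 <= \1_D p :> R by rewrite indicE.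
have phi0 : phi 0 = 0 by apply: (@addrI _ (phi 0)); rewrite -phiD !addr0.
have phiN p : phi (- p) = - phi p.
  by apply/eqP; rewrite -addr_eq0 -phiD addNr phi0.
have mcoord i : measurable_fun [set: XT] (fun p : XT => p.1 ord0 i).
  exact: (measurableT_comp (measurable_coord i) measurable_fst).
have mcoordD (f g : XT * XT -> XT) : measurable_fun [set: XT * XT] f ->
    measurable_fun [set: XT * XT] g ->
    measurable_fun [set: XT * XT] ((fun z => (f z : X) + (g z : X)) : XT * XT -> XT).
  move=> mf mg; apply: measurable_fun_pair.
    apply: measurable_fun_rV => i.
    rewrite (_ : (fun _ => _) = (fun z => ((f z : X).1 ord0 i + (g z : X).1 ord0 i : R))); last first.
      by apply/funext => z; rewrite mxE.
    by apply: measurable_funD; apply: (measurableT_comp (mcoord i)).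
  by apply: measurable_funD; apply: (measurableT_comp measurable_snd).
have mphiA : measurable (phi @^-1` A : set XT).
  by rewrite -[X in measurable X]setTI; exact: mphi.
have m1K : measurable_fun [set: XT] (\1_K : XT -> R) by exact: measurable_indic.
have m1A : measurable_fun [set: XT] (\1_A : XT -> R) by exact: measurable_indic.
have m1B : measurable_fun [set: XT] (\1_(phi @^-1` A) : XT -> R) by exact: measurable_indic.
have shift (g : XT -> R) (c : X) : measurable_fun [set: XT] g -> (forall p, 0 <= g p) ->
    (\int[mu]_p (g ((p : X) + c)%R)%:E = \int[mu]_p (g p)%:E)%E.
  move=> mg g0.
  apply: (@ge0_integral_preserved R n (fun p : X => p + c) (fun p => (g p)%:E)).
  - exact: measurable_grushin_translate.
  - by move=> D mD; exact: grushin_measure_translate.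
  - exact/measurable_EFinP.
  - by move=> p; rewrite lee_fin.
have msnd_phi : measurable_fun [set: XT * XT] ((fun z => phi z.2) : XT * XT -> XT).
  exact: (measurableT_comp mphi measurable_snd).
have madd : measurable_fun [set: XT * XT] ((fun z => (z.1 : X) + phi z.2) : XT * XT -> XT).
  exact: (mcoordD _ _ measurable_fst msnd_phi).
have msub : measurable_fun [set: XT * XT] ((fun z => (z.2 : X) + - phi z.1) : XT * XT -> XT).
  rewrite (_ : (fun z => _) = (fun z => (z.2 : X) + phi (- z.1))); last first.
    by apply/funext => z; rewrite phiN.
  apply: (mcoordD _ _ measurable_snd).
  apply: (measurableT_comp mphi).
  apply: measurable_fun_pair.
    apply: measurable_fun_rV => i.
    rewrite (_ : (fun _ => _) = (fun z : XT * XT => - ((z.1 : X).1 ord0 i : R))); last first.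
      by apply/funext => z; rewrite mxE.
    exact: (measurableT_comp (@oppr_measurable R setT) (measurableT_comp (mcoord i) measurable_fst)).
  exact: (measurableT_comp (@oppr_measurable R setT) (measurableT_comp measurable_snd measurable_fst)).
pose F (z : XT * XT) : \bar R := (\1_K z.1 * \1_A ((z.1 : X) + phi z.2))%:E.
have mF : measurable_fun [set: XT * XT] F.
  apply/measurable_EFinP; apply: measurable_funM.
    exact: (measurableT_comp m1K measurable_fst).
  exact: (measurableT_comp m1A madd).
have F0 z : (0 <= F z)%E by rewrite lee_fin mulr_ge0.
pose F' (z : XT * XT) : \bar R := (\1_A z.1 * \1_K ((z.2 : X) + - phi z.1))%:E.
have mF' : measurable_fun [set: XT * XT] F'.
  apply/measurable_EFinP; apply: measurable_funM.
    exact: (measurableT_comp m1A measurable_fst).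
  exact: (measurableT_comp m1K msub).
have F'0 z : (0 <= F' z)%E by rewrite lee_fin mulr_ge0.
have FT : (\int[mu]_x \int[mu]_y F (x, y) = \int[mu]_y \int[mu]_x F (x, y))%E.
  exact: grushin_tonelli.
have FT' : (\int[mu]_x \int[mu]_y F' (x, y) = \int[mu]_y \int[mu]_x F' (x, y))%E.
  exact: grushin_tonelli.
have prod_int (C D : set XT) : measurable C -> measurable D ->
    (\int[mu]_x \int[mu]_y ((\1_C x * \1_D y)%R)%:E = mu C * mu D)%E.
  move=> mC mD.
  have m1C : measurable_fun [set: XT] (\1_C : XT -> R) by exact: measurable_indic.
  have m1D : measurable_fun [set: XT] (\1_D : XT -> R) by exact: measurable_indic.
  have iE (E : set XT) : measurable E -> (\int[mu]_y (\1_E y)%:E = mu E)%E.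
    by move=> mE; have := @integral_indic _ _ _ mu setT measurableT _ mE; rewrite setIT.
  transitivity (\int[mu]_x ((\1_C x)%:E * mu D))%E.
    apply: eq_integral => x _; rewrite -(iE D mD).
    have := @ge0_integralZl_EFin _ _ _ mu setT measurableT (fun y => (\1_D y)%:E)
      (fun y _ => ltac:(by rewrite lee_fin)) ((measurable_EFinP _ _).2 m1D) (\1_C x)
      (ltac:(by rewrite indicE)).
    move=> <-; apply: eq_integral => y _; by rewrite EFinM.
  have := @ge0_integralZr _ _ _ mu setT measurableT (fun y => (\1_C y)%:E)
      ((measurable_EFinP _ _).2 m1C) (mu D)
      (fun y _ => ltac:(by rewrite lee_fin)) (measure_ge0 _ _).
  by move=> ->; rewrite iE.
have L : (\int[mu]_x \int[mu]_y F (x, y) = mu K * mu (phi @^-1` A))%E.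
  refine (etrans _ (prod_int K _ mK mphiA)); apply: eq_integral => x _.
  have := shift (fun y => \1_K x * \1_(phi @^-1` A) y) (phi x)
    (measurable_funM (measurable_cst _) m1B) (fun y => mulr_ge0 (ind0 _ _) (ind0 _ _)).
  move=> <-; apply: eq_integral => y _; rewrite /F; congr EFin; congr (_ * _).
  by rewrite !indicE; congr ((_ : bool)%:R); apply/idP/idP; rewrite !inE/= phiD phiK addrC.
have M : (\int[mu]_y \int[mu]_x F (x, y) = \int[mu]_y \int[mu]_x F' (x, y))%E.
  apply: eq_integral => y _.
  have my : measurable_fun [set: XT] (fun x : XT => \1_K ((y : X) + - phi x) : R).
    exact: (measurableT_comp m1K (measurableT_comp msub (measurable_pair2 y))).
  have := shift (fun x => \1_A x * \1_K ((y : X) + - phi x)) (phi y)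
    (measurable_funM m1A my) (fun y => mulr_ge0 (ind0 _ _) (ind0 _ _)).
  move=> <-; apply: eq_integral => x _; rewrite /F mulrC; congr EFin; congr (_ * _).
  rewrite !indicE; congr ((_ : bool)%:R).
  rewrite phiD phiK opprD addrC addrNK -phiN.
  by apply/idP/idP; rewrite !inE /K/= rphi rhoN.
have N : (\int[mu]_x \int[mu]_y F' (x, y) = mu A * mu K)%E.
  refine (etrans _ (prod_int A _ mA mK)); apply: eq_integral => x _.
  exact: (shift (fun y => \1_A x * \1_K y) (- phi x)
    (measurable_funM (measurable_cst _) m1K) (fun y => mulr_ge0 (ind0 _ _) (ind0 _ _))).
have E : (mu K * mu (phi @^-1` A) = mu A * mu K)%E by rewrite -L FT M -FT' N.
rewrite [RHS]muleC Kk in E.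
exact: mule_cancel k0 E.
Qed.

End isometry_invariance.

Section reflections.
Context {R : realType} {n : nat}.
Local Notation T := (measurableTypeR R).
Local Notation X := ('rV[R]_n * R)%type.
Local Notation XT := ('rV[T]_n * T)%type.
Local Notation dir := (@coord_dir R n).
Implicit Types (p q : X) (x y e : 'rV[R]_n).

Lemma point_eq p q : p.1 = q.1 -> p.2 = q.2 -> p = q.
Proof. by case: p q => [x t] [y s] /= -> ->. Qed.

Definition dot x y : R := \sum_i x 0 i * y 0 i.

Lemma dotC x y : dot x y = dot y x.
Proof. by apply: eq_bigr => i _; rewrite mulrC. Qed.

Lemma dotDl x y e : dot (x + y) e = dot x e + dot y e.
Proof. by rewrite /dot -big_split; apply: eq_bigr => i _; rewrite mxE mulrDl. Qed.

Lemma dotZl a x e : dot (a *: x) e = a * dot x e.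
Proof. by rewrite /dot mulr_sumr; apply: eq_bigr => i _; rewrite mxE mulrA. Qed.

Lemma dotBl x y e : dot (x - y) e = dot x e - dot y e.
Proof. by rewrite -scaleN1r dotDl dotZl mulN1r. Qed.

Lemma dotZr a x e : dot e (a *: x) = a * dot e x.
Proof. by rewrite dotC dotZl (dotC e). Qed.

Lemma dotBr x y e : dot e (x - y) = dot e x - dot e y.
Proof. by rewrite dotC dotBl !(dotC e). Qed.

Lemma s2_dot p : s2 p = dot p.1 p.1.
Proof. by apply: eq_bigr => i _; rewrite expr2. Qed.

Lemma dot_ge0 x : 0 <= dot x x.
Proof. by apply: sumr_ge0 => i _; rewrite -expr2 sqr_ge0. Qed.

Lemma dot_eq0 x : dot x x = 0 -> x = 0.
Proof.
move=> h; have : s2 (x, 0 : R) == 0 by rewrite s2_dot h.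
by rewrite s2_eq0 => /eqP.
Qed.

(** For a unit vector [e] this is the orthogonal reflection of [x] that sends [e] to [- e], with [t]
    kept. *)
Definition refl e p : X := (p.1 - (2 * dot p.1 e) *: e, p.2).

Lemma reflD e p q : refl e (p + q) = refl e p + refl e q.
Proof.
apply: point_eq => //=.
by rewrite dotDl mulrDr scalerDl opprD addrACA.
Qed.

Lemma reflZ e a p : refl e (a *: p) = a *: refl e p.
Proof.
apply: point_eq => //=.
by rewrite dotZl scalerBr scalerA mulrCA.
Qed.

Section unit_vector.
Variable e : 'rV[R]_n.
Hypothesis e1 : dot e e = 1.

Lemma refl_dot p : dot (refl e p).1 e = - dot p.1 e.
Proof. by rewrite dotBl dotZl e1; ring. Qed.

Lemma reflK p : refl e (refl e p) = p.
Proof.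
apply: point_eq => //.
by rewrite [refl e (refl e p)]/refl refl_dot /= mulrN scaleNr opprK subrK.
Qed.

Lemma refl_s2 p : s2 (refl e p) = s2 p.
Proof.
rewrite !s2_dot /= dotBl !dotBr !dotZl !dotZr e1 (dotC e); ring.
Qed.

Lemma refl_rho p : rho (refl e p) = rho p.
Proof. by rewrite !rho_sqrt /r4 refl_s2. Qed.

Lemma refl_sig p : sig (refl e p) = sig p.
Proof. by rewrite /sig refl_s2 refl_rho. Qed.

Lemma refl_coord_continuous i : continuous (fun p : X => (refl e p).1 0 i).
Proof.
rewrite (_ : (fun _ => _) = (fun p : X => p.1 0 i - 2 * (\sum_j p.1 0 j * e 0 j) * e 0 i)); last first.
  by apply/funext => p; rewrite /refl !mxE.
have h : Ck [set: X] 0 (fun p : X => p.1 0 i - 2 * (\sum_j p.1 0 j * e 0 j) * e 0 i).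
  apply: (CkB openT); first exact: (Ck_pcoord openT (Some i)).
  apply: (CkM openT); last exact: (Ck_cst openT).
  apply: (CkZ openT); apply: (Ck_sum openT) => j.
  by apply: (CkM openT); [exact: (Ck_pcoord openT (Some j))|exact: (Ck_cst openT)].
by move=> p; exact: h.1.
Qed.

Lemma measurable_refl : measurable_fun [set: XT] (refl e : XT -> XT).
Proof.
apply: measurable_fun_pair; last exact: measurable_snd.
apply: measurable_fun_rV => i.
exact: (measurable_continuous (@refl_coord_continuous i)).
Qed.

Lemma refl_continuous : continuous (refl e).
Proof.
pose c : R := 1 + 2 * \sum_i `|e 0 i|.
have c0 : 0 < c.
  by rewrite ltr_pwDl// mulr_ge0// sumr_ge0.
have hc q : `|refl e q| <= c * `|q|.
  have q0 := normr_ge0 q.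
  have dq : `|dot q.1 e| <= \sum_i `|e 0 i| * `|q|.
    rewrite (le_trans (ler_norm_sum _ _ _))//; apply: ler_sum => i _.
    rewrite normrM mulrC ler_wpM2l// (le_trans (rV_coord_le_norm _ _))//.
    exact: norm_fst_le.
  have ei i : `|e 0 i| <= 1.
    rewrite -(@ler_pXn2r _ 2)// ?nnegrE// real_normK ?num_real// expr1n -e1.
    rewrite /dot (bigD1 i)//= -expr2 lerDl; apply: sumr_ge0 => j _.
    by rewrite -expr2 sqr_ge0.
  apply: prod_norm_le; last first.
    rewrite /= (le_trans (norm_snd_le _))// ler_peMl// /c lerDl mulr_ge0//.
    exact: sumr_ge0.
  apply: rV_norm_le => [|i]; first by rewrite mulr_ge0// ltW.
  rewrite !mxE (le_trans (ler_normB _ _))//.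
  have -> : c * `|q| = `|q| + 2 * ((\sum_i `|e 0 i|) * `|q|) by rewrite /c; ring.
  apply: lerD.
    by rewrite (le_trans (rV_coord_le_norm _ _))// norm_fst_le.
  rewrite !normrM ger0_norm// -mulrA ler_wpM2l//.
  by rewrite mulr_suml -[leRHS]mulr1 ler_pM.
move=> p; apply/cvgrPdist_le => d d0.
near=> q.
have -> : refl e p - refl e q = refl e (p - q).
  by rewrite -[q in RHS]scale1r -scaleNr reflD reflZ scaleNr scale1r.
rewrite (le_trans (hc _))// -ler_pdivlMl// ltW//.
near: q; apply: cvgr_dist_lt => //; rewrite mulr_gt0// invr_gt0//.
Unshelve. all: by end_near. Qed.

Lemma I_refl (g : X -> R) : bb g -> I (fun p => g (refl e p)) = I g.
Proof.
move=> bg; apply: (I_preserved measurable_refl) => // A mA.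
by apply: isometry_preserves_measure => //;
  [exact: measurable_refl|exact: reflD|exact: reflK|exact: refl_rho].
Qed.

End unit_vector.

Context (rad : \bar R) (r1 r2 : R).
Hypothesis r1_gt0 : 0 < r1.
Hypothesis r2_rad : (r2%:E < rad)%E.
Local Notation Om := (@Om R n rad).
Local Notation oO := (@open_Om R n rad).
Local Notation AS := (@AS R n r1 r2).
Variable e : 'rV[R]_n.
Hypothesis e1 : dot e e = 1.
Implicit Types (g h : X -> R).

Lemma refl_Om p : Om p -> Om (refl e p).
Proof.
move=> /OmP[p0 pr]; apply/OmP; rewrite refl_rho//; split => //.
have h0 : refl e 0 = 0 by rewrite -[X in refl e X](scale0r (0 : X)) reflZ scale0r.
by apply: contra p0 => /eqP h; rewrite -(reflK e1 p) h h0.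
Qed.

Lemma AS_refl g : AS g -> AS (fun p => g (refl e p)).
Proof. by move=> ag p h; apply: ag; rewrite refl_rho. Qed.

Lemma Ck0_refl g : Ck Om 0 g -> Ck Om 0 (fun p => g (refl e p)).
Proof.
move=> Cg; split => // p Op.
apply: (@continuous_comp _ _ _ (refl e) g); first exact: refl_continuous.
exact: (Ck_cont Cg (refl_Om Op)).
Qed.

(** The gradient of [g] after reflection: the reflection is a symmetric map, so the chain rule
    applies it to the [x] part of the gradient. *)
Definition gr_at g p k : R :=
  if k is Some i then partial (Some i) g (refl e p)
    - 2 * e 0 i * \sum_j e 0 j * partial (Some j) g (refl e p)
  else partial None g (refl e p).

Lemma isD_refl g p k : Ck Om 1 g -> Om p ->
  is_derive p (dir k) (fun p => g (refl e p)) (gr_at g p k).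
Proof.
move=> Cg Op.
have E : p = 0 *: dir k + p by rewrite scale0r add0r.
rewrite [p in is_derive p]E; apply/isD_line.
rewrite (_ : (fun t : R => _) = (fun t => g (t *: refl e (dir k) + refl e p))); last first.
  by apply/funext => t; rewrite reflD reflZ.
have H := Ck_isD_dir oO (refl e (dir k)) Cg (refl_Om Op).
have E' : refl e p = 0 *: refl e (dir k) + refl e p by rewrite scale0r add0r.
rewrite E' in H.
have := (@isD_line _ _ (refl e p) (refl e (dir k)) g 0 _).1 H.
rewrite -E' => /isD_eq; apply.
rewrite /gr_at; case: k {E E' H} => [i|]; rewrite /refl /coord_dir /=.
  have di : dot (delta_mx 0 i) e = e 0 i.
    rewrite /dot (bigD1 i)//= mxE !eqxx mul1r big1 ?addr0// => j ji.
    by rewrite mxE eqxx (negbTE ji) mul0r.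
  rewrite di mul0r addr0.
  under eq_bigr do rewrite !mxE eqxx/= mulrBl.
  rewrite sumrB (bigD1 i)//= eqxx mul1r big1 ?addr0 => [|j ji]; last first.
    by rewrite (negbTE ji) mul0r.
  by congr (_ - _); rewrite [RHS]mulr_sumr; apply: eq_bigr => j _; ring.
rewrite mul1r big1 ?add0r// => i _; rewrite !mxE.
have -> : dot 0 e = 0 by rewrite /dot big1// => j _; rewrite mxE mul0r.
by rewrite !(mulr0, mul0r, oppr0, addr0, subrr).
Qed.

Lemma Ck1_refl g : Ck Om 1 g -> Ck Om 1 (fun p => g (refl e p)).
Proof.
move=> Cg; apply: (Ck_succ oO (dg := fun d p => gr_at g p d)).
- by have [h _] := Ck0_refl (CkS Cg).
- by move=> d p Op; exact: isD_refl.
- have Cd i : Ck Om 0 (fun p => partial i g (refl e p)).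
    by apply: Ck0_refl; exact: Ck_partial.
  case=> [i|]; rewrite /gr_at; last exact: Cd.
  apply: (CkB oO); first exact: Cd.
  apply: (CkM oO); first exact: (Ck_cst oO).
  by apply: (Ck_sum oO) => j; apply: (CkZ oO); exact: Cd.
Qed.

(** [Gv] and [Ev] see [x] and the [x] part of the gradient only through Euclidean inner products,
    which the reflection preserves. *)
Lemma qf_refl g p : Ck Om 1 g -> Om p ->
  qf (fun p => g (refl e p)) (fun p => g (refl e p)) p = qf g g (refl e p).
Proof.
move=> Cg Op.
have -> : qf (fun p => g (refl e p)) (fun p => g (refl e p)) p = qv p (gr_at g p) (gr_at g p).
  rewrite /qf; have -> // : gr (fun p => g (refl e p)) p = gr_at g p.
  by apply/funext => k; apply: grE; exact: isD_refl.
rewrite /qf /qv refl_sig//; pose a k := partial k g (refl e p).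
pose S := \sum_j e 0 j * a (Some j).
have EV : Ev p (gr_at g p) = Ev (refl e p) (gr g (refl e p)).
  rewrite /Ev /=; congr (_ + _).
  under [RHS]eq_bigr do rewrite !mxE mulrBl.
  under eq_bigr do rewrite mulrBr.
  rewrite !sumrB; congr (_ - _).
  rewrite -/S; transitivity (2 * S * dot p.1 e).
    by rewrite /dot mulr_sumr; apply: eq_bigr => i _; ring.
  by rewrite /S mulrAC mulr_sumr; apply: eq_bigr => i _; rewrite /a /gr; ring.
rewrite EV; congr (_ - _); rewrite /Gv refl_s2//=; congr (_ + _).
transitivity (\sum_i (a (Some i) * a (Some i) - 4 * S * (e 0 i * a (Some i))
    + 4 * S ^+ 2 * (e 0 i * e 0 i))).
  by apply: eq_bigr => i _; rewrite -/S -/(a (Some i)); ring.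
rewrite big_split sumrB/= -!mulr_sumr -/S -/(dot e e) e1.
by rewrite /gr -/(a _); ring.
Qed.

End reflections.

(** * Symmetrization *)

Section symmetrization.
Context {R : realType} {n : nat} (rad : \bar R) (r1 r2 : R).
Hypothesis r1_gt0 : 0 < r1.
Hypothesis r2_rad : (r2%:E < rad)%E.
Local Notation X := ('rV[R]_n * R)%type.
Local Notation dir := (@coord_dir R n).
Local Notation Om := (@Om R n rad).
Local Notation oO := (@open_Om R n rad).
Local Notation AS := (@AS R n r1 r2).
Local Notation bbA := (bb_AS r1_gt0 r2_rad).
Implicit Types (g h u v : X -> R) (p q : X) (e : 'rV[R]_n).

Variable phi : R -> R.
Hypothesis phi_C1 : C1_on (radii rad) phi.
Hypothesis phi_ge0 : forall r, radii rad r -> 0 <= phi r.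
Local Notation Pform := (@Pform R n phi).

Definition even_part e g p := (g p + g (refl e p)) / 2.
Definition odd_part e g p := (g p - g (refl e p)) / 2.

Lemma Ck1_even e g : dot e e = 1 -> Ck Om 1 g -> Ck Om 1 (even_part e g).
Proof.
move=> e1 Cg; apply: (CkM oO); last exact: (Ck_cst oO).
exact: (CkD oO Cg (Ck1_refl e1 Cg)).
Qed.

Lemma Ck1_odd e g : dot e e = 1 -> Ck Om 1 g -> Ck Om 1 (odd_part e g).
Proof.
move=> e1 Cg; apply: (CkM oO); last exact: (Ck_cst oO).
exact: (CkB oO Cg (Ck1_refl e1 Cg)).
Qed.

Lemma AS_even e g : dot e e = 1 -> AS g -> AS (even_part e g).
Proof.
by move=> e1 ag p h; rewrite /even_part (ag p h) (AS_refl e1 ag h) addr0 mul0r.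
Qed.

Lemma AS_odd e g : dot e e = 1 -> AS g -> AS (odd_part e g).
Proof.
by move=> e1 ag p h; rewrite /odd_part (ag p h) (AS_refl e1 ag h) subr0 mul0r.
Qed.

Lemma qf_even_odd e g p : dot e e = 1 -> Ck Om 1 g -> Om p ->
  qf (even_part e g) (even_part e g) p + qf (odd_part e g) (odd_part e g) p =
  (qf g g p + qf g g (refl e p)) / 2.
Proof.
move=> e1 Cg Op; rewrite -(qf_refl e1 Cg Op).
set g' := fun p => g (refl e p).
have Cg' : Ck Om 1 g' by exact: Ck1_refl.
have hg := Ck_isD _ Cg Op; have hg' := Ck_isD _ Cg' Op.
have Ee : gr (even_part e g) p = (fun k => 2^-1 * gr g p k + 2^-1 * gr g' p k).
  apply/funext => k; apply: grE.
  apply: isD_eq (isD_mul (isD_add (hg k) (hg' k)) (isD_cst p (dir k) 2^-1)) _.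
  by rewrite /gr; ring.
have Eo : gr (odd_part e g) p = (fun k => 2^-1 * gr g p k + (- 2^-1) * gr g' p k).
  apply/funext => k; apply: grE.
  apply: isD_eq (isD_mul (isD_add (hg k) (isD_opp (hg' k))) (isD_cst p (dir k) 2^-1)) _.
  by rewrite /gr; ring.
rewrite /qf Ee Eo !qv_linl !qv_linr !qv_scalel !qv_scaler.
rewrite (qv_sym p (gr g' p) (gr g p)).
by move: (qv _ _ _) (qv _ _ _) (qv _ _ _) => a b c; field.
Qed.

(** At a point and its mirror image the cross terms of the even and odd parts are opposite, and the
    measure is invariant, so the two parts are orthogonal for the form. *)
Lemma Pform_split k e g : dot e e = 1 -> Ck Om 1 g -> AS g ->
  Pform k g = Pform k (even_part e g) + Pform k (odd_part e g).
Proof.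
move=> e1 Cg ag.
have b := bb_Pform r1_gt0 r2_rad phi_C1 k Cg ag.
have be := bb_Pform r1_gt0 r2_rad phi_C1 k (Ck1_even e1 Cg) (AS_even e1 ag).
have bo := bb_Pform r1_gt0 r2_rad phi_C1 k (Ck1_odd e1 Cg) (AS_odd e1 ag).
pose F p := phi (rho p) * (qf g g p - k * sig p * g p ^+ 2).
have bF : bb (fun p => F (refl e p)).
  apply: bbA.
    apply: (Ck0_refl e1); apply: (CkM oO); first exact: (Ck0_phi phi_C1).
    apply: (CkB oO); first exact: Ckq.
    apply: (CkM oO); last by apply: (CkX oO); exact: CkS.
    by apply: (CkZ oO); exact: sm_sig.
  apply: (AS_refl e1); apply: ASMr; apply: ASB; first exact: AS_ql.
  by apply: ASMr => p /ag ->; rewrite expr0n.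
have Er : I (fun p => F (refl e p)) = I F := I_refl e1 b.
rewrite -[LHS]/(I F) /Pform -ID//.
have -> : I F = I (fun p => 2^-1 * (F p + F (refl e p))).
  by rewrite IZ; [rewrite ID// Er; field|exact: bbD].
apply: eq_I => p; have [h|h] := boolP (r1 <= rho p <= r2); last first.
  have z (g' : X -> R) : AS g' -> phi (rho p) * (qf g' g' p - k * sig p * g' p ^+ 2) = 0.
    by move=> ag'; rewrite (AS_ql g' ag' h) (ag' p h) expr0n/= mulr0 subr0 mulr0.
  rewrite (z _ (AS_even e1 ag)) (z _ (AS_odd e1 ag)) /F (z _ ag).
  rewrite refl_rho// refl_sig//.
  have h' : ~~ (r1 <= rho (refl e p) <= r2) by rewrite refl_rho.
  by rewrite (AS_ql g ag h') (ag _ h') expr0n/= mulr0 subr0 !mulr0 addr0 mulr0.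
have Op := annulus_Om r1_gt0 r2_rad h.
have := qf_even_odd e1 Cg Op; rewrite /F refl_rho// refl_sig// /even_part /odd_part.
move: (qf _ _ p) (qf _ _ p) (qf g g p) (qf g g (refl e p)) => a b' c d E.
have -> : c = 2 * (b' + a) - d by rewrite E; field.
by field.
Qed.

(** With the Euclidean norm in [x] the reflections are isometries, so that averaging keeps the
    constant [L]. *)
Definition Lip (L : R) g := forall p q,
  `|g p - g q| <= L * (enorm (p.1 - q.1) + `|p.2 - q.2|).

Lemma enorm_dot (x : 'rV[R]_n) : enorm x = Num.sqrt (dot x x).
Proof. by rewrite /enorm; congr Num.sqrt; apply: eq_bigr => i _; rewrite expr2. Qed.

Lemma enorm_ge0 (x : 'rV[R]_n) : 0 <= enorm x.
Proof. exact: sqrtr_ge0. Qed.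

Lemma enormZ (a : R) (x : 'rV[R]_n) : enorm (a *: x) = `|a| * enorm x.
Proof.
by rewrite !enorm_dot dotZl dotZr mulrA -expr2 sqrtrM ?sqr_ge0// sqrtr_sqr.
Qed.

Lemma enorm_coord (x : 'rV[R]_n) i : `|x 0 i| <= enorm x.
Proof.
rewrite -sqrtr_sqr /enorm ler_sqrt ?sumr_ge0// => [|j _]; last exact: sqr_ge0.
by rewrite (bigD1 i)//= lerDl; apply: sumr_ge0 => j _; exact: sqr_ge0.
Qed.

Lemma enorm_refl e p : dot e e = 1 -> enorm (refl e p).1 = enorm p.1.
Proof. by move=> e1; rewrite !enorm_dot -!s2_dot refl_s2. Qed.

Lemma Lip_refl L e g : dot e e = 1 -> Lip L g -> Lip L (fun p => g (refl e p)).
Proof.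
move=> e1 Lg p q; rewrite (le_trans (Lg _ _))//.
have -> : (refl e p).1 - (refl e q).1 = (refl e (p - q)).1.
  by apply/rowP => i; rewrite /= dotBl !mxE; ring.
by rewrite enorm_refl.
Qed.

Lemma Lip_even L e g : dot e e = 1 -> Lip L g -> Lip L (even_part e g).
Proof.
move=> e1 Lg p q; have := Lg p q; have := Lip_refl e1 Lg p q; rewrite /even_part.
move: (L * _) => K; rewrite !ler_norml => /andP[? ?] /andP[? ?].
by apply/andP; split; lra.
Qed.

Lemma Lip_odd L e g : dot e e = 1 -> Lip L g -> Lip L (odd_part e g).
Proof.
move=> e1 Lg p q; have := Lg p q; have := Lip_refl e1 Lg p q; rewrite /odd_part.
move: (L * _) => K; rewrite !ler_norml => /andP[? ?] /andP[? ?].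
by apply/andP; split; lra.
Qed.

(** A point and its mirror image are at distance [2 |x.e|]. This is the domination by the
    eigenfunction [x.e] that [ground_state] asks for. *)
Lemma odd_part_bound L e g p : dot e e = 1 -> Lip L g ->
  `|odd_part e g p| <= L * `|dot p.1 e|.
Proof.
move=> e1 Lg; rewrite /odd_part normrM [`|2^-1|]ger0_norm//.
rewrite ler_pdivrMr// (le_trans (Lg _ _))//=.
rewrite subrr normr0 addr0 opprB addrC subrK enormZ enorm_dot e1 sqrtr1 mulr1.
by rewrite normrM ger0_norm// mulrCA mulrC.
Qed.

Lemma exists_Lip g : Ck Om 1 g -> AS g -> exists2 L, 0 <= L & Lip L g.
Proof.
move=> Cg ag.
have /(@choice _ _ _)[C HC] : forall k, exists C : R, 0 <= C /\ forall p, `|partial k g p| <= C.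
  move=> k; have [C C0 h] := AS_bounded r1_gt0 r2_rad (Ck_partial k Cg) (AS_partial k ag).
  by exists C.
have C0 k : 0 <= C k := (HC k).1.
pose L : R := \sum_i C (Some i) + C None.
exists L; first by rewrite addr_ge0// sumr_ge0.
have isv (v : X) p : is_derive p v g (\sum_(i < n) v.1 0 i * partial (Some i) g p + v.2 * partial None g p).
  have [h|h] := boolP (r1 <= rho p <= r2).
    exact: (Ck_isD_dir oO v Cg (annulus_Om r1_gt0 r2_rad h)).
  apply: isD_eq (AS_isD0 v ag h) _.
  by rewrite (AS_partial None ag h) mulr0 addr0 big1// => i _; rewrite (AS_partial _ ag h) mulr0.
move=> p q; pose v : X := p - q.
have [s _ E] := @line_MVT _ _ q v g 1 (fun s _ => @ex_derive _ _ _ _ _ _ _ (isv v (s *: v + q))).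
move: E; rewrite scale1r /v subrK => ->; rewrite mul1r.
have [_ ->] := isv (p - q) (s *: (p - q) + q).
rewrite (le_trans (ler_normD _ _))// mulrDr /L lerD//.
  rewrite (le_trans (ler_norm_sum _ _ _))// mulrDl mulr_suml ler_wpDr ?mulr_ge0 ?enorm_ge0//.
  apply: ler_sum => i _; rewrite normrM mulrC ler_pM//; first exact: (HC _).2.
  exact: enorm_coord.
rewrite normrM mulrC ler_pM//; rewrite (le_trans ((HC _).2 _))// lerDr sumr_ge0//.
Qed.

End symmetrization.

(** * Averaging over finitely many reflections *)

Section averaging.
Context {R : realType} {n : nat} (rad : \bar R) (r1 r2 : R).
Hypothesis r1_gt0 : 0 < r1.
Hypothesis r2_rad : (r2%:E < rad)%E.
Local Notation T := (measurableTypeR R).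
Local Notation X := ('rV[R]_n * R)%type.
Local Notation XT := ('rV[T]_n * T)%type.
Local Notation dir := (@coord_dir R n).
Local Notation Om := (@Om R n rad).
Local Notation oO := (@open_Om R n rad).
Local Notation AS := (@AS R n r1 r2).
Local Notation bbA := (bb_AS r1_gt0 r2_rad).
Implicit Types (g h u v : X -> R) (p q : X) (e : 'rV[R]_n).

(** The second derivatives of a linear function vanish, so only the radial part of the operator is
    left; the degree [a] is 1 for [x.e] and 2 for [t]. *)
Lemma Sop_linear (z : X -> R) (a : R) p :
  (forall b p q, z (b *: p + q) = b * z p + z q) ->
  (forall p, Ev p (fun k => z (dir k)) = a * z p) ->
  Sop z p = - (a ^+ 2 + n%:R * a) * (sig p * z p).
Proof.
move=> lz Ez.
have pz k : partial k z = fun=> z (dir k).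
  by apply/funext => q; apply: (@derive_val _ _ _ _ _ _ _ (isD_linear q (dir k) lz)).
have ppz k : partial k (partial k z) p = 0.
  by rewrite pz; apply: (@derive_val _ _ _ _ _ _ _ (isD_cst p (dir k) (z (dir k)))).
have EEz : EE z = fun p => a * z p.
  by apply/funext => q; rewrite -Ez; congr Ev; apply/funext => k; rewrite /gr pz.
have lz' b q q' : a * z (b *: q + q') = b * (a * z q) + a * z q' by rewrite lz; ring.
have EEEz : EE (EE z) p = a * (a * z p).
  rewrite EEz /EE -Ez -Ev_scale; congr Ev; apply/funext => k.
  by apply: grE; exact: (isD_linear p (dir k) lz').
rewrite /Sop /grushin_op EEEz EEz ppz mulr0 addr0 big1; last by move=> i _; exact: ppz.
ring.
Qed.

Lemma dot_pcoord e : (fun p : X => dot p.1 e) = (fun p => \sum_i pcoord (Some i) p * e 0 i).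
Proof. by []. Qed.

Lemma Ck_dot O k e : open O -> Ck O k (fun p : X => dot p.1 e).
Proof.
move=> oO'; rewrite dot_pcoord; apply: (Ck_sum oO') => i.
by apply: (CkM oO'); [exact: (Ck_pcoord oO')|exact: (Ck_cst oO')].
Qed.

Lemma dot_continuous e : continuous (fun p : X => dot p.1 e).
Proof. by move=> p; exact: (Ck_cont (Ck_dot 0 e openT) Logic.I). Qed.

Variable phi : R -> R.
Hypothesis phi_C1 : C1_on (radii rad) phi.
Hypothesis phi_ge0 : forall r, radii rad r -> 0 <= phi r.
Local Notation Pform := (@Pform R n phi).

(** [ground_state] with [z = x.e], [l = n + 1] and [C = L ^+ 2]. Here the domination holds without
    the extra [eta], so one function serves every [eps]. *)
Lemma Pform_odd_ge0 e v L k : dot e e = 1 -> Ck Om 1 v -> AS v -> 0 <= L -> Lip L v ->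
  k <= n%:R + 1 -> 0 <= Pform k (odd_part e v).
Proof.
move=> e1 Cv av L0 Lv kn; apply/ler_addgt0Pr => eps eps0; rewrite addrC -lerBlDl sub0r.
have lz b p q : dot (b *: p + q).1 e = b * dot p.1 e + dot q.1 e by rewrite dotDl dotZl.
have Ez p : Ev p (fun k => dot (dir k).1 e) = 1 * dot p.1 e.
  rewrite /Ev /= mul1r {2}/dot [X in _ * X]big1 ?mulr0 ?addr0 => [|i _]; last by rewrite mxE mul0r.
  apply: eq_bigr => i _; congr (_ * _).
  rewrite /dot (bigD1 i)//= mxE !eqxx mul1r big1 ?addr0// => j ji.
  by rewrite mxE eqxx (negbTE ji) mul0r.
have := @ground_state R n rad r1 r2 r1_gt0 r2_rad phi phi_C1 phi_ge0
  (fun p => dot p.1 e) (n%:R + 1) k (L ^+ 2) eps (@dot_continuous e)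
  (fun k => Ck_dot k e oO).
case=> //.
- by move=> p _; rewrite (Sop_linear p lz Ez); ring.
- exact: sqr_ge0.
move=> eta eta0; apply; [exact: Ck1_odd|exact: AS_odd|move=> p].
rewrite (@le_trans _ _ (L ^+ 2 * dot p.1 e ^+ 2))//; last by rewrite lerDl ltW.
rewrite -exprMn -[leLHS]real_normK ?num_real// -[leRHS]real_normK ?num_real//.
rewrite ler_pXn2r ?nnegrE//.
by rewrite [leRHS]normrM [`|L|]ger0_norm//; exact: (odd_part_bound p e1 Lv).
Qed.

(** Finite chains of even parts stand in for the mean over all rotations, so that no measure on the
    orthogonal group is involved. *)
Inductive ravg u : (X -> R) -> Prop :=
| ravg_refl : ravg u u
| ravg_step e v : dot e e = 1 -> ravg u v -> ravg u (even_part e v).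

Lemma ravg_Ck u v : ravg u v -> Ck Om 1 u -> Ck Om 1 v.
Proof. by move=> uv Cu; elim: uv => [|e w e1 _ IH]; [exact: Cu|exact: Ck1_even e1 IH]. Qed.

Lemma ravg_AS u v : ravg u v -> AS u -> AS v.
Proof. by elim=> // e w e1 _ IH /IH; exact: AS_even. Qed.

Lemma ravg_Lip L u v : ravg u v -> Lip L u -> Lip L v.
Proof. by elim=> // e w e1 _ IH /IH; exact: Lip_even. Qed.

(** Each step drops the form of an odd part, nonnegative by [Pform_odd_ge0]. The function [c] is
    even for every reflection, so it stays in the even part. *)
Lemma ravg_Pform u v c k L : ravg u v -> Ck Om 1 u -> AS u -> 0 <= L -> Lip L u ->
  Ck Om 1 c -> AS c -> (forall e p, dot e e = 1 -> c (refl e p) = c p) ->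
  k <= n%:R + 1 ->
  Pform k (fun p => v p - c p) <= Pform k (fun p => u p - c p).
Proof.
move=> uv Cu au L0 Lu Cc ac cR kn; elim: uv => // e w e1 uw IH; apply: le_trans IH.
have Cw := ravg_Ck uw Cu; have aw := ravg_AS uw au; have Lw := ravg_Lip uw Lu.
have Cwc : Ck Om 1 (fun p => w p - c p) by exact: (CkB oO).
have awc : AS (fun p => w p - c p) by exact: ASB.
rewrite (@Pform_split _ _ rad r1 r2 r1_gt0 r2_rad phi phi_C1 k e _ e1 Cwc awc).
have -> : even_part e (fun p => w p - c p) = (fun p => even_part e w p - c p).
  by apply/funext => p; rewrite /even_part cR//; field.
have -> : odd_part e (fun p => w p - c p) = odd_part e w.
  by apply/funext => p; rewrite /odd_part cR//; congr (_ / _); ring.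
by rewrite lerDl; exact: (@Pform_odd_ge0 e w L).
Qed.

Lemma bb_sqr g : Ck Om 1 g -> AS g -> bb (fun p => g p ^+ 2).
Proof.
move=> Cg ag; apply: bbA; first by apply: (CkX oO); exact: CkS.
by move=> p /ag ->; rewrite expr0n.
Qed.

Lemma I_sqr_split e g : dot e e = 1 -> Ck Om 1 g -> AS g ->
  I (fun p => g p ^+ 2) =
  I (fun p => even_part e g p ^+ 2) + I (fun p => odd_part e g p ^+ 2).
Proof.
move=> e1 Cg ag.
have b := bb_sqr Cg ag.
have br : bb (fun p => g (refl e p) ^+ 2).
  exact: (bb_sqr (Ck1_refl e1 Cg) (AS_refl e1 ag)).
rewrite -ID; [|exact: (bb_sqr (Ck1_even e1 Cg) (AS_even e1 ag))|
               exact: (bb_sqr (Ck1_odd e1 Cg) (AS_odd e1 ag))].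
have Er := I_refl e1 b.
transitivity (I (fun p => 2^-1 * (g p ^+ 2 + g (refl e p) ^+ 2))).
  by rewrite IZ; [rewrite ID// Er; field|exact: bbD].
by apply: eq_I => p; rewrite /even_part /odd_part; field.
Qed.

(** Take an average whose squared L2 norm is within [delta] of the infimum over all averages. A
    further step lowers it by the squared norm of the odd part, which therefore cannot exceed
    [delta], whatever the direction. *)
Lemma ravg_almost_even u (delta : R) : Ck Om 1 u -> AS u -> 0 < delta ->
  exists2 v, ravg u v & forall e, dot e e = 1 -> I (fun p => odd_part e v p ^+ 2) <= delta.
Proof.
move=> Cu au d0.
pose S := [set x : R | exists2 v, ravg u v & x = I (fun p => v p ^+ 2)].
have S0 : has_inf S.
  split; first by exists (I (fun p => u p ^+ 2)), u => //; exact: ravg_refl.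
  by exists 0 => x [v _ ->]; apply: I_ge0 => p; exact: sqr_ge0.
have [x [v uv ->] Hv] := inf_adherent d0 S0.
exists v => // e e1.
have Cv := ravg_Ck uv Cu; have av := ravg_AS uv au.
have : inf S <= I (fun p => even_part e v p ^+ 2).
  by apply: (ge_inf S0.2); exists (even_part e v) => //; exact: ravg_step.
have := I_sqr_split e1 Cv av; move: Hv; move: (I _) (I _) (I _) => a b c.
lra.
Qed.

Lemma enorm_le_norm (x : 'rV[R]_n) : enorm x <= n%:R * `|x|.
Proof.
rewrite -(@ger0_norm _ (n%:R * _)) ?mulr_ge0// -sqrtr_sqr /enorm ler_sqrt ?sqr_ge0//.
apply: (@le_trans _ _ (\sum_(i < n) `|x| ^+ 2)).
  apply: ler_sum => i _; rewrite -[leLHS]real_normK ?num_real//.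
  by rewrite ler_pXn2r ?nnegrE//; exact: rV_coord_le_norm.
rewrite sumr_const card_ord exprMn -[leLHS]mulr_natl; apply: ler_wpM2r; first exact: sqr_ge0.
by rewrite -natrX ler_nat; case: (n) => // m; rewrite leq_pmulr.
Qed.

Lemma I_indic_gt0 (c : R) : 0 < c -> 0 < I (fun p : X => \1_(box c) p).
Proof.
move=> c0.
have b : bb (fun p : X => \1_(box c) p).
  by have := @bb_indic R n 1 c ler01; congr bb; apply/funext => p; rewrite mul1r.
rewrite -lte_fin -integral_bb// integral_indic ?setIT//; first exact: mu_box_gt0.
exact: measurable_box.
Qed.

(** If [|g p| > eta], then [|g| >= eta / 2] on a box around [p] whose size depends on [L], [eta] and
    [n] only, so the integral is at least [eta ^+ 2 / 4 * m]. The 8 in [delta] makes the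
    contradiction strict. *)
Lemma Lip_small (L eta : R) : 0 <= L -> 0 < eta -> exists2 delta, 0 < delta &
  forall g, Lip L g -> bb (fun p => g p ^+ 2) -> I (fun p => g p ^+ 2) <= delta ->
    forall p, `|g p| <= eta.
Proof.
move=> L0 eta0.
pose K := L * (n%:R + 1) + 1.
have K0 : 0 < K by rewrite ltr_wpDl// mulr_ge0// addr_ge0.
pose c := eta / 2 / K.
have c0 : 0 < c by rewrite !divr_gt0.
pose m := I (fun p : X => \1_(box c) p).
have m0 : 0 < m by exact: I_indic_gt0.
exists (eta ^+ 2 / 8 * m) => [|g Lg bg Hg p].
  by rewrite mulr_gt0// divr_gt0// exprn_gt0.
rewrite leNgt; apply/negP => gp.
have bi : bb (fun q : X => eta ^+ 2 / 4 * \1_(box c) q).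
  by apply: bb_indic; rewrite divr_ge0// sqr_ge0.
have bt : bb (fun q => g (q + p) ^+ 2).
  have [mg [C [M h]]] := bg; split.
    rewrite (_ : (fun q => _) = (fun q => g q ^+ 2) \o (fun q : XT => (q + p : XT))) //.
    by apply: measurableT_comp => //; exact: measurable_grushin_translate.
  exists C, (M + `|p|) => q; have [h1 h2] := h (q + p); split => // Mq; apply: h2.
  have : `|q| <= `|q + p| + `|p|.
    by rewrite -{1}(addrK p q) (le_trans (ler_normB _ _)).
  by move=> h2; rewrite -(ltrD2r `|p|) (lt_le_trans Mq).
have : I (fun q : X => eta ^+ 2 / 4 * \1_(box c) q) <= I (fun q => g (q + p) ^+ 2).
  apply: I_le => // q; rewrite indicE; case: (boolP (q \in box c)); last first.
    by rewrite mulr0 sqr_ge0.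
  rewrite inE /box /= mulr1 => qc.
  have := Lg (q + p) p; rewrite -/(fst (q + p)).
  have -> : (q + p).1 - p.1 = q.1 by exact: addrK.
  have -> : (q + p).2 - p.2 = q.2 by exact: addrK.
  have h1 : enorm q.1 + `|q.2| <= (n%:R + 1) * c.
    rewrite mulrDl mul1r; apply: lerD.
      by rewrite (le_trans (enorm_le_norm _))// ler_wpM2l// (le_trans (norm_fst_le _)).
    by rewrite (le_trans (norm_snd_le _)).
  have h2 : L * (enorm q.1 + `|q.2|) <= eta / 2.
    apply: (@le_trans _ _ (L * ((n%:R + 1) * c))); first by rewrite ler_wpM2l.
    rewrite mulrA /c mulrA ler_pdivrMr// mulrC ler_wpM2l ?divr_ge0 ?ltW//.
    by rewrite /K ltrDl.
  move=> h3; have {h3} h3 := le_trans h3 h2.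
  have h4 : eta / 2 <= `|g (q + p)|.
    have : `|g p| <= `|g (q + p)| + `|g (q + p) - g p|.
      by rewrite -{1}(subKr (g (q + p)) (g p)) (le_trans (ler_normB _ _)).
    move: h3 gp; move: `|_| `|_| `|_| => x y z; lra.
  rewrite -[leRHS]real_normK ?num_real//.
  have -> : eta ^+ 2 / 4 = (eta / 2) ^+ 2 by field.
  have e2 : 0 <= eta / 2 by rewrite divr_ge0// ltW.
  by rewrite ler_pXn2r ?nnegrE.
have bi1 : bb (fun q : X => \1_(box c) q).
  by have := @bb_indic R n 1 c ler01; congr bb; apply/funext => q; rewrite mul1r.
rewrite IZ// -/m (I_translate p bg) => h.
have := le_trans h Hg; rewrite ler_pM2r//.
have : 0 < eta ^+ 2 by rewrite exprn_gt0.
move: (eta ^+ 2) => x; lra.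
Qed.

End averaging.

(** * The spectral gap up to an error *)

Section mean_poincare.
Context {R : realType} {n : nat} (rad : \bar R) (r1 r2 : R).
Hypothesis r1_gt0 : 0 < r1.
Hypothesis r2_rad : (r2%:E < rad)%E.
Local Notation X := ('rV[R]_n * R)%type.
Local Notation dir := (@coord_dir R n).
Local Notation Om := (@Om R n rad).
Local Notation oO := (@open_Om R n rad).
Local Notation AS := (@AS R n r1 r2).
Variables (i0 : 'I_n).
Implicit Types (g h u v : X -> R) (p q : X) (e : 'rV[R]_n).

Let e0 : 'rV[R]_n := delta_mx 0 i0.
Let ray (r : R) : X := (r *: e0, 0).

Let dot_e0 : dot e0 e0 = 1.
Proof.
rewrite /dot (bigD1 i0)//= mxE !eqxx mul1r big1 ?addr0// => j ji.
by rewrite mxE eqxx (negbTE ji) mul0r.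
Qed.

Let rayE r : ray r = r *: dir (Some i0) + 0.
Proof. by apply: point_eq => //=; rewrite addr0 ?scaler0. Qed.

Let rho_ray r : 0 <= r -> rho (ray r) = r.
Proof.
move=> r0; rewrite rho_sqrt /r4 s2_dot /= dotZl dotZr dot_e0 expr0n/= mulr0 addr0 mulr1.
by rewrite sqrtr_sqr ger0_norm ?mulr_ge0// -expr2 sqrtr_sqr ger0_norm.
Qed.

Let Om_ray r : radii rad r -> Om (ray r).
Proof.
move=> [r0 rr]; apply/OmP; rewrite rho_ray ?ltW//; split => //.
by apply/eqP => h; have := rho_ray (ltW r0); rewrite h rho0 => E; move: r0; rewrite -E ltxx.
Qed.

Let ray_continuous : continuous ray.
Proof.
move=> r; rewrite (_ : ray = fun r => r *: dir (Some i0)); last first.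
  by apply/funext => s; rewrite rayE addr0.
by apply: cvgZr_tmp; exact: cvg_id.
Qed.

(** The ray is parametrised by [rho] itself. Depending on [rho] alone, the trace is annihilated by
    [q] and unchanged by every reflection. *)
Definition radial_trace v p : R := v (ray (rho p)).

Lemma C1_ray v : Ck Om 1 v -> C1_on (radii rad) (fun r => v (ray r)).
Proof.
move=> Cv.
have D r : radii rad r -> is_derive r 1 (fun r => v (ray r)) (partial (Some i0) v (ray r)).
  move=> hr; have := Ck_isD (Some i0) Cv (Om_ray hr); rewrite {1}rayE => /isD_line.
  rewrite (_ : (fun t => v (t *: dir (Some i0) + 0)) = (fun r => v (ray r))) //.
  by apply/funext => t; rewrite -rayE.
have D1 r : radii rad r -> derive1 (fun r => v (ray r)) r = partial (Some i0) v (ray r).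
  by move=> hr; rewrite derive1E; apply: derive_val; exact: D.
move=> r hr; split; first exact: (@ex_derive _ _ _ _ _ _ _ (D r hr)).
have nr : \near r, radii rad r.
  have h : \forall q \near ray r, Om q := near_O oO (Om_ray hr).
  have {h} h : \forall s \near r, Om (ray s) by exact: ray_continuous r _ h.
  have h0 : \forall s \near r, 0 < s by apply: lt_nbhsr; exact: hr.1.
  near=> s; have s0 : 0 < s by near: s.
  by rewrite -(@rho_ray s) ?ltW//; apply: (@Om_radii _ n); near: s.
rewrite /prop_for /continuous_at (D1 r hr).
apply: cvg_trans; last first.
  exact: (continuous_comp (@ray_continuous r) (Ck_cont (Ck_partial (Some i0) Cv) (Om_ray hr))).
apply: near_eq_cvg; near=> s; apply/esym/D1; near: s; exact: nr.
Unshelve. all: by end_near. Qed.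

Lemma Ck_radial_trace v : Ck Om 1 v -> Ck Om 1 (radial_trace v).
Proof. by move=> Cv; apply: (Ck1_radial (f := fun r => v (ray r))); exact: C1_ray. Qed.

Lemma AS_radial_trace v : AS v -> AS (radial_trace v).
Proof. by move=> av p h; apply: av; rewrite rho_ray// rho_ge0. Qed.

Lemma radial_trace_refl v e p : dot e e = 1 ->
  radial_trace v (refl e p) = radial_trace v p.
Proof. by move=> e1; rewrite /radial_trace refl_rho. Qed.

(* The reflection along [x - |x| e0] moves [x] onto the ray of [e0]. *)
Lemma refl_to_ray p : p.1 = enorm p.1 *: e0 \/
  exists2 e, dot e e = 1 & refl e p = (enorm p.1 *: e0, p.2).
Proof.
pose d := p.1 - enorm p.1 *: e0.
have [d0|d0] := eqVneq d 0; first by left; apply/eqP; rewrite -subr_eq0 -/d d0.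
right; have dd : 0 < dot d d.
  rewrite lt_neqAle dot_ge0 andbT eq_sym; apply: contra d0 => /eqP h; exact/eqP/dot_eq0.
have [c cc] : exists c, c ^+ 2 * dot d d = 1.
  exists (Num.sqrt (dot d d))^-1; rewrite exprVn sqr_sqrtr ?ltW//.
  by rewrite mulVf// gt_eqF.
exists (c *: d); first by rewrite dotZl dotZr mulrA -expr2.
apply: point_eq => //=; rewrite dotZr scalerA.
have hd : 2 * dot p.1 d = dot d d.
  have s : enorm p.1 ^+ 2 = dot p.1 p.1 by rewrite enorm_sqr s2_dot.
  have E1 : dot p.1 d = dot p.1 p.1 - enorm p.1 * dot p.1 e0 by rewrite /d dotBr dotZr.
  have E2 : dot e0 d = dot p.1 e0 - enorm p.1 by rewrite /d dotBr dotZr dot_e0 mulr1 dotC.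
  by rewrite {2}/d dotBl dotZl E2 E1 -s; ring.
have -> : 2 * (c * dot p.1 d) * c = 1 by rewrite -[RHS]cc -hd; ring.
by rewrite scale1r /d opprB addrC subrK.
Qed.

(** The chain [(rho - |x|) rho^3 <= rho^4 - |x|^4 = 4 t^2 <= 2 |t| rho^2] gives
    [rho - |x| <= 2 |t| / rho]. *)
Lemma rho_sub_enorm p : r1 <= rho p -> rho p - enorm p.1 <= 2 / r1 * `|p.2|.
Proof.
move=> h1; have rp : 0 < rho p by exact: lt_le_trans h1.
have h4 : rho p ^+ 4 = enorm p.1 ^+ 4 + 4 * `|p.2| ^+ 2.
  by rewrite rho_expr4 /r4 -enorm_sqr real_normK ?num_real// -exprM.
have ht := rho_time p; have s0 := enorm_ge0 p.1; have t0 := normr_ge0 p.2.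
apply: (@le_trans _ _ (2 * `|p.2| / rho p)); last first.
  rewrite mulrAC ler_wpM2r// ler_wpM2l// lef_pV2 ?posrE//.
rewrite ler_pdivlMr//; move: ht h4 s0 t0 rp; clear h1.
move: (rho p) (enorm p.1) `|p.2| => r s t ht h4 s0 t0 r0.
have sr : s <= r.
  rewrite -(@ler_pXn2r _ 4) ?nnegrE//; last exact: ltW.
  by rewrite h4 lerDl mulr_ge0// exprn_ge0.
have h5 : (r - s) * r ^+ 3 <= 4 * t ^+ 2.
  have -> : 4 * t ^+ 2 = r ^+ 4 - s ^+ 4 by rewrite h4; ring.
  have : 0 <= s * (r ^+ 3 - s ^+ 3).
    by rewrite mulr_ge0// subr_ge0 ler_pXn2r ?nnegrE//; exact: ltW.
  have -> : r ^+ 4 - s ^+ 4 = (r - s) * r ^+ 3 + s * (r ^+ 3 - s ^+ 3) by ring.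
  by rewrite lerDl.
rewrite -(@ler_pM2r _ (r ^+ 2)) ?exprn_gt0//.
have -> : (r - s) * r * r ^+ 2 = (r - s) * r ^+ 3 by ring.
apply: (le_trans h5); have -> : 4 * t ^+ 2 = 2 * t * (2 * t) by ring.
by apply: ler_wpM2l => //; rewrite mulr_ge0.
Qed.

Lemma enorm_e0 (a : R) : enorm (a *: e0) = `|a|.
Proof. by rewrite enormZ enorm_dot dot_e0 sqrtr1 mulr1. Qed.

(** Two moves lead from [p] to the ray. A reflection brings [x] to a multiple of [e0], at the cost
    of [2 * eta]; the Lipschitz bound then pays for [rho - |x|] and for [t], both controlled by
    [|t|]. *)
Lemma radial_trace_close v L eta p : 0 <= L -> Lip L v ->
  (forall e, dot e e = 1 -> forall q, `|odd_part e v q| <= eta) -> 0 <= eta ->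
  r1 <= rho p ->
  `|v p - radial_trace v p| <= 2 * eta + L * (1 + 2 / r1) * `|p.2|.
Proof.
move=> L0 Lv vo eta0 h1.
pose q : X := (enorm p.1 *: e0, p.2).
have A1 : `|v p - v q| <= 2 * eta.
  have [E|[e e1 E]] := refl_to_ray p.
    have -> : q = p by apply: point_eq.
    by rewrite subrr normr0 mulr_ge0.
  have := vo e e1 p; rewrite /odd_part E -/q normrM [X in _ * X]ger0_norm//.
  by rewrite ler_pdivrMr// mulrC.
have A2 : `|v q - v (ray (rho p))| <= L * (rho p - enorm p.1 + `|p.2|).
  apply: (le_trans (Lv _ _)); rewrite /= subr0 -scalerBl enorm_e0 distrC ger0_norm//.
  rewrite subr_ge0 -(@ler_pXn2r _ 4)// ?nnegrE ?enorm_ge0 ?rho_ge0//.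
  by rewrite rho_expr4 /r4 -enorm_sqr -exprM lerDl mulr_ge0// sqr_ge0.
have A3 : L * (rho p - enorm p.1 + `|p.2|) <= L * (1 + 2 / r1) * `|p.2|.
  rewrite -mulrA ler_wpM2l// mulrDl mul1r addrC lerD2l; exact: rho_sub_enorm.
rewrite /radial_trace -(subrKA (v q)).
by rewrite (le_trans (ler_normD _ _))// lerD// (le_trans A2).
Qed.

Variable phi : R -> R.
Hypothesis phi_C1 : C1_on (radii rad) phi.
Hypothesis phi_ge0 : forall r, radii rad r -> 0 <= phi r.
Local Notation Pform := (@Pform R n phi).

Lemma mean_poincare u (eps : R) : Ck Om 1 u -> AS u -> 0 < eps ->
  exists c, [/\ Ck Om 1 c, AS c,
    forall p b, Om p -> qv p (gr c p) b = 0 &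
    - eps <= Pform (n%:R + 1) (fun p => u p - c p)].
Proof.
move=> Cu au eps0.
have [L L0 Lu] := exists_Lip r1_gt0 r2_rad Cu au.
pose K := L * (1 + 2 / r1).
have K0 : 0 <= K by rewrite mulr_ge0// addr_ge0// divr_ge0// ltW.
have lz b p q : pcoord None (b *: p + q : X) = b * pcoord None p + pcoord None q.
  exact: pcoord_lin.
have Ez p : Ev p (fun k => pcoord None (dir k)) = 2 * pcoord None p.
  by have := EE_pcoord_none p; rewrite /EE gr_pcoord.
(* The constant [2 * K ^+ 2], and below the choice [eta ^+ 2 = eta0 / 8], come from
   [(2 eta + K |t|)^2 <= 8 eta^2 + 2 K^2 t^2]. *)
have [] := @ground_state R n rad r1 r2 r1_gt0 r2_rad phi phi_C1 phi_ge0
  (pcoord None) (2 ^+ 2 + n%:R * 2) (n%:R + 1) (2 * K ^+ 2) eps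
  (@pcoord_continuous _ _ None) (@sm_pcoord _ _ rad None) _ _ _ _ eps0.
- by move=> p _; exact: Sop_linear.
- by have : 0 <= n%:R :> R by []; move: (n%:R : R) => x; lra.
- by rewrite addr_ge0.
- by rewrite mulr_ge0// sqr_ge0.
move=> eta0 eta00 HP.
pose eta := Num.sqrt (eta0 / 8).
have eta_gt0 : 0 < eta by rewrite sqrtr_gt0 divr_gt0.
have eta2 : eta ^+ 2 = eta0 / 8 by rewrite sqr_sqrtr// divr_ge0// ltW.
have [delta d0 small] := @Lip_small R n L eta L0 eta_gt0.
have [v uv vd] := ravg_almost_even r1_gt0 r2_rad Cu au d0.
have Cv := ravg_Ck uv Cu; have av := ravg_AS uv au; have Lv := ravg_Lip uv Lu.
have vo e : dot e e = 1 -> forall q, `|odd_part e v q| <= eta.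
  move=> e1; apply: small; first exact: Lip_odd.
    by apply: (bb_sqr r1_gt0 r2_rad); [exact: Ck1_odd|exact: AS_odd].
  exact: vd.
have Cc := Ck_radial_trace Cv; have ac := AS_radial_trace av.
(* The trace is that of the average [v], yet it is subtracted from [u]: since it is invariant under
   reflections, [ravg_Pform] carries the lower bound for [v - c] over to [u - c]. *)
exists (radial_trace v); split => //.
  move=> p b Op.
  exact: (qv_radial (f := fun r => v (ray r)) b Op (C1_ray Cv (Om_radii Op)).1).
apply: le_trans (ravg_Pform r1_gt0 r2_rad phi_C1 phi_ge0 uv Cu au L0 Lu Cc ac _ (lexx _)); last first.
  by move=> e p; exact: radial_trace_refl.
apply: HP; [exact: (CkB oO)|exact: ASB|move=> p].
have [h|h] := boolP (r1 <= rho p <= r2); last first.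
  rewrite (av p h) (ac p h) subrr expr0n/=; apply: addr_ge0; last exact: ltW.
  by apply: mulr_ge0; [apply: mulr_ge0 => //|]; exact: sqr_ge0.
have := radial_trace_close L0 Lv vo (ltW eta_gt0) (andP h).1; rewrite -/K /= => hz.
have -> : p.2 ^+ 2 = `|p.2| ^+ 2 by rewrite real_normK ?num_real.
rewrite -[leLHS]real_normK ?num_real//.
have eK : 0 <= 2 * eta + K * `|p.2|.
  apply: addr_ge0; last exact: mulr_ge0.
  by apply: mulr_ge0 => //; exact: ltW.
apply: (@le_trans _ _ ((2 * eta + K * `|p.2|) ^+ 2)).
  by rewrite ler_pXn2r ?nnegrE.
move: eta2; move: `|p.2| => t e2.
have := sqr_ge0 (2 * eta - K * t).
have -> : eta0 = 8 * eta ^+ 2 by rewrite e2; field.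
move: (eta) (K) => x y; nra.
Qed.

End mean_poincare.

(** * The energy inequality *)

Section radial_weight.
Context {R : realType} (rad : \bar R).
Implicit Types (f g : R -> R).

Lemma near_radii r : radii rad r -> \forall s \near r, radii rad s.
Proof.
move=> [r0 rr]; have h0 : \forall s \near r, 0 < s by exact: lt_nbhsr.
have h1 : \forall s \near r, (s%:E < rad)%E.
  case: (rad) rr => [x| |]//.
    rewrite lte_fin => rx; near=> s; rewrite lte_fin; near: s; exact: (lt_nbhsl rx).
  by move=> _; near=> s; exact: ltry.
by near=> s; split; near: s.
Unshelve. all: by end_near. Qed.

Lemma C1_on_continuous f r : C1_on (radii rad) f -> radii rad r -> {for r, continuous f}.
Proof.
move=> Cf rr; apply: differentiable_continuous; apply/derivable1_diffP.
exact: (Cf r rr).1.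
Qed.

Lemma C1_on_isD f f' : (forall r, radii rad r -> is_derive r 1 f (f' r)) ->
  (forall r, radii rad r -> {for r, continuous f'}) -> C1_on (radii rad) f.
Proof.
move=> df cf r rr; split; first exact: (@ex_derive _ _ _ _ _ _ _ (df r rr)).
have D s : radii rad s -> derive1 f s = f' s.
  by move=> rs; rewrite derive1E; apply: derive_val; exact: df.
rewrite /prop_for /continuous_at (D r rr); apply: cvg_trans (cf r rr).
by apply: near_eq_cvg; near=> s; apply/esym/D; near: s; exact: near_radii.
Unshelve. all: by end_near. Qed.

Lemma C1_on_derive f r : C1_on (radii rad) f -> radii rad r -> is_derive r 1 f (derive1 f r).
Proof. by move=> Cf rr; rewrite derive1E; apply: derivableP; exact: (Cf r rr).1. Qed.

Lemma C1_onM f g : C1_on (radii rad) f -> C1_on (radii rad) g ->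
  C1_on (radii rad) (fun r => f r * g r).
Proof.
move=> Cf Cg.
apply: (@C1_on_isD (fun r => f r * g r) (fun r => derive1 f r * g r + f r * derive1 g r)) => r rr.
  by apply: isD_mul; exact: C1_on_derive.
have [_ cf'] := Cf r rr; have [_ cg'] := Cg r rr.
have cf := C1_on_continuous Cf rr; have cg := C1_on_continuous Cg rr.
exact: continuousD (continuousM cf' cg) (continuousM cf cg').
Qed.

Lemma C1_on_inv : C1_on (radii rad) (fun r => r^-1).
Proof.
apply: (@C1_on_isD _ (fun r => - (r^-1 * r^-1))) => r [r0 _].
  have rn0 : r != 0 by rewrite gt_eqF.
  apply: isD_eq (isD_inv rn0 (is_derive_id r 1)) _.
  by field.
have ci : {for r, continuous (fun s : R => s^-1)}.
  by apply: inv_continuous; rewrite gt_eqF.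
by apply: continuousN; exact: continuousM.
Qed.

End radial_weight.

(* The pointwise identity behind [energy_inequality], with [m] the dimension, [s = sig],
   [S = Sop u], [q = qf u (EE g)]. *)
Lemma energy_identity (R : realType) (m : nat) (r v v1 v2 w s S q a b d g gg y phi' : R)
    (T0 Wr Vr Fr z1 z2 z3 z4 P H N5 : R) (phi := v * (r^-1 * r^-1))
    (mm := gg + m%:R * g - (m%:R + 1) * y) (chi := v1 * r^-1 - phi) : r != 0 ->
  phi' = r * v1 * r^-1 ^+ 2 - 2 * phi ->
  T0 = phi * (2 * mm * (S + s * (gg + m%:R * g)) - s * mm ^+ 2) ->
  Wr = w * (a + s * (g * g)) ->
  Vr = (phi - v1 * r^-1) * (a + s * (g * g)) ->
  Fr = phi * (d + s * (gg - g) ^+ 2) - w * (s * (g * g)) ->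
  z1 = phi * mm * S + phi * ((-1) * ((m%:R + 1) * a) + (1 * q + m%:R * b)) ->
  z2 = phi * (d + q - 2 * b) + ((m%:R + 2) * phi + phi') * b ->
  z3 = phi * (2 * s * g * (gg - g)) + ((m%:R + 2) * phi + phi') * (s * (g * g)) ->
  z4 = chi * (2 * b - 2 * a) + ((m%:R + 2) * chi + (v2 - v1 * r^-1 - phi')) * a ->
  P = phi * (a - (m%:R + 1) * s * y ^+ 2) ->
  H = phi * (d - 2 * b + a) - w * a ->
  N5 = ((m.+2%:R - 5) * phi + 3 * (v1 * r^-1) - v2) * a ->
  T0 = Wr + (m%:R + 1) * Vr + Fr + 2 * z1 + (-2) * z2 + (m%:R + 1) * z3
    + z4 + (m%:R + 1) * P + H + N5.
Proof.
rewrite /mm /chi /phi => r0 -> -> -> -> -> -> -> -> -> -> -> ->.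
by rewrite -[m.+2]addn2 natrD; field.
Qed.

Lemma energy_sum (R : realType) (k w v r p q s eps : R) :
  0 <= q -> 0 <= s -> k * (- eps) <= k * p ->
  w + k * v + r <= w + k * v + r + k * p + q + s + k * eps.
Proof. by rewrite mulrN; move: (k * p) (k * v) (k * eps) => x1 x2 x3; lra. Qed.

Section main_estimate.
Context {R : realType} {n : nat} (rad : \bar R) (r1 r2 : R).
Hypothesis r1_gt0 : 0 < r1.
Hypothesis r2_rad : (r2%:E < rad)%E.
Variables (V W f : R -> R).
Hypothesis VWf : bessel_pair n.+2 rad V W f.
Hypothesis V_ge0 : forall r, radii rad r -> 0 <= V r.
Hypothesis V_C2 : C2_on (radii rad) V.
Hypothesis V_ineq : forall r, radii rad r ->
  0 <= (n.+2%:R - 5) * (V r / r ^+ 2) + 3 * (derive1 V r / r) - derive1 (derive1 V) r.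
Local Notation X := ('rV[R]_n * R)%type.
Local Notation Om := (@Om R n rad).
Local Notation oO := (@open_Om R n rad).
Local Notation AS := (@AS R n r1 r2).
Local Notation bbA := (bb_AS r1_gt0 r2_rad).
Local Notation B := (Bc V f).
Local Notation N := (Nc V f).
Local Notation V1 := (derive1 V).
Variables (i0 : 'I_n) (u : X -> R).
Hypothesis su : smooth_on Om u.
Hypothesis au : AS u.
Implicit Types (p : X).

Definition weight r := V r * (r^-1 * r^-1).
Local Notation phi := weight.

Lemma weight_C1 : C1_on (radii rad) phi.
Proof.
by apply: C1_onM; [exact: V_C2.1|apply: C1_onM; exact: C1_on_inv].
Qed.

Lemma weight_ge0 r : radii rad r -> 0 <= phi r.
Proof. by move=> rr; rewrite mulr_ge0 ?V_ge0// -expr2 sqr_ge0. Qed.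

Let g := EE u.
Let a := qf u u.
Let b := qf u g.
Let d := qf g g.

Let sg : smooth_on Om g := smE su.
Let sa : smooth_on Om a := smq su su.
Let sb : smooth_on Om b := smq su sg.
Let sd : smooth_on Om d := smq sg sg.
Let sgg : smooth_on Om (EE g) := smE sg.
Let ag : AS g := AS_E au.
Let aa : AS a := AS_ql u au.
Let ab : AS b := AS_ql g au.
Let ad : AS d := AS_ql g ag.
Let agg : AS (EE g) := AS_E ag.

Let Cri : smooth_on Om (fun p : X => (rho p)^-1) := @sm_rinv _ _ rad.
Let CV : Ck Om 1 (fun p => V (rho p)) := Ck1_radial V_C2.1.
Let CV1 : Ck Om 1 (fun p => V1 (rho p)) := Ck1_radial V_C2.2.
Let Cphi : Ck Om 1 (fun p => phi (rho p)) := Ck1_radial weight_C1.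
Let CW : Ck Om 0 (fun p => W (rho p)) := Ck0_W VWf.

Let EE_phi p : Om p ->
  EE (fun p => phi (rho p)) p = rho p * V1 (rho p) * (rho p)^-1 ^+ 2 - 2 * phi (rho p).
Proof.
move=> Op; have Ci : Ck Om 1 (fun p => (rho p)^-1 * (rho p)^-1) := CkM oO (Cri 1) (Cri 1).
rewrite (EEM CV Ci Op) (EEM (Cri 1) (Cri 1) Op) (EE_rinv Op).
rewrite (EE_radial Op (V_C2.1 _ (Om_radii Op)).1) /weight.
by move: (rho p)^-1 (V _) (V1 _) => x y z; ring.
Qed.

Let EE_b p : Om p -> EE b p = d p + qf u (EE g) p - 2 * b p.
Proof. by move=> Op; rewrite (EE_qf (su 2) (sg 2) Op). Qed.

Let EE_a p : Om p -> EE a p = 2 * b p - 2 * a p.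
Proof.
move=> Op; have E : qf (EE u) u p = b p := qv_sym p _ _.
rewrite (EE_qf (su 2) (su 2) Op) E -/(qf u g p) -/(b p) -/(a p).
by move: (a p) (b p) => x y; ring.
Qed.

(* [sig * g ^ 2] is the radial part of the squared gradient of [u]. *)
Let h p := sig p * (g p * g p).
Let Ch : smooth_on Om h := smM (@sm_sig _ _ rad) (smM sg sg).
Let ah : AS h.
Proof. by apply: ASMr; exact: ASMr. Qed.

Let EE_h p : Om p -> EE h p = 2 * sig p * g p * (EE g p - g p).
Proof.
move=> Op; have Cgg : Ck Om 1 (fun p => g p * g p) := smM sg sg 1.
rewrite (EEM (@sm_sig _ _ rad 1) Cgg Op) (EE_sig Op) (EEM (sg 1) (sg 1) Op); ring.
Qed.

(* [Rf] replaces the last density of the theorem: [hardy] absorbs its terms in [f]. *)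
Definition RW p := W (rho p) * (a p + h p).
Definition RV p := (phi (rho p) - V1 (rho p) * (rho p)^-1) * (a p + h p).
Definition Rf p := phi (rho p) * (d p + sig p * (EE g p - g p) ^+ 2) - W (rho p) * h p.

(** The first summand is [phi q(Eu - u, Eu - u)]. Hardy's inequality is applied to [a = q(u, u)],
    for which [E a = 2 q(u, Eu - u)]; the resulting term in [B] is absorbed by a square, as [q] is
    nonnegative at [(Eu - u) - rho (f' / f) u]. *)
Lemma hardy_tangential : bb (fun p => phi (rho p) * (d p - 2 * b p + a p) - W (rho p) * a p) /\
  0 <= I (fun p => phi (rho p) * (d p - 2 * b p + a p) - W (rho p) * a p).
Proof.
pose F p := phi (rho p) * (d p - 2 * b p + a p).
have CF : Ck Om 0 F.
  apply: (CkM oO); first exact: (CkS Cphi).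
  apply: (CkD oO); last exact: (sa 0).
  by apply: (CkB oO); [exact: (sd 0)|apply: (CkZ oO); exact: (sb 0)].
have aF : AS F.
  by apply: ASMr; apply: ASD => //; apply: ASB => //; exact: ASMr.
have CWa : Ck Om 0 (fun p => W (rho p) * a p) by apply: (CkM oO) => //; exact: (sa 0).
have aWa : AS (fun p => W (rho p) * a p) by exact: ASMr.
have CBa : Ck Om 0 (fun p => B (rho p) * ((rho p)^-1 * EE a p)).
  apply: (CkM oO); first exact: (Ck0_B VWf).
  by apply: (CkM oO); [exact: (Cri 0)|exact: (smE sa 0)].
have aBa : AS (fun p => B (rho p) * ((rho p)^-1 * EE a p)).
  by apply: ASMr; apply: ASMr; exact: AS_E.
have bF := bbA CF aF; have bWa := bbA CWa aWa; have bBa := bbA CBa aBa.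
split; first exact: bbB.
have a0 p : 0 <= a p by exact: qv_ge0.
have [mN N0 HN] := hardy r1_gt0 r2_rad VWf V_ge0 (sa 1) aa a0.
have K : forall p, B (rho p) * ((rho p)^-1 * EE a p) - F p <= N (rho p) * a p.
  move=> p; have [hp|hp] := boolP (r1 <= rho p <= r2); last first.
    by rewrite (aF p hp) (aBa p hp) (aa hp) subrr mulr0.
  have Op := annulus_Om r1_gt0 r2_rad hp.
  have V0 := V_ge0 (Om_radii Op).
  have [_ _ f0 _] := VWf; have fr := f0 _ (Om_radii Op).
  have q0 := qv_ge0 p (fun k => 1 * gr g p k +
     - (1 + rho p * (derive1 f (rho p) / f (rho p))) * gr u p k).
  rewrite qv_linl !qv_linr !qv_scalel !qv_scaler in q0.
  rewrite (EE_a Op) -subr_ge0.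
  have := mulr_ge0 (weight_ge0 (Om_radii Op)) q0.
  rewrite (qv_sym p (gr g p) (gr u p)) -/(qf u u p) -/(qf u g p) -/(qf g g p) -/(a p) -/(b p) -/(d p).
  congr (0 <= _); rewrite /F /Bc /Nc /weight.
  move: (Om_rho_neq0 Op) (lt0r_neq0 fr).
  move: (rho p) (V _) (derive1 f _) (f _) (a p) (b p) (d p) => r v f1 f2 x y z rn0 fn0.
  by field; rewrite fn0 rn0.
have bK : bb (fun p => B (rho p) * ((rho p)^-1 * EE a p) - F p) by exact: bbB.
have := I_le_ge0 bK mN N0 K HN.
rewrite (IB bBa bF) (IB bBa bWa) (IB bF bWa).
by move: (I _) (I _) (I _) => x y z; lra.
Qed.

Lemma grZ (k : R) w p : Ck Om 1 w -> Om p ->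
  gr (fun p => k * w p) p = (fun i => k * gr w p i).
Proof.
move=> Cw Op; rewrite (grM (Ck_cst oO 1 k) Cw Op) gr_cst.
by apply/funext => i; rewrite mulr0 add0r.
Qed.

(** Integration by parts along the dilation field, stated as densities of integral zero that can be
    added to an integrand with any coefficient. *)
Lemma I_EEM_eq0 w F : Ck Om 1 w -> Ck Om 1 F -> AS F ->
  let Z p := w p * EE F p + ((n%:R + 2) * w p + EE w p) * F p in
  [/\ bb Z, AS Z & I Z = 0].
Proof.
move=> Cw CF aF Z.
have C1 : Ck Om 0 (fun p => w p * EE F p) by apply: (CkM oO); [exact: CkS|exact: CkE].
have C2 : Ck Om 0 (fun p => ((n%:R + 2) * w p + EE w p) * F p).
  apply: (CkM oO); last exact: CkS.
  by apply: (CkD oO); [apply: (CkZ oO); exact: CkS|exact: CkE].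
have a1 : AS (fun p => w p * EE F p) by apply: ASMr; exact: AS_E.
have a2 : AS (fun p => ((n%:R + 2) * w p + EE w p) * F p) by exact: ASMr.
have b1 := bbA C1 a1; have b2 := bbA C2 a2.
split; [exact: bbD|exact: ASD|].
by rewrite /Z ID// (I_EEM r1_gt0 r2_rad Cw CF aF) addNr.
Qed.

Lemma bb_RHS : [/\ bb RW, bb RV, bb Rf & [/\ AS RW, AS RV & AS Rf]].
Proof.
have Cah : Ck Om 0 (fun p => a p + h p) by apply: (CkD oO); [exact: (sa 0)|exact: (Ch 0)].
have aah : AS (fun p => a p + h p) by exact: ASD.
have CRW : Ck Om 0 RW by exact: (CkM oO).
have CRV : Ck Om 0 RV.
  apply: (CkM oO) => //; apply: (CkB oO); first exact: (CkS Cphi).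
  by apply: (CkM oO); [exact: (CkS CV1)|exact: (Cri 0)].
have CRf : Ck Om 0 Rf.
  apply: (CkB oO); last by apply: (CkM oO) => //; exact: (Ch 0).
  apply: (CkM oO); first exact: (CkS Cphi).
  apply: (CkD oO); first exact: (sd 0).
  apply: (CkM oO); first exact: sm_sig.
  by apply: (CkX oO); apply: (CkB oO); [exact: (sgg 0)|exact: (sg 0)].
have aRW : AS RW by exact: ASMr.
have aRV : AS RV by exact: ASMr.
have aRf : AS Rf.
  apply: ASB; last exact: ASMr.
  apply: ASMr; apply: ASD => //; apply: ASMr => p hp.
  by rewrite (agg hp) (ag hp) subrr expr0n.
by split; [exact: bbA|exact: bbA|exact: bbA|].
Qed.

Definition test_form m p := phi (rho p) * (2 * m p * grushin_op u p - sig p * m p ^+ 2).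

(* [m] is the competitor in [(Lu)^2 / psi >= 2 k Lu - psi k^2], [psi = |gradG rho|^2],
   where [k = rho^-2 * m]. *)
Lemma energy_inequality eps : 0 < eps -> exists m, [/\ Ck Om 0 m, AS m &
  I RW + (n%:R + 1) * I RV + I Rf <= I (test_form m) + (n%:R + 1) * eps].
Proof.
move=> eps0.
have [c [Cc ac cq HP]] := mean_poincare r1_gt0 r2_rad i0 weight_C1 weight_ge0 (su 1) au eps0.
pose y p := u p - c p.
have Cy : Ck Om 1 y := CkB oO (su 1) Cc.
have ay : AS y by exact: ASB.
pose G p := EE g p + n%:R * g p.
have CG : Ck Om 1 G by apply: (CkD oO); [exact: (sgg 1)|apply: (CkZ oO); exact: (sg 1)].
have aG : AS G by apply: ASD => //; exact: ASMr.
pose m p := G p - (n%:R + 1) * y p.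
have Cm : Ck Om 1 m := CkB oO CG (CkZ oO _ Cy).
have am : AS m by apply: ASB => //; exact: ASMr.
exists m; split => //; first exact: CkS.
have [bW bV bf [aW aV af]] := bb_RHS.
pose phm p := phi (rho p) * m p.
have Cphm : Ck Om 1 phm by exact: (CkM oO).
have aphm : AS phm by exact: ASMr.
pose Z1 p := phm p * Sop u p + qf phm u p.
have b11 : bb (fun p => phm p * Sop u p).
  apply: bbA; last exact: ASMl.
  by apply: (CkM oO); [exact: CkS|exact: (Ck_Sop (su 2))].
have b12 : bb (qf phm u) := bbA (Ckq Cphm (su 1)) (AS_ql u aphm).
have b1 : bb Z1 by exact: bbD.
have I1 : I Z1 = 0 by rewrite /Z1 ID// (I_Sop r1_gt0 r2_rad Cphm aphm (su 2)) addNr.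
have a1 : AS Z1 by apply: ASD; [exact: ASMl|exact: AS_ql].
pose Z w F p := w p * EE F p + ((n%:R + 2) * w p + EE w p) * F p.
pose Z2 := Z (fun p => phi (rho p)) b.
have [b2 a2 I2] : [/\ bb Z2, AS Z2 & I Z2 = 0] := I_EEM_eq0 Cphi (sb 1) ab.
pose Z3 := Z (fun p => phi (rho p)) h.
have [b3 a3 I3] : [/\ bb Z3, AS Z3 & I Z3 = 0] := I_EEM_eq0 Cphi (Ch 1) ah.
pose chi p := V1 (rho p) * (rho p)^-1 - phi (rho p).
have Cchi0 : Ck Om 1 (fun p => V1 (rho p) * (rho p)^-1) := CkM oO CV1 (Cri 1).
have Cchi : Ck Om 1 chi by exact: (CkB oO).
pose Z4 := Z chi a.
have [b4 a4 I4] : [/\ bb Z4, AS Z4 & I Z4 = 0] := I_EEM_eq0 Cchi (sa 1) aa.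
pose P p := phi (rho p) * (qf y y p - (n%:R + 1) * sig p * y p ^+ 2).
have b5 : bb P := bb_Pform r1_gt0 r2_rad weight_C1 (n%:R + 1) Cy ay.
have I5 : - eps <= I P := HP.
have a5 : AS P.
  apply: ASMr; apply: ASB; first exact: AS_ql.
  by apply: ASMr => p /ay ->; rewrite expr0n.
pose H p := phi (rho p) * (d p - 2 * b p + a p) - W (rho p) * a p.
have [b6 I6] : bb H /\ 0 <= I H := hardy_tangential.
have a6 : AS H.
  apply: ASB; last exact: ASMr.
  by apply: ASMr; apply: ASD => //; apply: ASB => //; exact: ASMr.
pose N5 p := ((n.+2%:R - 5) * phi (rho p) + 3 * (V1 (rho p) * (rho p)^-1)
   - derive1 V1 (rho p)) * a p.
have CV2 : Ck Om 0 (fun p => derive1 V1 (rho p)).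
  by apply: Ck0_radial => r rr; exact: (V_C2.2 r rr).2.
have a7 : AS N5 by exact: ASMr.
have b7 : bb N5.
  apply: bbA => //; apply: (CkM oO); last exact: (sa 0).
  apply: (CkB oO) => //; apply: (CkD oO); apply: (CkZ oO); first exact: (CkS Cphi).
  exact: (CkS Cchi0).
have I7 : 0 <= I N5.
  apply: I_ge0 => p; have [hp|hp] := boolP (r1 <= rho p <= r2); last by rewrite (a7 p hp).
  have Op := annulus_Om r1_gt0 r2_rad hp.
  apply: mulr_ge0; last exact: qv_ge0.
  by have := V_ineq (Om_radii Op); rewrite /phi -expr2 exprVn.
have aT : AS (test_form m).
  apply: ASMr; apply: ASB; last by apply: ASMr => p /am ->; rewrite expr0n.
  by apply: ASMl => p /am ->; rewrite mulr0.
(* [Z1] to [Z4] have integral zero, and their coefficients eliminate [Sop u], [q(u, EEu)] and the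
   mixed terms. What remains besides [RW], [RV] and [Rf] is [P] for the spectral gap, [H] for
   Hardy's inequality on the tangential part, and [N5] for the hypothesis on [V]. *)
have main p : test_form m p = 
    RW p + (n%:R + 1) * RV p + Rf p + 2 * Z1 p + (-2) * Z2 p + (n%:R + 1) * Z3 p
    + Z4 p + (n%:R + 1) * P p + H p + N5 p.
  have [hp|hp] := boolP (r1 <= rho p <= r2); last first.
    rewrite (aT p hp) (aW p hp) (aV p hp) (af p hp) (a1 p hp) (a2 p hp) (a3 p hp) (a4 p hp).
    by rewrite (a5 p hp) (a6 p hp) (a7 p hp) !mulr0 !addr0.
  have Op := annulus_Om r1_gt0 r2_rad hp.
  have cq' w : qv p (gr c p) w = 0 by exact: cq.
  have qc w : qv p w (gr c p) = 0 by rewrite qv_sym.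
  have gy : gr y p = (fun k => (-1) * gr c p k + gr u p k) by exact: grB (su 1) Cc Op.
  have qyy : qf y y p = a p.
    by rewrite /qf gy !qv_linl !qv_linr !cq' !qc !(mulr0, add0r).
  have qyu : qf y u p = a p by rewrite /qf gy qv_linl cq' mulr0 add0r.
  have qmu : qf m u p = (-1) * ((n%:R + 1) * a p) + (1 * qf u (EE g) p + n%:R * b p).
    rewrite {1}/qf (grB CG (CkZ oO _ Cy) Op) qv_linl (grZ _ Cy Op) qv_scalel.
    rewrite (grD (sgg 1) (CkZ oO _ (sg 1)) Op) qv_linl (grZ _ (sg 1) Op) qv_scalel.
    have cong (k l x x' y1 y1' z z' : R) : x = x' -> y1 = y1' -> z = z' ->
      (-1) * (k * x) + (1 * y1 + l * z) = (-1) * (k * x') + (1 * y1' + l * z').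
      by move=> -> -> ->.
    exact: (cong _ _ _ _ _ _ _ _ qyu (qv_sym p (gr (EE g) p) (gr u p))
      (qv_sym p (gr g p) (gr u p))).
  have qphm : qf phm u p = phi (rho p) * qf m u p.
    rewrite {1}/qf (grM Cphi Cm Op) qv_linl qv_scalel.
    by rewrite (qv_radial _ Op (weight_C1 (Om_radii Op)).1) mulr0 add0r.
  have Echi : EE chi p = derive1 V1 (rho p) - V1 (rho p) * (rho p)^-1 - EE (fun p => phi (rho p)) p.
    rewrite (EEB Cchi0 Cphi Op) (EEM CV1 (Cri 1) Op) (EE_rinv Op).
    rewrite (EE_radial Op (V_C2.2 _ (Om_radii Op)).1); have := Om_rho_neq0 Op.
    by move: (rho p) (derive1 V1 _) (V1 _) (EE _ _) => r v1 v2 x rn0; field.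
  have EL : grushin_op u p = Sop u p + sig p * G p by rewrite /Sop subrK.
  apply: (energy_identity (Om_rho_neq0 Op) (q := qf u (EE g) p) (s := sig p)
    (a := a p) (b := b p) (d := d p) (g := g p) (gg := EE g p) (y := y p) (S := Sop u p)
    (v := V (rho p)) (v1 := V1 (rho p)) (v2 := derive1 V1 (rho p)) (w := W (rho p))
    (phi' := EE (fun p => phi (rho p)) p)).
  - exact: EE_phi.
  - by rewrite /test_form EL.
  - by [].
  - by [].
  - by [].
  - by rewrite /Z1 qphm qmu.
  - by rewrite /Z2 /Z (EE_b Op).
  - by rewrite /Z3 /Z (EE_h Op).
  - by rewrite /Z4 /Z Echi (EE_a Op).
  - by rewrite /P qyy.
  - by [].
  - by [].
have b23 := bbZ (-2) b2; have b33 := bbZ (n%:R + 1) b3; have b53 := bbZ (n%:R + 1) b5.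
have bV3 := bbZ (n%:R + 1) bV; have b13 := bbZ 2 b1.
have B1 := bbD bW bV3; have B2 := bbD B1 bf; have B3 := bbD B2 b13; have B4 := bbD B3 b23.
have B5 := bbD B4 b33; have B6 := bbD B5 b4; have B7 := bbD B6 b53; have B8 := bbD B7 b6.
rewrite (eq_I main) (ID B8 b7) (ID B7 b6) (ID B6 b53) (ID B5 b4) (ID B4 b33) (ID B3 b23).
rewrite (ID B2 b13) (ID B1 bf) (ID bW bV3) !IZ// I1 I2 I3 I4 !mulr0 !addr0.
have k0 : 0 <= n%:R + 1 :> R by rewrite addr_ge0.
have I5' := ler_wpM2l k0 I5.
exact: energy_sum I6 I7 I5'.
Qed.

End main_estimate.

(** * Lower bound for the left-hand side *)

Section integral_comparison.
Context {R : realType} {n : nat} (rad : \bar R) (r1 r2 : R).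
Hypothesis r1_gt0 : 0 < r1.
Hypothesis r2_rad : (r2%:E < rad)%E.
Variables (V W f : R -> R).
Hypothesis VWf : bessel_pair n.+2 rad V W f.
Hypothesis V_ge0 : forall r, radii rad r -> 0 <= V r.
Hypothesis V_C2 : C2_on (radii rad) V.
Local Notation T := (measurableTypeR R).
Local Notation X := ('rV[R]_n * R)%type.
Local Notation XT := ('rV[T]_n * T)%type.
Local Notation mu := (@grushin_measure R n).
Local Notation Om := (@Om R n rad).
Local Notation oO := (@open_Om R n rad).
Local Notation AS := (@AS R n r1 r2).
Local Notation bbA := (bb_AS r1_gt0 r2_rad).
Variables (i0 : 'I_n) (u : X -> R).
Hypothesis su : smooth_on Om u.
Hypothesis au : AS u.
Implicit Types (p : X).

Lemma sqnorm_gradG (g : X -> R) p : sqnorm (gradG g p) = qf g g p + sig p * EE g p ^+ 2.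
Proof.
rewrite /qf /qv expr2 subrK /sqnorm (enorm_sqr (gradG g p)) /= exprMn enorm_sqr /Gv -expr2.
by congr (_ + _); apply: eq_bigr => i _; rewrite mxE expr2.
Qed.

Lemma ball_integral (F : X -> R) : AS F ->
  (\int[mu]_(p in grushin_ball rad) (F p)%:E = \int[mu]_p (F p)%:E)%E.
Proof.
move=> aF; rewrite integral_mkcond; apply: eq_integral => p _; rewrite patchE.
case: ifPn => // pB; rewrite aF//; apply: contra pB => /(annulus_Om r1_gt0 r2_rad) Op.
by rewrite inE; exact: Op.1.
Qed.

Lemma AS_op : AS (grushin_op u).
Proof.
move=> p h; rewrite /grushin_op (AS_partial None (AS_partial None au) h) mulr0 addr0.
by rewrite big1// => i _; rewrite (AS_partial _ (AS_partial _ au) h).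
Qed.

(** On this axis [|gradG rho|^2] vanishes and the quotient in [lhs_integrand] is 0 by convention, so
    the pointwise comparison with [test_form] can fail there. *)
Lemma axis_null : mu.-negligible [set p : XT | p.1 = 0].
Proof.
pose A : set 'rV[T]_n := [set x | forall i, [set (0 : T)] (x ord0 i)].
have mA : measurable A by apply: (@measurable_rV_box _ n (fun=> [set (0 : T)])) => i; exact: measurable_set1.
have -> : [set p : XT | p.1 = 0] = A `*` setT.
  apply/seteqP; split => -[x t] /=; first by move=> ->; split => // i /=; rewrite mxE.
  by move=> [hx _]; apply/rowP => i; rewrite hx mxE.
exists (A `*` setT); split => //; first exact: measurableX.
have A0 : lebesgue_rV n A = 0%E.
  apply: (eq_trans (@lebesgue_rV_box R n (fun=> [set (0 : T)]) (fun=> measurable_set1 _))).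
  by rewrite (bigD1 i0)//= lebesgue_measure_set1 mul0e.
rewrite /grushin_measure /= product_measure1E//; apply: eq_trans (mul0e _).
by congr (_ * _)%E; exact: A0.
Qed.

Lemma s2_continuous : continuous (@s2 R n).
Proof.
move=> p; have C0 : Ck [set: X] 0 s2.
  apply: (Ck_sum openT) => i; apply: (CkX openT); exact: (Ck_pcoord openT (Some i)).
exact: (Ck_cont C0 Logic.I).
Qed.

Definition lhs_integrand p := V (rho p) * (grushin_op u p ^+ 2 / sqnorm (gradG rho p)).

Lemma AS_lhs : AS lhs_integrand.
Proof. by move=> p /AS_op h; rewrite /lhs_integrand h expr0n/= mul0r mulr0. Qed.

Lemma sqnorm_gradG_rho p : Om p -> sqnorm (gradG rho p) = sig p * rho p ^+ 2.
Proof. by move=> Op; rewrite sqnorm_gradG /qf (qv_rho _ Op) add0r (EE_rho Op). Qed.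

Lemma measurable_lhs : measurable_fun [set: XT] lhs_integrand.
Proof.
pose K p := V (rho p) * rho p ^+ 2 * grushin_op u p ^+ 2.
have CK : Ck Om 0 K.
  apply: (CkM oO); last by apply: (CkX oO); exact: (Ck_op (su 2)).
  by apply: (CkM oO); [exact: (CkS (Ck1_radial V_C2.1))|exact: (smX 2 (@sm_rho _ _ rad) 0)].
have aK : AS K by move=> p /AS_op h; rewrite /K h expr0n/= mulr0.
(* The power with exponent -1 is the inverse, with value 0 at 0, so the identity also holds on the
   axis. *)
have -> : lhs_integrand = (fun p => K p * (s2 p `^ (-1))).
  apply/funext => p; have [h|h] := boolP (r1 <= rho p <= r2); last first.
    by rewrite (AS_lhs h) (aK p h) mul0r.
  have Op := annulus_Om r1_gt0 r2_rad h; have r0 := Om_rho_neq0 Op.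
  rewrite (powR_inv1 (s2_ge0 p)) /lhs_integrand (sqnorm_gradG_rho Op) /sig /K.
  move: (rho p) (V _) (grushin_op u p) (s2 p) r0 => r v x y r0.
  have [->|y0] := eqVneq y 0; first by rewrite !mul0r invr0 !mulr0.
  by field; rewrite y0 r0.
apply: measurable_funM; first exact: (bbA CK aK).1.
apply: (measurableT_comp (measurable_powR (-1))).
exact: measurable_continuous s2_continuous.
Qed.

Lemma lhs_ge0 p : 0 <= lhs_integrand p.
Proof.
have [h|h] := boolP (r1 <= rho p <= r2); last by rewrite (AS_lhs h).
have V0 := V_ge0 (Om_radii (annulus_Om r1_gt0 r2_rad h)).
apply: mulr_ge0 => //; apply: divr_ge0; first exact: sqr_ge0.
by apply: addr_ge0; exact: sqr_ge0.
Qed.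

(** On the annulus the difference of the two sides is [V rho^-2 (Lu - sig m)^2 / sig]. *)
Lemma test_form_le m p : AS m -> p.1 != 0 -> test_form V u m p <= lhs_integrand p.
Proof.
move=> am p0; have [h|h] := boolP (r1 <= rho p <= r2); last first.
  by rewrite (AS_lhs h) /test_form (am p h) mulr0 mul0r expr0n/= mulr0 subr0 mulr0.
have Op := annulus_Om r1_gt0 r2_rad h; have r0 := Om_rho_gt0 Op.
have V0 := V_ge0 (Om_radii Op).
have s0 : 0 < sig p.
  rewrite mulr_gt0 ?exprn_gt0 ?invr_gt0// lt_neqAle s2_ge0 andbT eq_sym.
  by rewrite s2_eq0.
rewrite /lhs_integrand (sqnorm_gradG_rho Op) /test_form /weight.
have rn0 := Om_rho_neq0 Op; have sn0 : sig p != 0 by rewrite gt_eqF.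
rewrite -subr_ge0.
have : 0 <= V (rho p) * (rho p)^-1 ^+ 2 * ((grushin_op u p - sig p * m p) ^+ 2 / sig p).
  apply: mulr_ge0; first by apply: mulr_ge0 => //; exact: sqr_ge0.
  by apply: divr_ge0; [exact: sqr_ge0|exact: ltW].
congr (0 <= _).
move: (rho p) (V _) (grushin_op u p) (sig p) (m p) rn0 sn0 => r v x s y rn0 sn0.
by field; rewrite sn0 rn0.
Qed.

Lemma bb_norm (g : X -> R) : bb g -> bb (fun p => `|g p|).
Proof.
move=> [mg [C [M h]]]; split; first exact: measurableT_comp.
by exists C, M => p; rewrite normr_id; have [h1 h2] := h p; split => // /h2 ->; rewrite normr0.
Qed.

Lemma lhs_lower_bound m : Ck Om 0 m -> AS m ->
  ((I (test_form V u m))%:E <= \int[mu]_p (lhs_integrand p)%:E)%E.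
Proof.
move=> Cm am; pose t := test_form V u m.
have Ct : Ck Om 0 t.
  apply: (CkM oO); first exact: (CkS (Ck1_radial (weight_C1 V_C2))).
  apply: (CkB oO).
    by apply: (CkM oO); [exact: (CkZ oO)|exact: (Ck_op (su 2))].
  by apply: (CkM oO); [exact: (@sm_sig _ _ rad 0)|exact: (CkX oO)].
have at' : AS t.
  apply: ASMr; apply: ASB; first by apply: ASMl => p /am ->; rewrite mulr0.
  by apply: ASMr => p /am ->; rewrite expr0n.
have bt : bb t := bbA Ct at'.
(* The integral on the left may be infinite, so nonnegative functions are compared: the positive
   part of [t], set to 0 on the null axis. *)
pose tp p := 2^-1 * (t p + `|t p|).
have btp : bb tp by apply: bbZ; apply: bbD => //; exact: bb_norm.
have tp0 p : 0 <= tp p.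
  by rewrite mulr_ge0 ?invr_ge0//; have := lerNnormlW (lexx `|t p|); lra.
have ttp p : t p <= tp p by rewrite /tp; have := ler_norm (t p); lra.
have tpl p : p.1 != 0 -> tp p <= lhs_integrand p.
  move=> p0; have := test_form_le am p0; have := lhs_ge0 p; rewrite -/(t p) /tp.
  by move: (lhs_integrand p) (t p) => l x; case: (ger0P x); lra.
pose ax : set XT := [set p | p.1 = 0].
have max : measurable ax.
  have -> : ax = (fun p : X => s2 p) @^-1` [set 0].
    apply/seteqP; split => p /=; rewrite /ax /=.
      by move=> h; apply/eqP; rewrite s2_eq0 h.
    by move=> /eqP; rewrite s2_eq0 => /eqP.
  by rewrite -[X in measurable X]setTI; apply: (measurable_continuous s2_continuous).
pose tq p := tp p * \1_(~` ax) p.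
have mtq : measurable_fun [set: XT] tq.
  apply: measurable_funM; first exact: btp.1.
  by apply: measurable_indic; exact: measurableC.
have tq0 p : 0 <= tq p by rewrite mulr_ge0// indicE.
apply: (@le_trans _ _ (I tp)%:E); first by rewrite lee_fin; exact: I_le.
rewrite -integral_bb//.
have -> : (\int[mu]_p (tp p)%:E = \int[mu]_p (tq p)%:E)%E.
  apply: ge0_ae_eq_integral.
  - exact: measurableT.
  - exact: ((measurable_EFinP _ _).2 btp.1).
  - exact: ((measurable_EFinP _ _).2 mtq).
  - by move=> p _; rewrite lee_fin.
  - by move=> p _; rewrite lee_fin.
  apply: negligibleS axis_null => p /= h.
  apply: contrapT => pa; apply: h => _.
  by rewrite /tq indicE mem_set// mulr1.
apply: ge0_le_integral.
- exact: measurableT.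
- by move=> p _; rewrite lee_fin.
- exact: ((measurable_EFinP _ _).2 mtq).
- exact: ((measurable_EFinP _ _).2 measurable_lhs).
- move=> p _; rewrite lee_fin /tq indicE; case: (boolP (p \in ~` ax)).
    by rewrite inE /ax /= => /eqP p0; rewrite mulr1; exact: tpl.
  by rewrite mulr0 => _; exact: lhs_ge0.
Qed.

End integral_comparison.

(** * The integral of the term in [f] *)

Section radial_energy.
Context {R : realType} {n : nat} (rad : \bar R) (r1 r2 : R).
Hypothesis r1_gt0 : 0 < r1.
Hypothesis r2_rad : (r2%:E < rad)%E.
Variables (V W f : R -> R).
Hypothesis VWf : bessel_pair n.+2 rad V W f.
Hypothesis V_ge0 : forall r, radii rad r -> 0 <= V r.
Hypothesis V_C2 : C2_on (radii rad) V.
Local Notation X := ('rV[R]_n * R)%type.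
Local Notation mu := (@grushin_measure R n).
Local Notation Om := (@Om R n rad).
Local Notation oO := (@open_Om R n rad).
Local Notation AS := (@AS R n r1 r2).
Local Notation bbA := (bb_AS r1_gt0 r2_rad).
Local Notation B := (Bc V f).
Local Notation N := (Nc V f).
Variable u : X -> R.
Hypothesis su : smooth_on Om u.
Hypothesis au : AS u.
Implicit Types (p : X).

Definition radial_quotient p := radial_derivative u p / f (rho p).

Definition radial_energy p :=
  V (rho p) * sqnorm (gradG radial_quotient p) * f (rho p) ^+ 2.

Lemma AS_radial_energy : AS radial_energy.
Proof.
have aw : AS radial_quotient.
  by move=> p h; rewrite /radial_quotient -[radial_derivative u p]/((rho p)^-1 * EE u p) (AS_E au h) mulr0 mul0r.
move=> p h; rewrite /radial_energy sqnorm_gradG /EE /qf (AS_gr aw h).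
have -> : (fun=> 0 : R) = (fun k : option 'I_n => 0 * (0 : R)) by apply/funext => k; rewrite mul0r.
by rewrite qv_scalel Ev_scale !mul0r expr0n/= mulr0 addr0 mulr0 mul0r.
Qed.

Lemma qf_rinv (g : X -> R) p : Ck Om 1 g -> Om p ->
  qf (fun p => (rho p)^-1 * g p) (fun p => (rho p)^-1 * g p) p = (rho p)^-1 ^+ 2 * qf g g p.
Proof.
move=> Cg Op; rewrite /qf (grM (@sm_rinv _ _ rad 1) Cg Op).
have q0 c : qv p (gr (fun p => (rho p)^-1) p) c = 0.
  by rewrite (grV (@sm_rho _ _ rad 1) Op (Om_rho_neq0 Op)) qv_scalel (qv_rho _ Op) mulr0.
have q0' c : qv p c (gr (fun p => (rho p)^-1) p) = 0 by rewrite qv_sym.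
rewrite qv_linl qv_linr !qv_scalel !qv_linr !qv_scaler !q0 q0'.
by move: (qv _ _ _) (rho p)^-1 (g p) => x y z; ring.
Qed.

(** The terms that come from differentiating [1 / f] collect into [B] and [N]. With [h = sig (Eu)^2]
    the factor of [B] is [E h / rho] and that of [N] is [h], the two quantities linked by
    [hardy]. *)
Lemma radial_energyE p : Om p -> radial_energy p =
  weight V (rho p) * (qf (EE u) (EE u) p + sig p * (EE (EE u) p - EE u p) ^+ 2)
  - B (rho p) * ((rho p)^-1 * (2 * sig p * EE u p * (EE (EE u) p - EE u p)))
  + N (rho p) * (sig p * (EE u p * EE u p)).
Proof.
move=> Op; have rr := Om_radii Op; have [_ _ f0 sol] := VWf.
have fr := f0 _ rr; have [df _ _] := sol _ rr; have fn0 : f (rho p) != 0 by rewrite gt_eqF.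
have Cg : Ck Om 1 (EE u) := smE su 1.
pose z p := (rho p)^-1 * EE u p.
have Cz : Ck Om 1 z := CkM oO (@sm_rinv _ _ rad 1) Cg.
pose c := - (z p * ((f (rho p))^-1 ^+ 2 * derive1 f (rho p))).
have E : gr radial_quotient p = (fun k => (f (rho p))^-1 * gr z p k + c * gr rho p k).
  apply/funext => k; apply: grE.
  have h1 : is_derive (rho p) 1 f (derive1 f (rho p)) by rewrite derive1E; exact: derivableP.
  have h2 := isD_comp h1 (Ck_isD k (@sm_rho _ _ rad 1) Op).
  apply: isD_eq (isD_mul (Ck_isD k Cz Op) (isD_inv fn0 h2)) _.
  by rewrite /c /gr; move: (partial k z p) (partial k rho p) (derive1 f _) (f _)^-1 (z p) => *; ring.
have Ez : EE z p = (rho p)^-1 * (EE (EE u) p - EE u p).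
  by rewrite /z (EEM (@sm_rinv _ _ rad 1) Cg Op) (EE_rinv Op); ring.
have Ew : EE radial_quotient p = (f (rho p))^-1 * EE z p + c * rho p.
  by rewrite {1}/EE E Ev_lin Ev_scale -/(EE rho p) (EE_rho Op).
have qw : qf radial_quotient radial_quotient p = (f (rho p))^-1 ^+ 2 * ((rho p)^-1 ^+ 2 * qf (EE u) (EE u) p).
  rewrite -(qf_rinv Cg Op) /qf E qv_linl !qv_linr !qv_scalel !qv_scaler.
  rewrite !(qv_rho _ Op) (qv_sym p _ (gr rho p)) !(qv_rho _ Op) -/z.
  by move: (qv p (gr z p) (gr z p)) (f _)^-1 => x y; ring.
rewrite /radial_energy sqnorm_gradG qw Ew Ez /c /z /weight /Bc /Nc.
have rn0 := Om_rho_neq0 Op.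
move: (rho p) (f _) (derive1 f _) (V _) (sig p) (EE (EE u) p) (EE u p) (qf _ _ p) fn0 rn0.
move=> r k k' v s gg g q kn0 rn0.
by field; rewrite kn0 rn0.
Qed.

(** Apart from [N h], with [h = sig (Eu)^2], the energy is continuous and supported in the annulus.
    [hardy] bounds the integral of [N h] by that of [B E h / rho - W h], after which the terms in
    [B] cancel. *)
Lemma radial_energy_le :
  (\int[mu]_p (radial_energy p)%:E <= (I (Rf V W u))%:E)%E.
Proof.
pose g := EE u; pose h p := sig p * (g p * g p).
have sg : smooth_on Om g := smE su.
have ag : AS g := AS_E au.
have sh : smooth_on Om h := smM (@sm_sig _ _ rad) (smM sg sg).
have ah : AS h by apply: ASMr; exact: ASMr.
have h0 p : 0 <= h p by rewrite mulr_ge0 ?sig_ge0// -expr2 sqr_ge0.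
have [mN N0 HN] := hardy r1_gt0 r2_rad VWf V_ge0 (sh 1) ah h0.
pose Bh p := B (rho p) * ((rho p)^-1 * EE h p).
have bBh : bb Bh.
  apply: bbA.
    apply: (CkM oO); first exact: (Ck0_B VWf).
    by apply: (CkM oO); [exact: (@sm_rinv _ _ rad 0)|exact: (smE sh 0)].
  by apply: ASMr; apply: ASMr; exact: AS_E.
have aBh : AS Bh by apply: ASMr; apply: ASMr; exact: AS_E.
have bWh : bb (fun p => W (rho p) * h p).
  by apply: bbA; [apply: (CkM oO); [exact: (Ck0_W VWf)|exact: (sh 0)]|exact: ASMr].
have [_ _ bf [_ _ af]] := bb_RHS r1_gt0 r2_rad VWf V_C2 su au.
pose G p := Rf V W u p - (Bh p - W (rho p) * h p).
have bG : bb G := bbB bf (bbB bBh bWh).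
have EG : I (Rf V W u) = I G + I (fun p => Bh p - W (rho p) * h p).
  by rewrite -(ID bG (bbB bBh bWh)); apply: eq_I => p; rewrite /G subrK.
have -> : (\int[mu]_p (radial_energy p)%:E = \int[mu]_p (G p + N (rho p) * h p)%:E)%E.
  apply: eq_integral => p _; congr EFin; have [hp|hp] := boolP (r1 <= rho p <= r2); last first.
    by rewrite (AS_radial_energy hp) /G (af p hp) (aBh p hp) (ah p hp) !mulr0 !subrr add0r.
  have Op := annulus_Om r1_gt0 r2_rad hp.
  have Eh : EE h p = 2 * sig p * g p * (EE g p - g p).
    rewrite (EEM (@sm_sig _ _ rad 1) (smM sg sg 1) Op) (EE_sig Op) (EEM (sg 1) (sg 1) Op).
    by move: (sig p) (g p) (EE g p) => x y z; ring.
  rewrite (radial_energyE Op) /G /Bh Eh /Rf.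
  by rewrite -/g -/(h p); move: (weight V _) (B _) (N _) (W _) (rho p)^-1 => *; ring.
rewrite EG; exact: integral_bbD.
Qed.

End radial_energy.

(** * Reduction to an annulus and passage to the limit *)

Lemma compact_annulus (R : realType) (n : nat) (rad : \bar R) (K : set ('rV[R]_n * R)) :
  (0 < rad)%E -> compact K -> K `<=` grushin_ball rad `\ (0 : 'rV[R]_n * R) ->
  exists r1 r2, [/\ 0 < r1, (r2%:E < rad)%E & forall p, K p -> r1 <= rho p <= r2].
Proof.
(* An empty support fits into any annulus, but a radius below [rad] has to be produced; otherwise
   [rho] attains its extrema on [K]. *)
move=> rad0 cK KO; have [K0|/set0P[p0 Kp0]] := eqVneq K set0.
  have [r r0 rr] : exists2 r : R, 0 < r & (r%:E < rad)%E.
    case: (rad) rad0 => [x| |]//; last by move=> _; exists 1 => //; exact: ltry.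
    rewrite lte_fin => x0; exists (x / 2); first by rewrite divr_gt0.
    by rewrite lte_fin ltr_pdivrMr// ltr_pMr// ltr1n.
  by exists r, r; split => // p; rewrite K0.
have wc : {within K, continuous (@rho R n)}.
  by apply: continuous_subspaceT; exact: rho_continuous.
have [q /set_mem Kq Hq] := compact_EVT_max (ex_intro _ p0 Kp0) cK wc.
have [q' /set_mem Kq' Hq'] := compact_EVT_min (ex_intro _ p0 Kp0) cK wc.
have [_ q0] := (OmP rad q).1 (KO _ Kq).
have [q'0 _] := (OmP rad q').1 (KO _ Kq').
exists (rho q'), (rho q); split => [||p Kp]; [exact: rho_gt0|by []|].
by rewrite Hq ?Hq' ?inE.
Qed.

Theorem theorem1p3 (R : realType) (n Q : nat) (rad : \bar R)
    (V W f : R -> R) (u : 'rV[R]_n * R -> R)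
    (n_ge2 : (2 <= n)%N) (QE : Q = n.+2) (rad_gt0 : (0 < rad)%E)
    (VWf : bessel_pair Q rad V W f)
    (V_ge0 : forall r, radii rad r -> 0 <= V r)
    (V_C2 : C2_on (radii rad) V)
    (V_ineq : forall r, radii rad r ->
      0 <= (Q%:R - 5) * (V r / r ^+ 2) + 3 * (derive1 V r / r) - derive1 (derive1 V) r)
    (u_test : test_function (grushin_ball rad `\ (0 : 'rV[R]_n * R)) u) :
  (\int[grushin_measure n]_(p in grushin_ball rad)
      (V (rho p) * (grushin_op u p ^+ 2 / sqnorm (gradG rho p)))%:E >=
   \int[grushin_measure n]_(p in grushin_ball rad)
      (W (rho p) * sqnorm (gradG u p))%:E
   + (Q%:R - 1)%:E * \int[grushin_measure n]_(p in grushin_ball rad)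
      ((V (rho p) / rho p ^+ 2 - derive1 V (rho p) / rho p)
       * sqnorm (gradG u p))%:E
   + \int[grushin_measure n]_(p in grushin_ball rad)
      (V (rho p)
       * sqnorm (gradG (fun q => radial_derivative u q / f (rho q)) p)
       * f (rho p) ^+ 2)%:E)%E.
Proof.
subst Q; have [su_ cK KO] := u_test.
have su : smooth_on (Om rad) u := smooth_onP _ su_.
have [r1 [r2 [r1_gt0 r2_rad HK]]] := compact_annulus rad_gt0 cK KO.
have au : AS r1 r2 u.
  move=> p hp; apply/eqP; apply: contraNT hp => up; apply: HK.
  exact: (@subset_closure _ [set p | u p != 0]).
have i0 : 'I_n := Ordinal (ltnW n_ge2).
have [bW bV bf [aW aV af]] := bb_RHS r1_gt0 r2_rad VWf V_C2 su au.
have k0 : 0 < n%:R + 1 :> R by rewrite ltr_wpDl.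
have -> : (\int[grushin_measure n]_(p in grushin_ball rad)
    (V (rho p) * (grushin_op u p ^+ 2 / sqnorm (gradG rho p)))%:E =
    \int[grushin_measure n]_p (lhs_integrand V u p)%:E)%E.
  exact: (ball_integral r1_gt0 r2_rad (AS_lhs V au)).
have -> : (\int[grushin_measure n]_(p in grushin_ball rad) (W (rho p) * sqnorm (gradG u p))%:E =
    (I (RW W u))%:E)%E.
  rewrite -integral_bb// -(ball_integral r1_gt0 r2_rad aW).
  by apply: eq_integral => p _; rewrite sqnorm_gradG expr2.
have -> : (\int[grushin_measure n]_(p in grushin_ball rad)
    ((V (rho p) / rho p ^+ 2 - derive1 V (rho p) / rho p) * sqnorm (gradG u p))%:E =
    (I (RV V u))%:E)%E.
  rewrite -integral_bb// -(ball_integral r1_gt0 r2_rad aV).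
  by apply: eq_integral => p _; rewrite sqnorm_gradG expr2 /RV /weight -invfM -expr2.
have -> : (\int[grushin_measure n]_(p in grushin_ball rad)
    (V (rho p) * sqnorm (gradG (fun q => radial_derivative u q / f (rho q)) p) * f (rho p) ^+ 2)%:E =
    \int[grushin_measure n]_p (radial_energy V f u p)%:E)%E.
  exact: (ball_integral r1_gt0 r2_rad (AS_radial_energy V f au)).
have -> : n.+2%:R - 1 = n%:R + 1 :> R by rewrite -addn2 natrD; ring.
(* The competitor [m] depends on the error allowed, so only the final inequality is free of it.
   Dividing [eps] by [n + 1] compensates for the factor in front of the error in
   [energy_inequality]. *)
apply/lee_addgt0Pr => eps eps0.
have e0 : 0 < eps / (n%:R + 1) by rewrite divr_gt0.
have [m [Cm am Hm]] := energy_inequality r1_gt0 r2_rad VWf V_ge0 V_C2 V_ineq i0 su au e0.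
rewrite [X in _ <= _ + X]mulrC divfK ?gt_eqF// in Hm.
have L1 := lhs_lower_bound r1_gt0 r2_rad V_ge0 V_C2 i0 su au Cm am.
have L2 := radial_energy_le r1_gt0 r2_rad VWf V_ge0 V_C2 su au.
apply: (le_trans (leeD2l _ L2)); rewrite -EFinM -!EFinD.
apply: (@le_trans _ _ (I (test_form V u m) + eps)%:E); first by rewrite lee_fin.
by rewrite EFinD leeD2r.
Qed.
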